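(* Let $\Gamma$ be a (discrete) torsion free abelian group that contains a subgroup isomorphic to $\mathbb{Z}^3$, let $G$ be the connected compact abelian group whose character group is $\Gamma$, let $\preceq$ be a linear order making $\Gamma$ an ordered group, and let $\mathcal{B}\subseteq C(G)$ be an admissible algebra. Then for every natural $n\ge 2$ there exist infinitely many pathwise connected components of $GL(\mathcal{B}^{n\times n})$ with the property that each one of these components does not intersect the minimal closed (relative to $GL(\mathcal{B}^{n\times n})$) subgroup of $GL(\mathcal{B}^{n\times n})$ containing $GLF(\mathcal{B}^{n\times n})$. In particular, the minimal closed subgroup of $GL(\mathcal{B}^{n\times n})$ containing $GLF(\mathcal{B}^{n\times n})$ is not dense in $GL(\mathcal{B}^{n\times n})$.
   Context: $G$ is a connected compact abelian group (written multiplicatively) with (discrete, torsion free, additively written) character group $\Gamma$; $\langle j,g\rangle\in\mathbb{T}$ is the value of the character $j\in\Gamma$ at $g\in G$. A linear order $\preceq$ on $\Gamma$ making it an ordered group is fixed; $\Gamma_+=\{x\in\Gamma: x\succeq 0\}$, $\Gamma_-=\{x\in\Gamma: x\preceq 0\}$. $C(G)$ is the algebra of continuous complex functions on $G$ with the sup norm, and $P(G)$ is its subalgebra of finite linear combinations of the functions $\langle j,\cdot\rangle$, $j\in\Gamma$. The Bohr-Fourier spectrum of $a\in C(G)$ is the set $\sigma(a)$ of $j\in\Gamma$ for which the Bohr-Fourier coefficient $\int_G a(g)\overline{\langle j,g\rangle}\,dg$ (normalized Haar measure) is nonzero. For a unital ring $U$, $U^{n\times n}$ is the ring of $n\times n$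 matrices over $U$, and $GL(U^{n\times n})$ is its group of invertible elements. Admissible algebra: a unital Banach algebra $\mathcal{B}\subseteq C(G)$ (a subalgebra containing the constants, with its own Banach algebra norm) such that (1) $P(G)$ is contained and dense in $\mathcal{B}$ (in the norm of $\mathcal{B}$), and (2) $\mathcal{B}$ is inverse closed: $X\in\mathcal{B}\cap GL(C(G))$ implies $X\in GL(\mathcal{B})$. $\mathcal{B}^{n\times n}$ and $GL(\mathcal{B}^{n\times n})$ carry the topology induced by the norm of $\mathcal{B}$. $\mathcal{B}_\pm$ is the closed unital subalgebra of $a\in\mathcal{B}$ with $\sigma(a)\subseteq\Gamma_\pm$. Factorization: $A\in\mathcal{B}^{n\times n}$ is $\mathcal{B}$-factorable if $A(g)=A_-(g)\,\mathrm{diag}(\langle j_1,g\rangle,\ldots,\langle j_n,g\rangle)\,A_+(g)$ for all $g\in G$, for some $A_\pm$ with $A_\pm,A_\pm^{-1}\in\mathcal{B}_\pm^{n\times n}$ and some $j_1,\ldots,j_n\in\Gamma$. $GLF(\mathcal{B}^{n\times n})$ is the set of $\mathcal{B}$-factorable elements of $\mathcal{B}^{n\times n}$ (it is contained in $GL(\mathcal{B}^{n\times n})$). *)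

(* Defs.v *)
From HB Require Import structures.
From mathcomp Require Import all_boot all_order all_algebra.
From mathcomp Require Import complex.
From mathcomp Require Import all_classical all_reals all_analysis.

Set Implicit Arguments.
Unset Strict Implicit.
Unset Printing Implicit Defensive.
Import Order.TTheory GRing.Theory Num.Theory numFieldNormedType.Exports.
Local Open Scope classical_set_scope.
Local Open Scope ring_scope.
Local Open Scope complex_scope.

(* Unital commutative Banach algebras.  The norm of the unit is not required to
   be 1 and, as in every normedModType K, the norm takes its values in K.  The
   product is part of the mixin, and the ring structures are derived from it:
   HB rejects a direct join of CompleteNormedModule and GRing.ComAlgebra (no
   common join with Num.NumDomain). *)
HB.mixin Record NormedModule_isComBanachAlgebra (K : numFieldType) B
    of CompleteNormedModule K B := {
  bone : B;
  bmul : B -> B -> B;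
  bmulA : associative bmul;
  bmulC : commutative bmul;
  bmul1 : left_id bone bmul;
  bmulDl : left_distributive bmul +%R;
  bone_neq0 : bone != 0;
  bscaleAl : forall (k : K) (a b : B), k *: bmul a b = bmul (k *: a) b;
  normr_bmul_le : forall a b : B, `|bmul a b| <= `|a| * `|b|
}.

#[short(type="comBanachAlgType")]
HB.structure Definition ComBanachAlgebra (K : numFieldType) :=
  {B of CompleteNormedModule K B & NormedModule_isComBanachAlgebra K B}.

#[non_forgetful_inheritance]
HB.instance Definition _ (K : numFieldType) (B : comBanachAlgType K) :=
  GRing.Zmodule_isComNzRing.Build B (@bmulA K B) (@bmulC K B) (@bmul1 K B)
    (@bmulDl K B) (@bone_neq0 K B).
#[non_forgetful_inheritance]
HB.instance Definition _ (K : numFieldType) (B : comBanachAlgType K) :=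
  GRing.LSemiModule_isLSemiAlgebra.Build K B (@bscaleAl K B).
#[non_forgetful_inheritance]
HB.instance Definition _ (K : numFieldType) (B : comBanachAlgType K) :=
  GRing.Lalgebra_isComAlgebra.Build K B.

(* A topological abelian group seen as a measurable space with its Borel sets.
   The alias is there because measurable types must be pointed. *)
Definition borel_carrier (G : topologicalZmodType) : Type := G.
HB.instance Definition _ (G : topologicalZmodType) :=
  Choice.on (borel_carrier G).
HB.instance Definition _ (G : topologicalZmodType) :=
  isPointed.Build (borel_carrier G) (0 : G).

Definition borel (G : topologicalZmodType) :=
  g_sigma_algebraType (@open G : set (set (borel_carrier G))).

(* The compact group G is written additively, since this is how the library
   presents topological abelian groups. *)
Section group.
Context {R : realType} {G : topologicalZmodType}.

Definition is_character (f : G -> R[i]) : Prop :=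
  [/\ continuous (f : G -> R[i]^o),
      forall g h, f (g + h) = f g * f h
    & forall g, `|f g| = 1].

(* chi identifies the abelian group Gamma with the character group of G;
   chi j g is <j, g>. *)
Definition is_character_group (Gamma : zmodType) (chi : Gamma -> G -> R[i]) :
    Prop :=
  [/\ forall j, is_character (chi j),
      forall i j g, chi (i + j) g = chi i g * chi j g,
      injective chi
    & forall f, is_character f -> exists j, chi j = f].

Definition is_haar (mu : probability (borel G) R) : Prop :=
  [/\ forall (g : G) (A : set G), measurable (A : set (borel G)) ->
        mu [set g + x | x in A] = mu A,
      forall A : set G, measurable (A : set (borel G)) ->
        mu A = ereal_inf [set mu U | U in [set U : set G | open U /\ A `<=` U]]
    & forall U : set G, open U ->
        mu U = ereal_sup [set mu K | K in [set K : set G |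
                                             compact K /\ K `<=` U]]].

Definition Cintegral (mu : probability (borel G) R) (f : G -> R[i]) : R[i] :=
  Rintegral mu setT (fun g : borel G => complex.Re (f g)) +i*
  Rintegral mu setT (fun g : borel G => complex.Im (f g)).

Context {Gamma : zmodType} (chi : Gamma -> G -> R[i]).

Definition spectrum (mu : probability (borel G) R) (f : G -> R[i]) :
    set Gamma :=
  [set j | Cintegral mu (fun g => f g * (chi j g)^*) != 0].

Definition trig_poly : set (G -> R[i]) :=
  [set f | exists (m : nat) (c : 'I_m -> R[i]) (j : 'I_m -> Gamma),
     f = fun g => \sum_(k < m) c k * chi (j k) g].

(* The subalgebra B of C(G) is given as an abstract Banach algebra together
   with its inclusion iota in the functions on G. *)
Record admissible (B : comBanachAlgType R[i]) (iota : B -> G -> R[i]) : Prop :=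
  Admissible {
    adm_continuous : forall a, continuous (iota a : G -> R[i]^o);
    adm_inj : injective iota;
    adm_linear : forall g, linear (fun a => iota a g : R[i]^o);
    adm_mul : forall g, monoid_morphism (fun a => iota a g);
    adm_trig_poly : trig_poly `<=` range iota;
    adm_dense : dense [set a | trig_poly (iota a)];
    adm_inverse_closed : forall a : B,
      (exists h : G -> R[i], continuous (h : G -> R[i]^o) /\
         forall g, iota a g * h g = 1) ->
      exists b : B, a * b = 1 }.

End group.

Definition torsion_free (Gamma : zmodType) : Prop :=
  forall (x : Gamma) (k : nat), x *+ k.+1 = 0 -> x = 0.

Definition contains_Z3 (Gamma : zmodType) : Prop :=
  exists f : {additive 'rV[int]_3 -> Gamma}, injective f.

Definition is_group_order (Gamma : zmodType) (le : rel Gamma) : Prop :=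
  [/\ reflexive le, antisymmetric le, transitive le, total le
    & forall x y z, le x y -> le (x + z) (y + z)].

Definition GL {B : pzRingType} (n : nat) : set 'M[B]_n :=
  [set A | exists A' : 'M[B]_n, A *m A' = 1%:M /\ A' *m A = 1%:M].

(* A and its inverse have all their entries in S. *)
Definition GL_in {B : pzRingType} (n : nat) (S : set B) : set 'M[B]_n :=
  [set A | exists A' : 'M[B]_n,
     [/\ A *m A' = 1%:M, A' *m A = 1%:M,
         forall i j, S (A i j) & forall i j, S (A' i j)]].

Section factorization.
Context {R : realType} {G : topologicalZmodType} {Gamma : zmodType}.
Context (chi : Gamma -> G -> R[i]) (mu : probability (borel G) R).
Context (le : rel Gamma).
Context {B : comBanachAlgType R[i]} (iota : B -> G -> R[i]).

Definition mxeval (n : nat) (A : 'M[B]_n) (g : G) : 'M[R[i]]_n :=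
  map_mx (fun a => iota a g) A.

Definition Bplus : set B :=
  [set a | spectrum chi mu (iota a) `<=` [set j | le 0 j]].

Definition Bminus : set B :=
  [set a | spectrum chi mu (iota a) `<=` [set j | le j 0]].

Definition GLF (n : nat) : set 'M[B]_n :=
  [set A | exists (Am Ap : 'M[B]_n) (j : 'I_n -> Gamma),
     [/\ GL_in Bminus Am, GL_in Bplus Ap
       & forall g, mxeval A g =
           mxeval Am g *m diag_mx (\row_k chi (j k) g) *m mxeval Ap g]].

End factorization.

Section GL_topology.
Context {R : realType} {B : comBanachAlgType R[i]} {n : nat}.

Definition is_closed_subgroup (H : set 'M[B]_n) : Prop :=
  [/\ H 1%:M,
      forall X Y, H X -> H Y -> H (X *m Y),
      forall X Y, H X -> X *m Y = 1%:M -> Y *m X = 1%:M -> H Y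
    & exists2 F : set 'M[B]_n, closed F & H = F `&` GL (n := n)].

Definition path_in (S : set 'M[B]_n) (X Y : 'M[B]_n) : Prop :=
  exists gamma : R -> 'M[B]_n,
    [/\ {within `[0, 1], continuous gamma}, gamma 0 = X, gamma 1 = Y
      & forall t, t \in `[0, 1] -> S (gamma t)].

Definition is_path_component (S C : set 'M[B]_n) : Prop :=
  exists2 X, S X & C = [set Y | path_in S X Y].

End GL_topology.

(* Main.v *)
(* Let [phi_i], [i < 3], be additive functions on Gamma extending the coordinates
   of a copy of Z^3, and let [D_i] be the derivation of the trigonometric
   polynomials with [D_i chi_j = phi_i(j) chi_j].  An invertible matrix
   polynomial [P] has the Wess-Zumino number [w(P) = int_G tr (a_0 [a_1, a_2])],
   where [a_i = P^-1 D_i P].  It is additive under products, the mixed terms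
   being derivatives, and it vanishes near 1; so it is locally constant for the
   sup norm and induces a homomorphism on GL(B^{n x n}) that is constant on path
   components and whose kernel is a closed subgroup.

   Factorable functions lie in this kernel.  For the factors A_+ and A_- the
   integrand has its spectrum in Gamma_+ \ {0} or Gamma_- \ {0}, once they are
   approximated, by Fejer means, by polynomials with the same property; for a
   diagonal of characters the [a_i] commute.  On the other hand [w] is nonzero on
   an explicit quaternion-valued polynomial on the 3-torus, whose Jacobian is
   nonnegative.  Its powers lie in distinct components outside the kernel. *)

Require Import Defs.
From HB Require Import structures.
From mathcomp Require Import all_boot all_order all_algebra.
From mathcomp Require Import complex ring lra zify.
From mathcomp Require Import all_classical all_reals all_analysis.
From mathcomp Require Import measurable_realfun.
Import Order.TTheory GRing.Theory Num.Theory numFieldNormedType.Exports.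
Import Normc.
Set Implicit Arguments.
Unset Strict Implicit.
Unset Printing Implicit Defensive.
Local Open Scope classical_set_scope.
Local Open Scope ring_scope.
Local Open Scope complex_scope.

(** * The entrywise l1 norm of complex matrices *)

(** An element of [B] need not be differentiable, and the inverse of a matrix polynomial need not be
    a polynomial. Derivatives are therefore taken in the closure of the graph of [D_i] ([mderiv]),
    which is stable under inversion; and [wind F c] says that approximants of [F] of every precision
    have the value [c], which makes sense without derivatives of [F]. All this uses the sup norm
    only. The norm of [B] dominates it because evaluations at points are multiplicative functionals
    on a Banach algebra.

    No integrality of the number is proved: one nonzero value [c] is enough, since its multiples are
    distinct in characteristic 0. For the generator the integral is likewise only shown to be
    nonzero, through a minorant that can be integrated by orthogonality.

    For A_+ and A_- the approximants, and those of the inverses, must keep their frequencies in one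
    half of Gamma; hence the set [S] carried through the calculus. Since Gamma is an arbitrary
    discrete group, the kernels of the Fejer means live on Folner sets, which exist because finitely
    generated abelian groups grow polynomially. *)

Section entry_sum_norm.
Variable R : realType.
Local Notation C := R[i].

Lemma normc_ge0 (z : C) : 0 <= normc z.
Proof. by case: z => a b; rewrite /normc sqrtr_ge0. Qed.

Lemma normcR (a : R) : normc a%:C = `|a|.
Proof. by rewrite /normc /= expr0n addr0 sqrtr_sqr. Qed.

Lemma normc_normr (z : C) : `|z| = (normc z)%:C.
Proof. by case: z. Qed.

Lemma normc_eq1 (z : C) : `|z| = 1 -> normc z = 1.
Proof. by rewrite normc_normr => -[]. Qed.

Lemma normc_sum I (r : seq I) (P : pred I) (F : I -> C) :
  normc (\sum_(i <- r | P i) F i) <= \sum_(i <- r | P i) normc (F i).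
Proof.
elim/big_rec2: _ => [|i y z _ h]; first by rewrite normc0.
by apply: le_trans (le_normcD _ _) _; rewrite lerD2l.
Qed.

(** The full entry sum is submultiplicative and dominates both the trace and every entry. It is not
    normalized: the identity of size [n] has norm [n]. *)
Definition mxN m n (A : 'M[C]_(m, n)) : R := \sum_i \sum_j normc (A i j).

Lemma mxN_ge0 m n (A : 'M[C]_(m, n)) : 0 <= mxN A.
Proof. by apply: sumr_ge0 => i _; apply: sumr_ge0 => j _; apply: normc_ge0. Qed.

Lemma mxN_entry m n (A : 'M[C]_(m, n)) i j : normc (A i j) <= mxN A.
Proof.
rewrite /mxN (bigD1 i) //= (bigD1 j) //= -addrA lerDl addr_ge0 //.
  by apply: sumr_ge0 => *; apply: normc_ge0.
by apply: sumr_ge0 => ? _; apply: sumr_ge0 => *; apply: normc_ge0.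
Qed.

Lemma mxN0 m n : mxN (0 : 'M[C]_(m, n)) = 0.
Proof. by rewrite /mxN big1 // => i _; rewrite big1 // => j _; rewrite mxE normc0. Qed.

Lemma mxN_eq0 m n (A : 'M[C]_(m, n)) : mxN A = 0 -> A = 0.
Proof.
move=> A0; apply/matrixP => i j; rewrite mxE; apply: eq0_normc.
by apply: le_anti; rewrite normc_ge0 andbT -A0 mxN_entry.
Qed.

Lemma mxND m n (A B : 'M[C]_(m, n)) : mxN (A + B) <= mxN A + mxN B.
Proof.
rewrite /mxN -big_split ler_sum // => i _; rewrite -big_split ler_sum // => j _.
by rewrite mxE le_normcD.
Qed.

Lemma mxNN m n (A : 'M[C]_(m, n)) : mxN (- A) = mxN A.
Proof. by apply: eq_bigr => i _; apply: eq_bigr => j _; rewrite mxE normcN. Qed.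

Lemma mxNB m n (A B : 'M[C]_(m, n)) : mxN (A - B) <= mxN A + mxN B.
Proof. by rewrite -(mxNN B) mxND. Qed.

Lemma mxN_distC m n (A B : 'M[C]_(m, n)) : mxN (A - B) = mxN (B - A).
Proof. by rewrite -mxNN opprB. Qed.

Lemma mxNZ m n a (A : 'M[C]_(m, n)) : mxN (a *: A) = normc a * mxN A.
Proof.
rewrite mulr_sumr; apply: eq_bigr => i _; rewrite mulr_sumr.
by apply: eq_bigr => j _; rewrite mxE normcM.
Qed.

Lemma mxNM m n p (A : 'M[C]_(m, n)) (B : 'M[C]_(n, p)) :
  mxN (A *m B) <= mxN A * mxN B.
Proof.
rewrite /mxN mulr_suml ler_sum // => i _.
apply: (@le_trans _ _ (\sum_j \sum_k normc (A i k) * normc (B k j))).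
  apply: ler_sum => j _; rewrite mxE; apply: le_trans (normc_sum _ _ _) _.
  by apply: ler_sum => k _; rewrite normcM.
rewrite exchange_big mulr_suml ler_sum //= => k _.
rewrite -mulr_sumr ler_wpM2l ?normc_ge0 //.
rewrite [leRHS](bigD1 k) //= lerDl.
by apply: sumr_ge0 => ? _; apply: sumr_ge0 => *; apply: normc_ge0.
Qed.

Lemma mxN_sum I (r : seq I) (P : pred I) m n (F : I -> 'M[C]_(m, n)) :
  mxN (\sum_(i <- r | P i) F i) <= \sum_(i <- r | P i) mxN (F i).
Proof.
elim/big_rec2: _ => [|i y z _ h]; first by rewrite mxN0.
by apply: le_trans (mxND _ _) _; rewrite lerD2l.
Qed.

Lemma mxN_tr n (A : 'M[C]_n) : normc (\tr A) <= mxN A.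
Proof.
apply: le_trans (normc_sum _ _ _) _; apply: ler_sum => i _.
by rewrite (bigD1 i) //= lerDl; apply: sumr_ge0 => *; apply: normc_ge0.
Qed.

Lemma mxN_scalar n (a : C) : mxN (a%:M : 'M[C]_n) = n%:R * normc a.
Proof.
rewrite /mxN (eq_bigr (fun=> normc a)) => [|i _].
  by rewrite sumr_const card_ord mulr_natl.
rewrite (bigD1 i) //= big1 ?addr0 => [|j /negPf ji]; first by rewrite mxE eqxx.
by rewrite mxE eq_sym ji normc0.
Qed.

(** A row [v] of the left kernel satisfies [v = v (1 - A)], so its norm is at most itself times a
    number below 1. *)
Lemma near1_unitmx n (A : 'M[C]_n) : mxN (1%:M - A) < 1 -> A \in unitmx.
Proof.
move=> A1; rewrite -row_free_unit -kermx_eq0.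
apply/eqP/row_matrixP => i; rewrite row0; apply: mxN_eq0.
set v := row i _.
have vA : v = v *m (1%:M - A).
  rewrite mulmxBr mulmx1.
  by have /sub_kermxP -> : (v <= kermx A)%MS := row_sub _ _; rewrite subr0.
have := mxNM v (1%:M - A); rewrite -vA.
have := mxN_ge0 v; nra.
Qed.

Lemma near1_invmx n (A X : 'M[C]_n) e :
  A *m X = 1%:M -> mxN (1%:M - A) <= e -> e < 1 -> mxN X <= n%:R / (1 - e).
Proof.
move=> AX A1 e1; rewrite ler_pdivlMr ?subr_gt0 //.
have XE : X = 1%:M + (1%:M - A) *m X by rewrite mulmxBl mul1mx AX addrC subrK.
have := mxND 1%:M ((1%:M - A) *m X); rewrite -XE mxN_scalar normc1.
have := mxNM (1%:M - A) X; have := mxN_ge0 X; nra.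
Qed.

End entry_sum_norm.

(** * Integration of continuous complex functions *)

Section haar_integral.
Context {R : realType} {G : topologicalZmodType}.
Hypothesis G_compact : compact [set: G].
Variable mu : probability (borel G) R.
Local Notation C := R[i].

Definition cont (f : G -> C) : Prop := continuous (f : G -> C^o).

Lemma contP f : cont f <->
  forall g (e : R), 0 < e -> \forall h \near g, normc (f h - f g) < e.
Proof.
split=> [cf g e e0|H g].
  have /cvgrPdist_lt /(_ e%:C) := cf g.
  rewrite ltcR => /(_ e0); apply: filterS => h.
  by rewrite /= distrC normc_normr ltcR.
apply/cvgrPdist_lt => e e0.
(* In the order of [C] a positive element is real. *)
have eE : e = (complex.Re e)%:C by rewrite RRe_real // gtr0_real.
have {}e0 : 0 < complex.Re e by rewrite -ltcR -eE.
by apply: filterS (H g _ e0) => h hh; rewrite eE distrC normc_normr ltcR.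
Qed.

Lemma cont_cst c : cont (fun=> c).
Proof. by move=> g; apply: cvg_cst. Qed.

Lemma contD f h : cont f -> cont h -> cont (fun g => f g + h g).
Proof. by move=> cf ch g; apply: cvgD; [apply: cf|apply: ch]. Qed.

Lemma contM f h : cont f -> cont h -> cont (fun g => f g * h g).
Proof. by move=> cf ch g; apply: (@cvgM _ _ _ _ _ _ (f g) (h g)); [apply: cf|apply: ch]. Qed.

Lemma normc_conj (z : C) : normc z^* = normc z.
Proof. by case: z => a b; rewrite /= sqrrN. Qed.

Lemma cont_conj f : cont f -> cont (fun g => (f g)^*).
Proof.
move/contP => cf; apply/contP => g e e0; apply: filterS (cf g e e0) => h.
by rewrite -rmorphB normc_conj.
Qed.

Lemma cont_sum I (r : seq I) (P : pred I) (F : I -> G -> C) :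
  (forall i, cont (F i)) -> cont (fun g => \sum_(i <- r | P i) F i g).
Proof.
move=> cF; elim: r => [|i r ih].
  have -> : (fun g => \sum_(i <- [::] | P i) F i g) = (fun=> 0).
    by apply/funext => g; rewrite big_nil.
  exact: cont_cst.
have -> : (fun g => \sum_(j <- i :: r | P j) F j g) =
    (fun g => if P i then F i g + \sum_(j <- r | P j) F j g else \sum_(j <- r | P j) F j g).
  by apply/funext => g; rewrite big_cons.
by case: (P i); [exact: (contD (cF i) ih)|exact: ih].
Qed.

Lemma cont_bounded f : cont f -> exists M, forall g, normc (f g) <= M.
Proof.
move=> cf.
have cn : continuous (fun g => normc (f g) : R).
  move=> g; apply/cvgrPdist_lt => e e0; move/contP: cf => /(_ g e e0).
  apply: filterS => h; apply: le_lt_trans.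
  have A : normc (f g) <= normc (f h) + normc (f h - f g).
    by rewrite -[X in _ + X]normcN; apply: le_trans (le_normcD _ _); rewrite opprB addrC subrK.
  have B : normc (f h) <= normc (f g) + normc (f h - f g).
    by apply: le_trans (le_normcD _ _); rewrite addrC subrK.
  by rewrite ler_norml; apply/andP; split; lra.
have [M [_ HM]] : bounded_set ((fun g => normc (f g) : R) @` [set: G]).
  apply: compact_bounded; apply: continuous_compact => //.
  exact: continuous_subspaceT.
exists (M + 1) => g; have /= := HM (M + 1).
rewrite ltrDl ltr01 => /(_ isT) /(_ (normc (f g))) h.
by apply: le_trans (h _); [exact: ler_norm|exists g].
Qed.

Lemma Re_le_normc (z : C) : `|complex.Re z| <= normc z.
Proof.
by case: z => a b /=; rewrite -sqrtr_sqr ler_wsqrtr // lerDl sqr_ge0.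
Qed.

Lemma Im_le_normc (z : C) : `|complex.Im z| <= normc z.
Proof.
by case: z => a b /=; rewrite -sqrtr_sqr ler_wsqrtr // lerDr sqr_ge0.
Qed.

Lemma open_borel (A : set G) : open A -> measurable (A : set (borel G)).
Proof. by move=> oA; apply: sub_sigma_algebra. Qed.

Lemma continuous_borel (f : G -> R) : continuous f ->
  measurable_fun [set: borel G] (f : borel G -> R).
Proof.
move=> cf; apply: (measurability _ (RGenOpens.measurableE R)).
move=> _ [_ [x [y ->]] <-]; rewrite setTI; apply: open_borel.
by move/continuousP: cf; apply; exact: itv_open.
Qed.

Lemma integrable_borel (f : G -> R) M : continuous f ->
  (forall g, `|f g| <= M) -> mu.-integrable [set: borel G] (EFin \o f).
Proof.
move=> cf fM; apply: measurable_bounded_integrable => //.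
- by rewrite (le_lt_trans (probability_le1 _ _)) ?ltry.
- exact: continuous_borel.
- by exists M; split; [exact: num_real|move=> N MN g _; apply: le_trans (fM g) (ltW MN)].
Qed.

Lemma continuous_Re f : cont f -> continuous (fun g => complex.Re (f g) : R).
Proof.
move=> /contP cf g; apply/cvgrPdist_lt => e e0; apply: filterS (cf g e e0) => h.
by rewrite distrC -raddfB; apply: le_lt_trans (Re_le_normc _).
Qed.

Lemma continuous_Im f : cont f -> continuous (fun g => complex.Im (f g) : R).
Proof.
move=> /contP cf g; apply/cvgrPdist_lt => e e0; apply: filterS (cf g e e0) => h.
by rewrite distrC -raddfB; apply: le_lt_trans (Im_le_normc _).
Qed.

Lemma integrable_Re f : cont f ->
  mu.-integrable [set: borel G] (EFin \o (fun g => complex.Re (f g))).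
Proof.
move=> cf; have [M fM] := cont_bounded cf.
apply: (@integrable_borel _ M); first exact: continuous_Re.
by move=> g; apply: le_trans (Re_le_normc _) (fM g).
Qed.

Lemma integrable_Im f : cont f ->
  mu.-integrable [set: borel G] (EFin \o (fun g => complex.Im (f g))).
Proof.
move=> cf; have [M fM] := cont_bounded cf.
apply: (@integrable_borel _ M); first exact: continuous_Im.
by move=> g; apply: le_trans (Im_le_normc _) (fM g).
Qed.

Local Notation Cint := (Cintegral mu).

Lemma Cint_ext f h : f =1 h -> Cint f = Cint h.
Proof. by move=> /funext ->. Qed.

Lemma CintD f h : cont f -> cont h ->
  Cint (fun g => f g + h g) = Cint f + Cint h.
Proof.
move=> cf ch; rewrite /Cintegral.
under [X in X +i* _ = _]eq_Rintegral do rewrite raddfD.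
under [X in _ +i* X = _]eq_Rintegral do rewrite raddfD.
rewrite !RintegralD //; first [exact: integrable_Re|exact: integrable_Im].
Qed.

Lemma integrableZl_borel (a : R) (f : borel G -> R) :
  mu.-integrable setT (EFin \o f) -> mu.-integrable setT (EFin \o (fun x => a * f x)).
Proof.
move=> h; apply: (@eq_integrable _ _ _ mu _ measurableT
  (fun x => a%:E * (EFin \o f) x)%E) (integrableZl measurableT a h).
by move=> x _ /=; rewrite EFinM.
Qed.

Lemma CintZ c f : cont f -> Cint (fun g => c * f g) = c * Cint f.
Proof.
case: c => a b cf; have iR := integrable_Re cf; have iI := integrable_Im cf.
rewrite /Cintegral; simpc; congr (_ +i* _).
  rewrite -!RintegralZl // -RintegralB //; try exact: integrableZl_borel.
  by apply: eq_Rintegral => g _; case: (f g).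
rewrite -!RintegralZl // -RintegralD //; try exact: integrableZl_borel.
by apply: eq_Rintegral => g _; case: (f g).
Qed.

Lemma Cint_cst c : Cint (fun=> c) = c.
Proof.
have E : fine (mu [set: borel G]) = 1 by rewrite (@probability_setT _ _ _ mu).
rewrite /Cintegral !Rintegral_cst // E !mulr1.
by case: c.
Qed.

Lemma Cint_sum I (r : seq I) (P : pred I) (F : I -> G -> C) :
  (forall i, cont (F i)) ->
  Cint (fun g => \sum_(i <- r | P i) F i g) = \sum_(i <- r | P i) Cint (F i).
Proof.
move=> cF; elim: r => [|i r ih].
  by rewrite big_nil; under Cint_ext do rewrite big_nil; rewrite Cint_cst.
rewrite big_cons; under Cint_ext do rewrite big_cons.
by case: (P i); rewrite ?CintD ?ih //; apply: cont_sum.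
Qed.

Lemma le_Re_Cint f h : cont f -> cont h ->
  (forall g, complex.Re (f g) <= complex.Re (h g)) ->
  complex.Re (Cint f) <= complex.Re (Cint h).
Proof.
move=> cf ch fh; apply: le_Rintegral => //; try exact: integrable_Re.
Qed.

Lemma normc_Cint f M : cont f -> (forall g, normc (f g) <= M) ->
  normc (Cint f) <= M.
Proof.
move=> cf fM.
(* Multiplying by [w] rotates the integral onto the positive real axis. *)
have [->|z0] := eqVneq (Cint f) 0.
  by rewrite normc0; apply: le_trans (fM 0); apply: normc_ge0.
set z := Cint f in z0 *.
have n0 : normc z != 0 by apply: contra z0 => /eqP /eq0_normc ->.
pose w := (normc z)%:C / z.
have w1 : normc w = 1 by rewrite normcM normcV normcR ger0_norm ?normc_ge0 // divff.
have -> : normc z = complex.Re (Cint (fun g => w * f g)).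
  by rewrite CintZ // -/z /w divfK.
have -> : M = complex.Re (Cint (fun=> M%:C)) by rewrite Cint_cst.
have ch : cont (fun g => w * f g) := contM (@cont_cst w) cf.
apply: (le_Re_Cint ch); first exact: cont_cst.
move=> g; apply: le_trans (ler_norm _) _; apply: le_trans (Re_le_normc _) _.
by rewrite normcM w1 mul1r.
Qed.

End haar_integral.

(** * Characters *)

Section characters.
Context {R : realType} {G : topologicalZmodType} {Gamma : zmodType}.
Context (chi : Gamma -> G -> R[i]) (mu : probability (borel G) R).
Hypothesis G_compact : compact [set: G].
Hypothesis chi_dual : is_character_group chi.
Hypothesis mu_haar : is_haar mu.
Local Notation C := R[i].
Local Notation Cint := (Cintegral mu).

Lemma cont_chi j : cont (chi j).
Proof. by case: chi_dual => H _ _ _; case: (H j). Qed.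

Lemma chiD i j g : chi (i + j) g = chi i g * chi j g.
Proof. by case: chi_dual. Qed.

Lemma chi_translate j g h : chi j (g + h) = chi j g * chi j h.
Proof. by case: chi_dual => H _ _ _; case: (H j). Qed.

Lemma normc_chi j g : normc (chi j g) = 1.
Proof. by case: chi_dual => H _ _ _; case: (H j) => _ _ h; apply: normc_eq1. Qed.

Lemma chi_neq0 j g : chi j g != 0.
Proof.
apply/eqP => c0; have := normc_chi j g; rewrite c0 normc0 => /esym/eqP.
by rewrite oner_eq0.
Qed.

Lemma chi0 g : chi 0 g = 1.
Proof. by apply: (mulfI (chi_neq0 0 g)); rewrite -chiD addr0 mulr1. Qed.

Lemma chiNK j g : chi (- j) g * chi j g = 1.
Proof. by rewrite -chiD addNr chi0. Qed.

Lemma chiN j g : chi (- j) g = (chi j g)^*.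
Proof.
apply: (mulIf (chi_neq0 j g)); rewrite chiNK.
have := normc_chi j g; case: (chi j g) => a b /= h.
have hh : a ^+ 2 + b ^+ 2 = 1.
  by have := sqr_sqrtr (addr_ge0 (sqr_ge0 a) (sqr_ge0 b)); rewrite h expr1n.
by simpc; apply/eqP; rewrite eq_complex /=; apply/andP; split; apply/eqP; rewrite -?hh; ring.
Qed.

Lemma Cint_translate f h : cont f -> Cint (fun g => f (h + g)) = Cint f.
Proof.
move=> cf.
have tc : continuous (fun g : G => h + g).
  move=> g; apply: (@continuous2_cvg _ _ _ _ _ _ _ _ (fun x y : G => x + y)).
  - exact: (@tvs.add_continuous G (h, g)).
  - exact: cvg_cst.
  - exact: cvg_id.
have mt : measurable_fun [set: borel G] (fun g : borel G => (h + g : G) : borel G).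
  apply: (measurability _ (erefl : @measurable _ (borel G) = <<s (@open G) >>)).
  move=> _ [A oA <-]; rewrite setTI; apply: open_borel.
  by move/continuousP: tc; apply.
have key (f' : G -> R) M : continuous f' -> (forall g, `|f' g| <= M) ->
  Rintegral mu setT (fun g : borel G => f' (h + g)) = Rintegral mu setT (f' : borel G -> R).
  move=> cf' fM; congr fine.
  have cft : continuous (fun g : G => f' (h + g)).
    by move=> g; apply: (@continuous_comp _ _ _ (fun x => h + x) f'); [apply: tc | apply: cf'].
  have := @integral_pushforward _ _ (borel G) (borel G) R _ mt mu setT (EFin \o f').
  rewrite preimage_setT => /(_ _ _ measurableT) <- //; last 2 first.
  - by apply/measurable_EFinP; exact: continuous_borel.
  - by apply: (integrable_borel (M := M) _ cft) => g; apply: fM.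
  (* The pushforward measures the preimage of [A] under [x |-> h + x], which is the translate of [A]
     by [- h]. *)
  apply: (@eq_measure_integral _ _ _ _ mu) => A mA _; rewrite /pushforward.
  have [inv _ _] := mu_haar.
  apply: etrans (inv (- h) A mA); congr (mu _); apply/seteqP; split => x /=.
    by move=> hx; exists (h + x); rewrite ?addKr.
  by move=> [y Ay <-]; rewrite addNKr.
have [M fM] := cont_bounded G_compact cf.
congr (_ +i* _).
  apply: (key (fun g => complex.Re (f g)) M); first exact: continuous_Re.
  by move=> g; apply: le_trans (Re_le_normc _) (fM g).
apply: (key (fun g => complex.Im (f g)) M); first exact: continuous_Im.
by move=> g; apply: le_trans (Im_le_normc _) (fM g).
Qed.

(** If [chi j h != 1], translation by [h] multiplies the integral by [chi j h] and yet leaves it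
    unchanged, so it is 0. *)
Lemma Cint_chi j : Cint (chi j) = (j == 0)%:R.
Proof.
have [->|j0] := eqVneq j 0.
  by rewrite (Cint_ext _ chi0) Cint_cst.
have [h hn1] : exists h, chi j h != 1.
  apply: contrapT => H; move/eqP: j0; apply.
  case: chi_dual => _ _ inj _; apply: inj; apply/funext => g.
  by rewrite chi0; apply: contrapT => /eqP gn1; apply: H; exists g.
have := Cint_translate h (cont_chi (j := j)).
under Cint_ext do rewrite chi_translate.
rewrite CintZ //; last exact: cont_chi.
move/eqP; rewrite -subr_eq0 -[X in _ - X]mul1r -mulrBl mulf_eq0 subr_eq0.
by rewrite (negPf hn1) => /eqP.
Qed.

End characters.

(** * Derivations of matrix-valued functions *)

Lemma exists_half_le (R : realType) (K e : R) : 0 < e -> exists k, K * 2^-1 ^+ k <= e.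
Proof.
move=> e0; pose k := Num.Def.archi_bound (`|K| / e); exists k.
have hk : `|K| / e < k%:R by apply: archi_boundP; rewrite divr_ge0 // ltW.
have h2 : (k%:R : R) <= 2 ^+ k by rewrite -natrX ler_nat ltnW // ltn_expl.
rewrite exprVn ler_pdivrMr ?exprn_gt0 //.
have := ler_norm K; have : `|K| < e * 2 ^+ k; last lra.
by rewrite mulrC -ltr_pdivrMr //; apply: lt_le_trans hk h2.
Qed.

Lemma mx_addE (V : nmodType) m n (A B : 'M[V]_(m, n)) i j : (A + B) i j = A i j + B i j.
Proof. by rewrite mxE. Qed.

Lemma mx_oppE (V : zmodType) m n (A : 'M[V]_(m, n)) i j : (- A) i j = - A i j.
Proof. by rewrite mxE. Qed.

Ltac mx_ring :=
  rewrite ?(mulmxDl, mulmxDr, mulmxBl, mulmxBr, mulNmx, mulmxN, mul1mx, mulmx1, mulmxA, mul0mx, mulmx0);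
  apply/matrixP => ? ?; rewrite ?(mx_addE, mx_oppE); ring.

Section derivations.
Context {R : realType} {G : topologicalZmodType} {Gamma : zmodType}.
Context (chi : Gamma -> G -> R[i]).
Hypothesis chi_dual : is_character_group chi.
Local Notation C := R[i].
Variable n : nat.
Local Notation M := 'M[C]_n.

Definition mev (s : seq (M * Gamma)) (g : G) : M :=
  \sum_(x <- s) chi x.2 g *: x.1.

Definition mevD (phi : Gamma -> C) (s : seq (M * Gamma)) (g : G) : M :=
  \sum_(x <- s) (phi x.2 * chi x.2 g) *: x.1.

Definition mulp (s t : seq (M * Gamma)) : seq (M * Gamma) :=
  [seq (x.1 *m y.1, x.2 + y.2) | x <- s, y <- t].

Definition derp (phi : Gamma -> C) (s : seq (M * Gamma)) : seq (M * Gamma) :=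
  [seq (phi x.2 *: x.1, x.2) | x <- s].

Definition freq_in (S : set Gamma) (s : seq (M * Gamma)) : Prop :=
  forall x, x \in s -> S x.2.

Lemma freq_in_cat S s t : freq_in S s -> freq_in S t -> freq_in S (s ++ t).
Proof. by move=> hs ht x; rewrite mem_cat => /orP[/hs|/ht]. Qed.

Lemma freq_in_derp S phi s : freq_in S s -> freq_in S (derp phi s).
Proof. by move=> hs _ /mapP[x xs ->] /=; apply: hs. Qed.

Lemma freq_in_mulp S s t : (forall x y, S x -> S y -> S (x + y)) ->
  freq_in S s -> freq_in S t -> freq_in S (mulp s t).
Proof. by move=> SD hs ht _ /allpairsP[[x y] /= [xs yt ->]] /=; apply: SD; [apply: hs|apply: ht]. Qed.

Lemma mev_cat s t g : mev (s ++ t) g = mev s g + mev t g.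
Proof. by rewrite /mev big_cat. Qed.

Lemma mevD_cat phi s t g : mevD phi (s ++ t) g = mevD phi s g + mevD phi t g.
Proof. by rewrite /mevD big_cat. Qed.

Lemma mev_derp phi s g : mev (derp phi s) g = mevD phi s g.
Proof. by rewrite /mev /mevD big_map; apply: eq_bigr => x _ /=; rewrite scalerA mulrC. Qed.

Lemma mevD_derp phi phi' s g :
  mevD phi (derp phi' s) g = mevD (fun x => phi x * phi' x) s g.
Proof.
rewrite /mevD big_map; apply: eq_bigr => x _ /=; rewrite scalerA; congr (_ *: _); ring.
Qed.

Lemma mev_mulp s t g : mev (mulp s t) g = mev s g *m mev t g.
Proof.
rewrite /mev big_allpairs_dep mulmx_suml; apply: eq_bigr => x _.
rewrite mulmx_sumr; apply: eq_bigr => y _ /=.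
by rewrite -scalemxAl -scalemxAr scalerA (chiD chi_dual).
Qed.

Lemma mevD_mulp phi s t g : (forall x y, phi (x + y) = phi x + phi y) ->
  mevD phi (mulp s t) g = mevD phi s g *m mev t g + mev s g *m mevD phi t g.
Proof.
move=> phiD; rewrite /mev /mevD big_allpairs_dep !mulmx_suml -big_split; apply: eq_bigr => x _.
rewrite !mulmx_sumr -big_split; apply: eq_bigr => y _ /=.
rewrite -!scalemxAl -!scalemxAr !scalerA -scalerDl (chiD chi_dual) phiD; congr (_ *: _).
ring.
Qed.

Lemma mev_bounded s : exists K, forall g, mxN (mev s g) <= K.
Proof.
exists (\sum_(x <- s) mxN x.1) => g; apply: le_trans (mxN_sum _ _ _) _.
by apply: ler_sum => x _; rewrite mxNZ (normc_chi chi_dual) mul1r.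
Qed.

Lemma mev_cont s i j : cont (fun g => mev s g i j).
Proof.
rewrite /mev; under eq_fun do rewrite summxE.
apply: cont_sum => x; under eq_fun do rewrite mxE.
apply: contM; [exact: (cont_chi chi_dual) | exact: cont_cst].
Qed.

(* [(A, A')] is a uniform limit of pairs [(P, D P)], where [P] is a matrix
   polynomial with frequencies in [S] and [D] is the derivation given by [phi]. *)
Definition mderiv (S : set Gamma) (phi : Gamma -> C) (A A' : G -> M) : Prop :=
  forall e : R, 0 < e -> exists2 s, freq_in S s &
    forall g, mxN (A g - mev s g) <= e /\ mxN (A' g - mevD phi s g) <= e.

Section calculus.
Variables (S : set Gamma) (phi : Gamma -> C).
Hypothesis S0 : S 0.
Hypothesis SD : forall x y, S x -> S y -> S (x + y).
Hypothesis phiD : forall x y, phi (x + y) = phi x + phi y.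

Lemma deriv_phi0 : phi 0 = 0.
Proof. by apply: (addrI (phi 0)); rewrite -phiD !addr0. Qed.

Lemma mderiv_mev s : freq_in S s -> mderiv S phi (mev s) (mevD phi s).
Proof. by move=> hs e /ltW e0; exists s => // g; rewrite !subrr mxN0. Qed.

Lemma mderiv_ext A A' B B' : A =1 B -> A' =1 B' -> mderiv S phi A A' -> mderiv S phi B B'.
Proof. by move=> /funext -> /funext ->. Qed.

Lemma mderiv_cst c : mderiv S phi (fun=> c) (fun=> 0).
Proof.
apply: mderiv_ext (mderiv_mev (s := [:: (c, 0)]) _).
- by move=> g; rewrite /mev big_seq1 (chi0 chi_dual) scale1r.
- by move=> g; rewrite /mevD big_seq1 deriv_phi0 mul0r scale0r.
- by move=> x; rewrite inE => /eqP ->.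
Qed.

Lemma mderiv_bounded A A' : mderiv S phi A A' ->
  exists2 K, 0 <= K & forall g, mxN (A g) <= K /\ mxN (A' g) <= K.
Proof.
move=> /(_ 1 ltr01)[s _ hs].
have [K hK] := mev_bounded s; have [L hL] := mev_bounded (derp phi s).
have K0 : 0 <= K := le_trans (mxN_ge0 _) (hK 0).
have L0 : 0 <= L := le_trans (mxN_ge0 _) (hL 0).
exists (1 + K + L) => [|g]; first by lra.
have [h1 h2] := hs g; have := hK g; have := hL g; rewrite mev_derp => h3 h4.
have := mxND (A g - mev s g) (mev s g); rewrite subrK.
have := mxND (A' g - mevD phi s g) (mevD phi s g); rewrite subrK.
lra.
Qed.

(** The relation, being the closure of a graph, is closed under uniform limits of pairs; this is how
    the limit of Newton's iteration gets a derivative. *)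
Lemma mderiv_lim A A' :
  (forall e : R, 0 < e -> exists B B', mderiv S phi B B' /\
     forall g, mxN (A g - B g) <= e /\ mxN (A' g - B' g) <= e) ->
  mderiv S phi A A'.
Proof.
move=> H e e0; have e2 : 0 < e / 2 by lra.
have [B [B' [hB AB]]] := H _ e2; have [s Ss hs] := hB _ e2.
exists s => // g; have [a1 a2] := AB g; have [b1 b2] := hs g.
have := mxND (A g - B g) (B g - mev s g); rewrite addrA subrK.
have := mxND (A' g - B' g) (B' g - mevD phi s g); rewrite addrA subrK.
lra.
Qed.

Lemma mderivD A A' B B' : mderiv S phi A A' -> mderiv S phi B B' ->
  mderiv S phi (fun g => A g + B g) (fun g => A' g + B' g).
Proof.
move=> hA hB e e0; have e2 : 0 < e / 2 by lra.
have [s Ss hs] := hA _ e2; have [t St ht] := hB _ e2.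
exists (s ++ t) => [|g]; first exact: freq_in_cat.
have E (a b c d : M) : a + b - (c + d) = (a - c) + (b - d) by rewrite opprD addrACA.
rewrite mev_cat mevD_cat !E.
have [a1 a2] := hs g; have [b1 b2] := ht g.
have := mxND (A g - mev s g) (B g - mev t g).
have := mxND (A' g - mevD phi s g) (B' g - mevD phi t g).
lra.
Qed.

Lemma mderivM A A' B B' : mderiv S phi A A' -> mderiv S phi B B' ->
  mderiv S phi (fun g => A g *m B g) (fun g => A' g *m B g + A g *m B' g).
Proof.
move=> hA hB e e0.
have [K K0 hK] := mderiv_bounded hA; have [L L0 hL] := mderiv_bounded hB.
(* With [d <= 1] an approximant of a function bounded by [K] is bounded by [K + 1], so each product
   is off by at most [d L + (K + 1) d]. The factor 2 is for the two products in the derivative. *)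
pose d := Num.min 1 (e / (2 * (K + L + 1))).
have KL : 0 < 2 * (K + L + 1) by lra.
have d0 : 0 < d by rewrite lt_min ltr01 divr_gt0.
have d1 : d <= 1 by rewrite ge_min lexx.
have de : d * (2 * (K + L + 1)) <= e by rewrite -ler_pdivlMr // ge_min lexx orbT.
have [s Ss hs] := hA _ d0; have [t St ht] := hB _ d0.
exists (mulp s t) => [|g]; first exact: freq_in_mulp.
rewrite mev_mulp (mevD_mulp _ _ _ phiD).
have [a1 a2] := hs g; have [b1 b2] := ht g; have [k1 k2] := hK g; have [l1 l2] := hL g.
move: (A g) (A' g) (B g) (B' g) (mev s g) (mevD phi s g) (mev t g) (mevD phi t g)
  a1 a2 b1 b2 k1 k2 l1 l2 => a a' b b' p p' q q' a1 a2 b1 b2 k1 k2 l1 l2.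
have key (x y u v : M) : mxN (x - u) <= d -> mxN (y - v) <= d -> mxN x <= K -> mxN y <= L ->
    mxN (x *m y - u *m v) <= d * (K + L + 1).
  move=> xu yv xK yL.
  have -> : x *m y - u *m v = (x - u) *m y + u *m (y - v) by mx_ring.
  have := mxND ((x - u) *m y) (u *m (y - v)).
  have := mxNM (x - u) y; have := mxNM u (y - v).
  have := mxND x (- (x - u)); rewrite mxNN opprB addrCA subrr addr0.
  have := mxN_ge0 y; have := mxN_ge0 u; have := mxN_ge0 (x - u); have := mxN_ge0 (y - v).
  set X := mxN (x - u) in xu *; set Y := mxN (y - v) in yv *.
  move=> ? ? ? ? ? ? ? ?.
  have : X * mxN y <= d * L by apply: ler_pM.
  have : mxN u * Y <= (K + 1) * d by apply: ler_pM => //; lra.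
  nra.
split; first by have := key _ _ _ _ a1 b1 k1 l1; nra.
have -> : a' *m b + a *m b' - (p' *m q + p *m q') =
  (a' *m b - p' *m q) + (a *m b' - p *m q') by rewrite opprD addrACA.
have := mxND (a' *m b - p' *m q) (a *m b' - p *m q').
have := key _ _ _ _ a2 b1 k2 l1; have := key _ _ _ _ a1 b2 k1 l2; nra.
Qed.

Lemma mderivZ a A A' : mderiv S phi A A' ->
  mderiv S phi (fun g => a *: A g) (fun g => a *: A' g).
Proof.
move=> /(mderivM (mderiv_cst a%:M)); apply: mderiv_ext => g.
  by rewrite mul_scalar_mx.
by rewrite mul0mx add0r mul_scalar_mx.
Qed.

Lemma mderivN A A' : mderiv S phi A A' ->
  mderiv S phi (fun g => - A g) (fun g => - A' g).
Proof. by move=> /(mderivZ (-1)); apply: mderiv_ext => g; rewrite scaleN1r. Qed.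

(** This is the product rule for [P U (1 + E) = 1 - E^2], where [- V] is the derivative of [E]. The
    zeros are the derivatives of the constant 1, in the place where [mderivM] and [mderivD] leave
    them. *)
Let newton_id (p p' u u' : M) (E := 1%:M - p *m u) (V := p' *m u + p *m u') :
  p' *m (u *m (1%:M + E)) + p *m (u' *m (1%:M + E) + u *m (0 + (0 - V))) =
  V *m E + E *m V.
Proof.
have pu : p *m u = 1%:M - E by rewrite opprB addrCA subrr addr0.
rewrite !add0r mulmxDr !mulmxA addrA -mulmxDl -/V pu mulmxN mulmxBl mul1mx mulmxDr mulmx1.
by rewrite opprB addrC addrA subrK addrC.
Qed.

(* Newton's iteration [Q <- Q (2 - P Q)] squares the error [E = 1 - P Q], and
   the derivative of the error is multiplied by at most [2 N(E) <= 1/2]. *)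
Lemma mderiv_inv P P' Q Q' X : mderiv S phi P P' -> mderiv S phi Q Q' ->
  (forall g, mxN (1%:M - P g *m Q g) <= 1 / 4) ->
  (forall g, P g *m X g = 1%:M) ->
  mderiv S phi X (fun g => - (X g *m P' g *m X g)).
Proof.
move=> hP hQ PQ PX.
have XP g : X g *m P g = 1%:M := mulmx1C (PX g).
have [K K0 hK] := mderiv_bounded (mderivM hP hQ).
have [p p0 hp] := mderiv_bounded hP; have [q q0 hq] := mderiv_bounded hQ.
have hX g : mxN (X g) <= 2 * q.
  have E : X g = Q g + X g *m (1%:M - P g *m Q g).
    by rewrite mulmxBr mulmx1 mulmxA XP mul1mx addrC subrK.
  have := mxND (Q g) (X g *m (1%:M - P g *m Q g)); rewrite -E.
  have := mxNM (X g) (1%:M - P g *m Q g); have := PQ g; have [? _] := hq g.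
  have := mxN_ge0 (X g); have := mxN_ge0 (1%:M - P g *m Q g); nra.
have iter k : exists U U', mderiv S phi U U' /\
    forall g, mxN (1%:M - P g *m U g) <= 1 / 4 * 2^-1 ^+ k /\
              mxN (P' g *m U g + P g *m U' g) <= K * 2^-1 ^+ k.
  elim: k => [|k [U [U' [hU HU]]]].
    by exists Q, Q'; split=> // g; rewrite expr0 !mulr1; split; [|have [] := hK g].
  pose E g := 1%:M - P g *m U g; pose V g := P' g *m U g + P g *m U' g.
  have hE : mderiv S phi E (fun g => 0 - V g).
    by apply: mderivD (mderiv_cst _) (mderivN (mderivM hP hU)).
  exists (fun g => U g *m (1%:M + E g)), (fun g => U' g *m (1%:M + E g) + U g *m (0 + (0 - V g))).
  split; first exact: (mderivM hU (mderivD (mderiv_cst _) hE)).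
  move=> g; have [e1 e2] := HU g; rewrite -/(E g) -/(V g) in e1 e2.
  have k0 : 0 <= 2^-1 ^+ k :> R by rewrite exprn_ge0.
  have k1 : 2^-1 ^+ k <= 1 :> R by rewrite exprn_ile1 // invf_le1 // ler1n.
  have PU : P g *m U g = 1%:M - E g by rewrite opprB addrCA subrr addr0.
  split.
    have -> : 1%:M - P g *m (U g *m (1%:M + E g)) = E g *m E g.
      by rewrite mulmxA PU; mx_ring.
    apply: le_trans (mxNM _ _) _; rewrite exprS; have := mxN_ge0 (E g); nra.
  have -> : P' g *m (U g *m (1%:M + E g)) +
      P g *m (U' g *m (1%:M + E g) + U g *m (0 + (0 - V g))) = V g *m E g + E g *m V g.
    exact: newton_id.
  have := mxND (V g *m E g) (E g *m V g); have := mxNM (V g) (E g); have := mxNM (E g) (V g).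
  rewrite exprS; have := mxN_ge0 (E g); have := mxN_ge0 (V g).
  set v := mxN (V g) in e2 *; set w := mxN (E g) in e1 *.
  move=> ? ? ? ? ?; have : v * w <= (K * 2^-1 ^+ k) * (1 / 4) by apply: ler_pM => //; lra.
  lra.
apply: mderiv_lim => e e0.
pose L := 2 * q * p * (2 * q) + 2 * q * K + 2 * q.
have L0 : 0 <= L by rewrite !addr_ge0 ?mulr_ge0.
have [k hk] := exists_half_le L e0.
have [U [U' [hU HU]]] := iter k; exists U, U'; split=> // g.
have [e1 e2] := HU g; set r := 2^-1 ^+ k in hk e1 e2.
have r0 : 0 <= r by rewrite exprn_ge0.
set E := 1%:M - P g *m U g in e1; set V := P' g *m U g + P g *m U' g in e2.
have XU : X g - U g = X g *m E by rewrite mulmxBr mulmx1 mulmxA XP mul1mx.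
have n1 : mxN (X g - U g) <= 2 * q * r.
  rewrite XU; apply: le_trans (mxNM _ _) _; apply: ler_pM; rewrite ?mxN_ge0 ?hX //; lra.
split.
  apply: le_trans n1 _; apply: le_trans hk; apply: ler_wpM2r => //.
  by rewrite /L lerDr addr_ge0 ?mulr_ge0.
(* [V] is the derivative of [P U], so [X V = X P' U + U']. The error of the derivative is thus
   controlled by [X - U] and [V], both of order [r]. *)
have -> : - (X g *m P' g *m X g) - U' g = - (X g *m P' g *m (X g - U g)) - X g *m V.
  have -> : X g *m V = X g *m P' g *m U g + U' g by rewrite mulmxDr !mulmxA XP mul1mx.
  by mx_ring.
have := mxNB (- (X g *m P' g *m (X g - U g))) (X g *m V); rewrite mxNN.
have := mxNM (X g *m P' g) (X g - U g); have := mxNM (X g) (P' g); have := mxNM (X g) V.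
have := hX g; have [_] := hp g; have := mxN_ge0 (X g); have := mxN_ge0 (P' g).
have := mxN_ge0 V; have := mxN_ge0 (X g - U g).
set x := mxN (X g); set y := mxN (P' g); set v := mxN V in e2 *; set w := mxN (X g - U g) in n1 *.
set xy := mxN (X g *m P' g) => ? ? ? ? ? ? ? ? ? ?.
have : x * v <= 2 * q * (K * r) by apply: ler_pM.
have : x * y <= 2 * q * p by apply: ler_pM.
move=> hxy ?; have : xy * w <= 2 * q * p * (2 * q * r).
  by apply: ler_pM => //; [exact: mxN_ge0|lra].
have : L * r = 2 * q * p * (2 * q * r) + 2 * q * (K * r) + 2 * q * r by rewrite /L; ring.
have : 0 <= 2 * q * r by rewrite !mulr_ge0.
lra.
Qed.

End calculus.
End derivations.

(** * The cubic form tr a[b, c] and the degree *)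

Ltac mx_tr_ring :=
  rewrite ?(mulmxDl, mulmxDr, mulmxBl, mulmxBr, mulNmx, mulmxN, mul1mx, mulmx1, mulmxA, mul0mx, mulmx0);
  do 4 rewrite ?mxtraceD ?raddfN /=.

Section cubic_trace.
Variables (K : comNzRingType) (n : nat).
Local Notation M := 'M[K]_n.
Implicit Types a b c : M.

(** For [theta = A^-1 dA], the 3-form tr (theta^3) takes three times this value on the three
    directions, by cyclicity of the trace. *)
Definition cubic a b c : K := \tr (a *m (b *m c - c *m b)).

Lemma cubicZ (k : K) a b c : cubic (k *: a) (k *: b) (k *: c) = k ^+ 3 * cubic a b c.
Proof.
rewrite /cubic -!scalemxAl -!scalemxAr !scalerA -scalerBr -scalemxAr.
by rewrite scalerA mxtraceZ; congr (_ * _); ring.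
Qed.

Lemma cubicN a b c : cubic (- a) (- b) (- c) = - cubic a b c.
Proof. by rewrite -!scaleN1r cubicZ; ring. Qed.

Lemma cubic_conj (x y : M) a b c : x *m y = 1%:M ->
  cubic (y *m a *m x) (y *m b *m x) (y *m c *m x) = cubic a b c.
Proof.
move=> xy; rewrite /cubic.
have E u v : y *m u *m x *m (y *m v *m x) = y *m (u *m v) *m x.
  by rewrite !mulmxA -(mulmxA _ x y) xy mulmx1.
rewrite !E -mulmxBl -mulmxBr E mxtrace_mulC !mulmxA xy mul1mx.
by [].
Qed.

(* With [a_i = A^-1 D_i A] and [b_i = (D_i B) B^-1] one has
   [D_i a_j = - a_i a_j + aa_ij] and [D_i b_j = bb_ij - b_j b_i], where [aa]
   and [bb] are symmetric; the mixed terms are thus minus the trace of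
   [sum_cyc D_i (a_j b_k - a_k b_j)]. *)
Lemma cubicD (a0 a1 a2 b0 b1 b2 aa01 aa02 aa12 bb01 bb02 bb12 : M) :
  cubic (a0 + b0) (a1 + b1) (a2 + b2) = cubic a0 a1 a2 + cubic b0 b1 b2 -
   (\tr ((- (a0 *m a1) + aa01) *m b2 + a1 *m (bb02 - b2 *m b0)
       - ((- (a0 *m a2) + aa02) *m b1 + a2 *m (bb01 - b1 *m b0)))
  + \tr ((- (a1 *m a2) + aa12) *m b0 + a2 *m (bb01 - b0 *m b1)
       - ((- (a1 *m a0) + aa01) *m b2 + a0 *m (bb12 - b2 *m b1)))
  + \tr ((- (a2 *m a0) + aa02) *m b1 + a0 *m (bb12 - b1 *m b2)
       - ((- (a2 *m a1) + aa12) *m b0 + a1 *m (bb02 - b0 *m b2)))).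
Proof.
have rot (x y z : M) : \tr (x *m y *m z) = \tr (y *m z *m x).
  by rewrite mxtrace_mulC mulmxA mxtrace_mulC mulmxA mxtrace_mulC mulmxA.
rewrite /cubic; mx_tr_ring.
(* Each word is rotated to a fixed cyclic representative, so that [ring] meets equal traces as equal
   atoms. *)
rewrite (rot b0 a1 a2) (rot b0 a2 a1) (rot b0 b1 a2) (rot b1 a2 b0) (rot b0 b2 a1) (rot b2 a1 b0).
rewrite (rot a0 b1 a2) (rot b1 a2 a0) (rot a0 b2 a1) (rot b2 a1 a0) (rot b0 a1 b2) (rot b0 a2 b1).
ring.
Qed.

End cubic_trace.

Section degree.
Context {R : realType} {G : topologicalZmodType} {Gamma : zmodType}.
Context (chi : Gamma -> G -> R[i]) (mu : probability (borel G) R).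
Hypothesis G_compact : compact [set: G].
Hypothesis chi_dual : is_character_group chi.
Hypothesis mu_haar : is_haar mu.
Local Notation C := R[i].
Local Notation Cint := (Cintegral mu).
Variable n : nat.
Local Notation M := 'M[C]_n.
Local Notation mderiv := (@mderiv R G Gamma chi n).
Local Notation mev := (@mev R G Gamma chi n).
Local Notation mevD := (@mevD R G Gamma chi n).
Variable phi : 'I_3 -> Gamma -> C.
Hypothesis phiD : forall i x y, phi i (x + y) = phi i x + phi i y.

Definition mcont (A : G -> M) : Prop := forall i j, cont (fun g => A g i j).

Lemma mcontM (A B : G -> M) : mcont A -> mcont B -> mcont (fun g => A g *m B g).
Proof.
move=> cA cB i j; under eq_fun do rewrite mxE.
by apply: cont_sum => k; apply: contM.
Qed.

Lemma mcontD (A B : G -> M) : mcont A -> mcont B -> mcont (fun g => A g + B g).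
Proof. by move=> cA cB i j; under eq_fun do rewrite mxE; apply: contD. Qed.

Lemma mcontN (A : G -> M) : mcont A -> mcont (fun g => - A g).
Proof.
move=> cA i j; under eq_fun do rewrite mxE -mulN1r.
by apply: contM; [exact: cont_cst|].
Qed.

Lemma cont_tr (A : G -> M) : mcont A -> cont (fun g => \tr (A g)).
Proof. by move=> cA; apply: cont_sum. Qed.

Lemma cont_cubic (A B D : G -> M) : mcont A -> mcont B -> mcont D ->
  cont (fun g => cubic (A g) (B g) (D g)).
Proof.
move=> cA cB cD.
exact: (cont_tr (mcontM cA (mcontD (mcontM cB cD) (mcontN (mcontM cD cB))))).
Qed.

Lemma cont_lim (f : G -> C) :
  (forall e : R, 0 < e -> exists2 h, cont h & forall g, normc (f g - h g) <= e) ->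
  cont f.
Proof.
move=> H; apply/contP => g e e0.
have e4 : 0 < e / 4 by lra.
have [h /contP ch fh] := H _ e4; apply: filterS (ch g _ e4) => x hx.
have -> : f x - f g = (f x - h x) + ((h x - h g) - (f g - h g)) by ring.
apply: le_lt_trans (le_normcD _ _) _.
have := le_normcD (h x - h g) (- (f g - h g)); rewrite normcN.
by have := fh x; have := fh g; lra.
Qed.

Lemma mderiv_cont S p A A' : mderiv S p A A' -> mcont A /\ mcont A'.
Proof.
move=> hA; split=> i j; apply: cont_lim => e e0; have [s _ hs] := hA e e0.
  exists (fun g => mev s g i j); first exact: mev_cont.
  move=> g; have [h _] := hs g; apply: le_trans h.
  by rewrite -mx_oppE -mx_addE mxN_entry.
exists (fun g => mevD p s g i j).
  by under eq_fun do rewrite -mev_derp; exact: mev_cont.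
move=> g; have [_ h] := hs g; apply: le_trans h.
by rewrite -mx_oppE -mx_addE mxN_entry.
Qed.

Lemma Cint_tr_mev s : Cint (fun g => \tr (mev s g)) =
  \sum_(x <- s) \tr x.1 * (x.2 == 0)%:R.
Proof.
rewrite /mev; under Cint_ext do rewrite raddf_sum.
rewrite (Cint_sum G_compact) => [|x]; last first.
  under eq_fun do rewrite /= mxtraceZ.
  by apply: contM; [exact: (cont_chi chi_dual)|exact: cont_cst].
apply: eq_bigr => x _; rewrite -(Cint_chi G_compact chi_dual mu_haar).
under Cint_ext do rewrite /= mxtraceZ mulrC.
by rewrite CintZ //; exact: (cont_chi chi_dual).
Qed.

Lemma small_eq0 (z : C) K : (forall e : R, 0 < e -> normc z <= K * e) -> z = 0.
Proof.
move=> H; apply: eq0_normc; apply: le_anti; rewrite normc_ge0 andbT.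
rewrite leNgt; apply/negP => z0.
have K0 : 0 < `|K| + 1 by rewrite ltr_pwDr.
have e0 : 0 < normc z / (2 * (`|K| + 1)) by rewrite divr_gt0 ?mulr_gt0.
have := H _ e0; rewrite leNgt => /negP; apply.
have := ler_norm K; set e := normc z / _ in e0 *.
have : normc z = 2 * (`|K| + 1) * e by rewrite mulrC divfK //; lra.
nra.
Qed.

(** The integral sees only the frequency 0, which [D] multiplies by [p 0 = 0]; this passes to
    uniform limits. It plays the part of integration by parts. *)
Lemma Cint_tr_mderiv S p A A' : (forall x y, p (x + y) = p x + p y) ->
  mderiv S p A A' -> Cint (fun g => \tr (A' g)) = 0.
Proof.
move=> pD hA; have p0 := deriv_phi0 pD.
have [_ cA'] := mderiv_cont hA.
apply: (@small_eq0 _ 1) => e e0; rewrite mul1r.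
have [s _ hs] := hA _ e0.
have z : Cint (fun g => \tr (mevD p s g)) = 0.
  under Cint_ext do rewrite -mev_derp.
  rewrite Cint_tr_mev big_map big1 // => x _ /=.
  by case: eqP => [->|]; rewrite ?p0 ?scale0r ?raddf0 ?mul0r ?mulr0.
have c1 : mcont (mevD p s).
  by move=> i j; under eq_fun do rewrite -mev_derp; exact: mev_cont.
have c2 : cont (fun g => \tr (A' g - mevD p s g)).
  exact: (cont_tr (mcontD cA' (mcontN c1))).
have -> : Cint (fun g => \tr (A' g)) = Cint (fun g => \tr (A' g - mevD p s g)).
  have h := CintD G_compact mu c2 (cont_tr c1); rewrite z addr0 in h; rewrite -h.
  by apply: Cint_ext => g; rewrite -raddfD subrK.
apply: (normc_Cint G_compact) => // g; apply: le_trans (mxN_tr _) _.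
by have [] := hs g.
Qed.

(* If 0 is not a sum of two elements of S other than 0 + 0, then the factor
   A' has no constant term and H * A' has none either. *)
Lemma Cint_tr_mderiv_pos (S : set Gamma) p A A' H H' :
  (forall x y, p (x + y) = p x + p y) ->
  (forall x y, S x -> S y -> x + y = 0 -> y = 0) ->
  mderiv S p H H' -> mderiv S p A A' -> Cint (fun g => \tr (H g *m A' g)) = 0.
Proof.
move=> pD pos hH hA; have p0 := deriv_phi0 pD.
have [K K0 hK] := mderiv_bounded chi_dual hA.
have [cH _] := mderiv_cont hH; have [_ cA'] := mderiv_cont hA.
apply: (@small_eq0 _ (K + 1)) => e e0.
have [s Ss hs] := hH _ e0.
have [L hL] := mev_bounded chi_dual s.
have L0 : 0 <= L := le_trans (mxN_ge0 _) (hL 0).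
(* The approximation of [A'] is chosen after [s]: its precision must outweigh the bound [L] of
   [mev s]. *)
have e1 : 0 < e / (L + 1) by rewrite divr_gt0 //; lra.
have [t St ht] := hA _ e1.
have z : Cint (fun g => \tr (mev s g *m mevD p t g)) = 0.
  under Cint_ext do rewrite -mev_derp -(mev_mulp chi_dual).
  rewrite Cint_tr_mev big_seq big1 // => _ /allpairsP[[x y] /= [xs /mapP[w wt ->] ->]] /=.
  case: eqP => [xw|]; last by rewrite mulr0.
  by rewrite (pos _ _ (Ss _ xs) (St _ wt) xw) p0 scale0r mulmx0 raddf0 mul0r.
have c1 : mcont (mevD p t).
  by move=> i j; under eq_fun do rewrite -mev_derp; exact: mev_cont.
have c2 : mcont (mev s) by move=> i j; exact: mev_cont.
have c3 := mcontM c2 c1; have c5 := mcontM cH cA'.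
have c4 : mcont (fun g => H g *m A' g - mev s g *m mevD p t g).
  exact: (mcontD c5 (mcontN c3)).
have -> : Cint (fun g => \tr (H g *m A' g)) =
    Cint (fun g => \tr (H g *m A' g - mev s g *m mevD p t g)).
  have h := CintD G_compact mu (cont_tr c4) (cont_tr c3); rewrite z addr0 in h; rewrite -h.
  by apply: Cint_ext => g; rewrite -raddfD subrK.
apply: (normc_Cint G_compact) => [|g]; first exact: (cont_tr c4).
apply: le_trans (mxN_tr _) _.
have -> : H g *m A' g - mev s g *m mevD p t g =
   (H g - mev s g) *m A' g + mev s g *m (A' g - mevD p t g) by mx_ring.
apply: le_trans (mxND _ _) _.
have := mxNM (H g - mev s g) (A' g); have := mxNM (mev s g) (A' g - mevD p t g).
have [h1 _] := hs g; have [_ h2] := ht g; have [_ h3] := hK g; have h4 := hL g.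
have : mxN (H g - mev s g) * mxN (A' g) <= e * K by apply: ler_pM => //; exact: mxN_ge0.
have : mxN (mev s g) * mxN (A' g - mevD p t g) <= (L + 1) * (e / (L + 1)).
  by apply: ler_pM => //; rewrite ?mxN_ge0 //; lra.
rewrite [(L + 1) * _]mulrC divfK; last by rewrite gt_eqF //; lra.
lra.
Qed.

Definition i0 : 'I_3 := @Ordinal 3 0 isT.
Definition i1 : 'I_3 := @Ordinal 3 1 isT.
Definition i2 : 'I_3 := @Ordinal 3 2 isT.

(* [A1 i] is D_i A, [A2 i j] is D_i D_j A and [X] is the inverse of [A]. *)
Definition smooth (S : set Gamma) (A : G -> M) (A1 : 'I_3 -> G -> M)
    (A2 : 'I_3 -> 'I_3 -> G -> M) (X : G -> M) : Prop :=
  [/\ forall g, A g *m X g = 1%:M,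
      forall i, mderiv S (phi i) A (A1 i),
      forall i, mderiv S (phi i) X (fun g => - (X g *m A1 i g *m X g)),
      forall i j, mderiv S (phi i) (A1 j) (A2 i j)
    & forall i j g, A2 i j g = A2 j i g].

Definition wz (A1 : 'I_3 -> G -> M) (X : G -> M) : C :=
  Cint (fun g => cubic (X g *m A1 i0 g) (X g *m A1 i1 g) (X g *m A1 i2 g)).

Definition deg S (F : G -> M) (c : C) : Prop :=
  exists A1 A2 X, smooth S F A1 A2 X /\ c = wz A1 X.

Section operations.
Variable S : set Gamma.
Hypothesis S0 : S 0.
Hypothesis SD : forall x y, S x -> S y -> S (x + y).

Lemma smooth_mcont A A1 A2 X : smooth S A A1 A2 X -> [/\ mcont A, forall i, mcont (A1 i) & mcont X].
Proof.
by move=> [_ h1 h2 _ _]; split=> [|i|]; [case: (mderiv_cont (h1 i0))|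
  case: (mderiv_cont (h1 i))|case: (mderiv_cont (h2 i0))].
Qed.

Lemma smoothM A A1 A2 X B B1 B2 Y :
  smooth S A A1 A2 X -> smooth S B B1 B2 Y ->
  exists AB2, smooth S (fun g => A g *m B g)
    (fun i g => A1 i g *m B g + A g *m B1 i g) AB2 (fun g => Y g *m X g).
Proof.
move=> [AX hA hX hA1 symA] [BY hB hY hB1 symB].
exists (fun i j g => (A2 i j g *m B g + A1 j g *m B1 i g) + (A1 i g *m B1 j g + A g *m B2 i j g)).
split=> [g|i|i|i j|i j g].
- by rewrite mulmxA -(mulmxA (A g)) BY mulmx1.
- exact: mderivM.
- apply: mderiv_ext (mderivM chi_dual SD (@phiD i) (hY i) (hX i)) => g //.
  have BY' : Y g *m B g = 1%:M by apply: mulmx1C.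
  have AX' : X g *m A g = 1%:M by apply: mulmx1C.
  rewrite mulmxDr mulmxDl !mulmxA -(mulmxA _ (B g) (Y g)) BY mulmx1.
  by rewrite -(mulmxA (Y g) (X g) (A g)) AX' mulmx1 opprD addrC mulNmx mulmxN !mulmxA.
- by apply: mderivD; apply: mderivM.
- by rewrite symA symB addrACA.
Qed.

Lemma cont_wz_integrand (A1 : 'I_3 -> G -> M) X : (forall i, mcont (A1 i)) -> mcont X ->
  cont (fun g => cubic (X g *m A1 i0 g) (X g *m A1 i1 g) (X g *m A1 i2 g)).
Proof.
by move=> cA cX; exact: (cont_cubic (mcontM cX (cA i0)) (mcontM cX (cA i1)) (mcontM cX (cA i2))).
Qed.

Lemma wz_ext (A1 B1 : 'I_3 -> G -> M) X Y :
  (forall i g, X g *m A1 i g = Y g *m B1 i g) -> wz A1 X = wz B1 Y.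
Proof. by move=> E; apply: Cint_ext => g; rewrite !E. Qed.

Lemma Cint_mixed (u a b f1 f2 f3 : G -> C) : cont u -> cont a -> cont b ->
  cont f1 -> cont f2 -> cont f3 -> Cint f1 = 0 -> Cint f2 = 0 -> Cint f3 = 0 ->
  (forall g, u g = a g + b g - (f1 g + f2 g + f3 g)) -> Cint u = Cint a + Cint b.
Proof.
move=> cu ca cb c1 c2 c3 z1 z2 z3 E.
have c12 := contD c1 c2.
rewrite -(CintD G_compact mu ca cb).
have <- : Cint (fun g => u g + (f1 g + f2 g + f3 g)) = Cint u.
  rewrite (CintD G_compact mu cu (contD c12 c3)) (CintD G_compact mu c12 c3).
  by rewrite (CintD G_compact mu c1 c2) z1 z2 z3 !addr0.
by apply: Cint_ext => g; rewrite E subrK.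
Qed.

Lemma wzM A A1 A2 X B B1 B2 Y :
  smooth S A A1 A2 X -> smooth S B B1 B2 Y ->
  wz (fun i g => A1 i g *m B g + A g *m B1 i g) (fun g => Y g *m X g) = wz A1 X + wz B1 Y.
Proof.
move=> sA sB; have [cA cA1 cX] := smooth_mcont sA; have [cB cB1 cY] := smooth_mcont sB.
have [AX hA hX hA1 symA] := sA; have [BY hB hY hB1 symB] := sB.
(* Logarithmic derivatives on the left for [A] and on the right for [B]: that of the product is then
   [B^-1 (a + b) B], and [cubic] does not see the conjugation. *)
pose a i g := X g *m A1 i g; pose b i g := B1 i g *m Y g.
have ca i : mcont (a i) by exact: (mcontM cX (cA1 i)).
have cb i : mcont (b i) by exact: (mcontM (cB1 i) cY).
have YB g : Y g *m B g = 1%:M by apply: mulmx1C.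
have XA g : X g *m A g = 1%:M by apply: mulmx1C.
have wB : wz B1 Y = Cint (fun g => cubic (b i0 g) (b i1 g) (b i2 g)).
  apply: Cint_ext => g; rewrite -(cubic_conj (b i0 g) (b i1 g) (b i2 g) (BY g)).
  have E i : Y g *m B1 i g = Y g *m b i g *m B g by rewrite /b !mulmxA -(mulmxA _ (Y g)) YB mulmx1.
  by cbv beta; rewrite (E i0) (E i1) (E i2).
have wAB : wz (fun i g => A1 i g *m B g + A g *m B1 i g) (fun g => Y g *m X g) =
    Cint (fun g => cubic (a i0 g + b i0 g) (a i1 g + b i1 g) (a i2 g + b i2 g)).
  apply: Cint_ext => g.
  rewrite -(cubic_conj (a i0 g + b i0 g) (a i1 g + b i1 g) (a i2 g + b i2 g) (BY g)).
  have E i : Y g *m X g *m (A1 i g *m B g + A g *m B1 i g) = Y g *m (a i g + b i g) *m B g.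
    rewrite /a /b mulmxDr mulmxDr mulmxDl !mulmxA -(mulmxA _ (Y g) (B g)) YB mulmx1.
    by rewrite -(mulmxA _ (X g) (A g)) XA mulmx1.
  by cbv beta; rewrite (E i0) (E i1) (E i2).
pose aa i j g := X g *m A2 i j g; pose bb i j g := B2 i j g *m Y g.
pose da i j g := - (a i g *m a j g) + aa i j g.
pose db i j g := bb i j g - b j g *m b i g.
have ha i j : mderiv S (phi i) (a j) (da i j).
  apply: (mderiv_ext (A := a j) _ _ (mderivM chi_dual SD (@phiD i) (hX i) (hA1 i j))) => [//|g].
  by rewrite /da /a /aa mulNmx !mulmxA.
have hb i j : mderiv S (phi i) (b j) (db i j).
  apply: (mderiv_ext (A := b j) _ _ (mderivM chi_dual SD (@phiD i) (hB1 i j) (hY i))) => [//|g].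
  by rewrite /db /b /bb mulmxN !mulmxA.
pose f (i j k : 'I_3) g := a j g *m b k g - a k g *m b j g.
pose df (i j k : 'I_3) g := da i j g *m b k g + a j g *m db i k g - (da i k g *m b j g + a k g *m db i j g).
have hf i j k : mderiv S (phi i) (f i j k) (df i j k).
  apply: mderivD; [|apply: (mderivN chi_dual S0 SD (@phiD i))];
  exact: (mderivM chi_dual SD (@phiD i) (ha _ _) (hb _ _)).
have If i j k : Cint (fun g => \tr (df i j k g)) = 0 by exact: (Cint_tr_mderiv (@phiD i) (hf i j k)).
have cf i j k : cont (fun g => \tr (df i j k g)).
  by have [_ cdf] := mderiv_cont (hf i j k); apply: cont_tr cdf.
have wA : wz A1 X = Cint (fun g => cubic (a i0 g) (a i1 g) (a i2 g)) := erefl.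
have cca := cont_cubic (ca i0) (ca i1) (ca i2); have ccb := cont_cubic (cb i0) (cb i1) (cb i2).
have cc := cont_cubic (mcontD (ca i0) (cb i0)) (mcontD (ca i1) (cb i1)) (mcontD (ca i2) (cb i2)).
rewrite wAB wA wB.
refine (Cint_mixed cc cca ccb (cf i0 i1 i2) (cf i1 i2 i0) (cf i2 i0 i1)
  (If i0 i1 i2) (If i1 i2 i0) (If i2 i0 i1) _) => g.
rewrite (cubicD (a i0 g) (a i1 g) (a i2 g) (b i0 g) (b i1 g) (b i2 g)
   (aa i0 i1 g) (aa i0 i2 g) (aa i1 i2 g) (bb i0 i1 g) (bb i0 i2 g) (bb i1 i2 g)).
have s1 i j : aa i j g = aa j i g by rewrite /aa symA.
have s2 i j : bb i j g = bb j i g by rewrite /bb symB.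
rewrite /df /da /db (s1 i1 i0) (s1 i2 i0) (s1 i2 i1) (s2 i1 i0) (s2 i2 i0) (s2 i2 i1).
by [].
Qed.

End operations.
End degree.

Lemma exists_invS2_le (R : realType) (e : R) : 0 < e -> exists m, (m.+1%:R)^-1 ^+ 2 <= e.
Proof.
move=> e0; pose m := Num.Def.archi_bound e^-1; exists m.
have hm : e^-1 < m%:R by apply: archi_boundP; rewrite invr_ge0 ltW.
have m0 : 0 < m.+1%:R :> R by [].
have em : (m.+1%:R)^-1 <= e.
  rewrite -[leRHS]invrK lef_pV2 ?posrE ?invr_gt0 //.
  by apply: ltW; apply: lt_le_trans hm _; rewrite ler_nat.
have m1 : (m.+1%:R : R)^-1 <= 1 by rewrite invf_le1 // ler1n.
have x0 : 0 <= (m.+1%:R : R)^-1 by rewrite invr_ge0.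
by apply: le_trans em; rewrite expr2 ler_piMr.
Qed.

(** * The degree of inverses, of functions in a half-space, and of functions near 1 *)

Section degree_properties.
Context {R : realType} {G : topologicalZmodType} {Gamma : zmodType}.
Context (chi : Gamma -> G -> R[i]) (mu : probability (borel G) R).
Hypothesis G_compact : compact [set: G].
Hypothesis chi_dual : is_character_group chi.
Hypothesis mu_haar : is_haar mu.
Local Notation C := R[i].
Local Notation Cint := (Cintegral mu).
Variable n : nat.
Local Notation M := 'M[C]_n.
Local Notation mderiv := (@mderiv R G Gamma chi n).
Local Notation mev := (@mev R G Gamma chi n).
Local Notation mevD := (@mevD R G Gamma chi n).
Variable phi : 'I_3 -> Gamma -> C.
Hypothesis phiD : forall i x y, phi i (x + y) = phi i x + phi i y.
Local Notation smooth := (@smooth R G Gamma chi n phi).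
Local Notation wz := (@wz R G mu n).
Local Notation deg := (@deg R G Gamma chi mu n phi).

Section freq.
Variable S : set Gamma.
Hypothesis S0 : S 0.
Hypothesis SD : forall x y, S x -> S y -> S (x + y).

Lemma smoothV A A1 A2 X : smooth S A A1 A2 X ->
  exists X2, smooth S X (fun i g => - (X g *m A1 i g *m X g)) X2 A.
Proof.
move=> [AX hA hX hA1 symA].
have XA g : X g *m A g = 1%:M by apply: mulmx1C.
pose X1 i g := - (X g *m A1 i g *m X g).
exists (fun i j g => - ((X1 i g *m A1 j g + X g *m A2 i j g) *m X g + X g *m A1 j g *m X1 i g)).
split=> [g|i|i|i j|i j g]; first exact: XA.
- exact: hX.
- refine (mderiv_ext (A := A) (A' := A1 i) _ _ (hA i)) => [//|g].
  by rewrite mulmxN mulNmx opprK !mulmxA (AX g) mul1mx; rewrite -mulmxA XA mulmx1.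
- refine (mderivN chi_dual S0 SD (@phiD i) _).
  exact: (mderivM chi_dual SD (@phiD i) (mderivM chi_dual SD (@phiD i) (hX i) (hA1 i j)) (hX i)).
- rewrite /X1; cbv beta; rewrite symA; move: (X g) (A1 i g) (A1 j g) (A2 j i g) => x a b c.
  have E (u v w : M) : - (- u + w - v) = - (- v + w - u).
    by rewrite addrAC (addrC (- u)) addrAC.
  by rewrite !mulmxDl !mulNmx !mulmxN !mulmxA; exact: E.
Qed.

Lemma wzV A A1 A2 X : smooth S A A1 A2 X ->
  wz (fun i g => - (X g *m A1 i g *m X g)) A = - wz A1 X.
Proof.
move=> sA; have [cA cA1 cX] := smooth_mcont chi_dual sA; have [AX _ _ _ _] := sA.
have XA g : X g *m A g = 1%:M by apply: mulmx1C.
have c1 := cont_wz_integrand cA1 cX.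
rewrite -[RHS]mulN1r; refine (etrans _ (CintZ G_compact mu (-1) c1)).
apply: Cint_ext => g.
have E i : A g *m - (X g *m A1 i g *m X g) = A g *m (- (X g *m A1 i g)) *m X g.
  by rewrite !mulmxN !mulNmx !mulmxA.
refine (etrans (f_equal3 (@cubic _ _) (E i0) (E i1) (E i2)) _).
by rewrite (cubic_conj _ _ _ (XA g)) cubicN mulN1r.
Qed.

Lemma wz_pos A A1 A2 X : (forall x y, S x -> S y -> x + y = 0 -> y = 0) ->
  smooth S A A1 A2 X -> wz A1 X = 0.
Proof.
move=> pos sA; have [AX hA hX hA1 symA] := sA.
(* By cyclicity the integrand is [tr (H D_0 A)] with [H = [a_1, a_2] X]. Here [H] has its
   frequencies in [S], and [D_0 A] has no constant term. *)
have hi i := mderivM chi_dual SD (@phiD i0) (hX i0) (hA1 i0 i).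
have hij i j := mderivM chi_dual SD (@phiD i0) (hi i) (hi j).
have hH := mderivM chi_dual SD (@phiD i0)
  (mderivD (hij i1 i2) (mderivN chi_dual S0 SD (@phiD i0) (hij i2 i1))) (hX i0).
refine (etrans _ (Cint_tr_mderiv_pos G_compact chi_dual mu_haar (@phiD i0) pos hH (hA i0))).
apply: Cint_ext => g; rewrite /cubic mxtrace_mulC.
exact: (congr1 mxtrace (mulmxA _ _ _)).
Qed.

Lemma cubic_le (a b c : M) L : mxN a <= L -> mxN b <= L -> mxN c <= L ->
  normc (cubic a b c) <= 2 * L ^+ 3.
Proof.
move=> ha hb hc; apply: le_trans (mxN_tr _) _; apply: le_trans (mxNM _ _) _.
have L0 : 0 <= L := le_trans (mxN_ge0 _) ha.
have h : mxN (b *m c - c *m b) <= 2 * L ^+ 2.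
  apply: le_trans (mxNB _ _) _.
  have := mxNM b c; have := mxNM c b.
  have : mxN b * mxN c <= L * L by apply: ler_pM; rewrite ?mxN_ge0.
  have : mxN c * mxN b <= L * L by apply: ler_pM; rewrite ?mxN_ge0.
  rewrite expr2; lra.
have -> : 2 * L ^+ 3 = L * (2 * L ^+ 2) by ring.
by apply: ler_pM; rewrite ?mxN_ge0.
Qed.

(* Along the segment [A_t = 1 + t (F - 1)] multiplicativity gives
   [wz A_t - wz A_s = wz (A_t A_s^-1)], which is [O(|t - s|^3)] because the
   logarithmic derivatives of [A_t A_s^-1] are [O(|t - s|)]; so [wz] is constant. *)
Lemma wz_near1 F A1 A2 X : smooth S F A1 A2 X ->
  (forall g, mxN (1%:M - F g) <= 1 / 4) -> wz A1 X = 0.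
Proof.
move=> sF near1; have [FX hF hX hA1 symF] := sF.
pose A (t : C) g : M := 1%:M + t *: (F g - 1%:M).
pose Xt (t : C) g := invmx (A t g).
have A1E (t : C) g : normc t <= 1 -> mxN (1%:M - A t g) <= 1 / 4.
  move=> t1; rewrite /A opprD addrA subrr add0r mxNN mxNZ mxN_distC.
  have := near1 g; have := mxN_ge0 (1%:M - F g); have := normc_ge0 t; nra.
have AX (t : C) g : normc t <= 1 -> A t g *m Xt t g = 1%:M.
  move=> t1; apply: mulmxV; apply: near1_unitmx; apply: le_lt_trans (A1E t g t1) _; lra.
have hX2 (t : C) g : normc t <= 1 -> mxN (Xt t g) <= 2 * n%:R.
  move=> t1; apply: le_trans (near1_invmx (AX t g t1) (A1E t g t1) _) _; first by lra.
  have n0 : 0 <= n%:R :> R by [].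
  rewrite ler_pdivrMr; lra.
have hA2 (t : C) g : normc t <= 1 -> mxN (A t g) <= n%:R + 1.
  move=> t1; have := mxNB 1%:M (1%:M - A t g); rewrite opprB addrCA subrr addr0.
  rewrite mxN_scalar normc1 mulr1; have := A1E t g t1; lra.
have sA (t : C) : normc t <= 1 ->
    smooth S (A t) (fun i g => t *: A1 i g) (fun i j g => t *: A2 i j g) (Xt t).
  move=> t1.
  have hA i : mderiv S (phi i) (A t) (fun g => t *: A1 i g).
    apply: (mderiv_ext _ _ (mderivD (mderiv_cst chi_dual S0 (@phiD i) 1%:M)
      (mderivZ chi_dual S0 SD (@phiD i) t
        (mderivD (hF i) (mderiv_cst chi_dual S0 (@phiD i) (-1%:M)))))) => g //.
    by rewrite add0r addr0.
  split=> [g|i|i|i j|i j g]; first exact: AX.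
  - exact: hA.
  - apply: (mderiv_inv chi_dual S0 SD (@phiD i) (hA i) (mderiv_cst chi_dual S0 (@phiD i) 1%:M)) => g.
      by rewrite mulmx1; exact: A1E.
    exact: AX.
  - exact: (mderivZ chi_dual S0 SD (@phiD i) t (hA1 i j)).
  - by rewrite symF.
pose h (t : C) := wz (fun i g => t *: A1 i g) (Xt t).
have [K0 K0p hK0] := mderiv_bounded chi_dual (hF i0).
have [K1 K1p hK1] := mderiv_bounded chi_dual (hF i1).
have [K2 K2p hK2] := mderiv_bounded chi_dual (hF i2).
pose k := K0 + K1 + K2.
have k0 : 0 <= k by rewrite !addr_ge0.
pose L := (n%:R + 1) * (2 * n%:R) * (2 * n%:R) * k * (2 * n%:R).
have hL (s t : C) g (B : M) : normc s <= 1 -> normc t <= 1 -> mxN B <= k ->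
    mxN (A s g *m Xt t g *m Xt s g *m B *m Xt s g) <= L.
  move=> s1 t1 Bk; have n0 : 0 <= n%:R :> R by [].
  have mm (a b : M) (x y : R) : mxN a <= x -> mxN b <= y -> mxN (a *m b) <= x * y.
    by move=> ? ?; apply: le_trans (mxNM _ _) _; apply: ler_pM; rewrite ?mxN_ge0.
  have hX2s := hX2 s g s1.
  exact: (mm _ _ _ _ (mm _ _ _ _ (mm _ _ _ _ (mm _ _ _ _ (hA2 s g s1) (hX2 t g t1)) hX2s) Bk) hX2s).
have diff (s t : C) : normc s <= 1 -> normc t <= 1 ->
    normc (h t - h s) <= 2 * L ^+ 3 * normc (t - s) ^+ 3.
  move=> s1 t1; have [X2 sV] := smoothV (sA s s1).
  have e := wzM G_compact chi_dual mu_haar phiD S0 SD (sA t t1) sV.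
  rewrite (wzV (sA s s1)) in e; rewrite -[h t - h s]e.
  have [AB2 sAB] := smoothM chi_dual phiD SD (sA t t1) sV.
  have [_ cAB cY] := smooth_mcont chi_dual sAB.
  refine (normc_Cint G_compact mu (cont_wz_integrand cAB cY) _) => g.
  (* The logarithmic derivative of [A_t A_s^-1] gains a factor [t - s], because [t - s A_t A_s^-1 =
     (t A_s - s A_t) A_s^-1 = (t - s) A_s^-1]. *)
  have E i : A s g *m Xt t g *m (t *: A1 i g *m Xt s g + A t g *m - (Xt s g *m (s *: A1 i g) *m Xt s g))
    = (t - s) *: (A s g *m Xt t g *m Xt s g *m A1 i g *m Xt s g).
    have -> : t *: A1 i g *m Xt s g + A t g *m - (Xt s g *m (s *: A1 i g) *m Xt s g) =
       (t%:M - s *: (A t g *m Xt s g)) *m (A1 i g *m Xt s g).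
      rewrite mulmxBl mul_scalar_mx mulmxN -scalemxAr -!scalemxAl -scalemxAr.
      by rewrite !mulmxA.
    have -> : t%:M - s *: (A t g *m Xt s g) = (t - s) *: Xt s g.
      have -> : t%:M = t *: (A s g *m Xt s g) by rewrite AX // scalemx1.
      have E1 : t *: A s g - s *: A t g = (t - s) *: 1%:M.
        rewrite /A !scalerDr !scalerA (mulrC s t) opprD addrACA subrr addr0.
        by rewrite -scalerBl.
      by rewrite !scalemxAl -mulmxBl E1 -scalemxAl mul1mx.
    by rewrite -scalemxAl -scalemxAr !mulmxA.
  rewrite (f_equal3 (@cubic _ _) (E i0) (E i1) (E i2) : cubic _ _ _ = _).
  rewrite cubicZ normcM mulrC.
  have -> : normc ((t - s) ^+ 3) = normc (t - s) ^+ 3 by rewrite !exprS expr0 !mulr1 !normcM.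
  apply: ler_wpM2r; first by rewrite exprn_ge0 // normc_ge0.
  have kA g' : [/\ mxN (A1 i0 g') <= k, mxN (A1 i1 g') <= k & mxN (A1 i2 g') <= k].
    by have [_ ?] := hK0 g'; have [_ ?] := hK1 g'; have [_ ?] := hK2 g'; split; rewrite /k; lra.
  by have [? ? ?] := kA g; apply: cubic_le; apply: hL.
have h0 : h 0 = 0.
  refine (etrans _ (Cint_cst mu 0)); apply: Cint_ext => g.
  by rewrite !scale0r !mulmx0 /cubic mul0mx raddf0.
have h1 : h 1 = wz A1 X.
  apply: wz_ext => i g; rewrite scale1r; congr (_ *m _).
  have FE : A 1 g = F g by rewrite /A scale1r addrC subrK.
  by rewrite -[LHS]mulmx1 -(FX g) mulmxA -FE mulVmx ?mul1mx //;
    apply: near1_unitmx; apply: le_lt_trans (A1E 1 g _) _; rewrite ?normc1 //; lra.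
rewrite -h1; pose D := 2 * L ^+ 3.
have L0 : 0 <= L.
  have nn : 0 <= n%:R :> R := ler0n _ _.
  by rewrite /L; do ![exact: nn | exact: k0 | exact: ler01 | exact: ler0n
    | apply: addr_ge0 | apply: mulr_ge0].
have D0 : 0 <= D := mulr_ge0 (ler0n _ 2) (exprn_ge0 3 L0).
(* The interval [0, 1] is cut into [m + 1] steps of length [r]; each changes [h] by at most [D r^3],
   together at most [D r^2]. *)
have bound m : normc (h 1) <= D * (m.+1%:R)^-1 ^+ 2.
  pose r : R := (m.+1%:R)^-1.
  have r0 : 0 <= r by rewrite invr_ge0.
  have rm : m.+1%:R * r = 1 by rewrite divff.
  have step j : (j <= m.+1)%N -> normc (h (j%:R * r)%:C) <= j%:R * (D * r ^+ 3).
    elim: j => [|j ih] jm; first by rewrite !mul0r h0 normc0.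
    have jr (i : nat) : (i <= m.+1)%N -> normc (i%:R * r)%:C <= 1.
      move=> im; rewrite normcR (ger0_norm (mulr_ge0 (ler0n _ _) r0)) -[leRHS]rm.
      by apply: (ler_wpM2r r0); rewrite ler_nat.
    have := diff _ _ (jr j (ltnW jm)) (jr _ jm).
    have -> : (j.+1%:R * r)%:C - (j%:R * r)%:C = r%:C.
      by rewrite -rmorphB -mulrBl -natr1 addrAC subrr add0r mul1r.
    rewrite normcR (ger0_norm r0) -/D => d.
    have := le_normcD (h (j.+1%:R * r)%:C - h (j%:R * r)%:C) (h (j%:R * r)%:C).
    rewrite subrK => tri; apply: le_trans tri _.
    by rewrite -[in leRHS]natr1 mulrDl mul1r [leRHS]addrC; exact: (lerD d (ih (ltnW jm))).
  have := step m.+1 (leqnn _); rewrite rm.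
  have -> : m.+1%:R * (D * r ^+ 3) = D * r ^+ 2 * (m.+1%:R * r) by ring.
  by rewrite rm mulr1.
apply: (@small_eq0 R _ D) => e e0.
have [m hm] := exists_invS2_le e0.
exact: (le_trans (bound m) (ler_wpM2l D0 hm)).
Qed.

End freq.
End degree_properties.

(** * The winding class of invertible matrix functions *)

Section winding.
Context {R : realType} {G : topologicalZmodType} {Gamma : zmodType}.
Context (chi : Gamma -> G -> R[i]) (mu : probability (borel G) R).
Hypothesis G_compact : compact [set: G].
Hypothesis chi_dual : is_character_group chi.
Hypothesis mu_haar : is_haar mu.
Local Notation C := R[i].
Variable n : nat.
Local Notation M := 'M[C]_n.
Local Notation mderiv := (@mderiv R G Gamma chi n).
Local Notation mev := (@mev R G Gamma chi n).
Local Notation mevD := (@mevD R G Gamma chi n).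
Variable phi : 'I_3 -> Gamma -> C.
Hypothesis phiD : forall i x y, phi i (x + y) = phi i x + phi i y.
Local Notation smooth := (@smooth R G Gamma chi n phi).
Local Notation wz := (@wz R G mu n).
Local Notation deg := (@deg R G Gamma chi mu n phi).

Lemma mderiv_sub (S S' : set Gamma) p A A' : S `<=` S' -> mderiv S p A A' -> mderiv S' p A A'.
Proof. by move=> SS' hA e e0; have [s Ss hs] := hA e e0; exists s => // x /Ss /SS'. Qed.

Lemma deg_setT S F c : deg S F c -> deg setT F c.
Proof.
move=> [A1 [A2 [X [[FX hA hX hA1 sym] ->]]]]; exists A1, A2, X; split=> //.
have sT : S `<=` [set: Gamma] by [].
split=> [//|i|i|i j|//].
- exact: (mderiv_sub sT (hA i)).
- exact: (mderiv_sub sT (hX i)).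
- exact: (mderiv_sub sT (hA1 i j)).
Qed.

Lemma degM F F' c c' : deg setT F c -> deg setT F' c' ->
  deg setT (fun g => F g *m F' g) (c + c').
Proof.
move=> [A1 [A2 [X [sA ->]]]] [B1 [B2 [Y [sB ->]]]].
have [AB2 sAB] := smoothM chi_dual phiD (S := setT) (fun _ _ _ _ => I) sA sB.
exists (fun i g => A1 i g *m F' g + F g *m B1 i g), AB2, (fun g => Y g *m X g).
split; first exact: sAB.
exact: (esym (wzM G_compact chi_dual mu_haar phiD (S := setT) I (fun _ _ _ _ => I) sA sB)).
Qed.

Lemma degV F X c : deg setT F c -> (forall g, F g *m X g = 1%:M) -> deg setT X (- c).
Proof.
move=> [A1 [A2 [Y [sA ->]]]] FX.
have XY : X = Y.
  have [FY _ _ _ _] := sA; apply/funext => g.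
  by rewrite -[LHS]mulmx1 -(FY g) mulmxA (mulmx1C (FX g)) mul1mx.
have [X2 sV] := smoothV chi_dual phiD (S := setT) I (fun _ _ _ _ => I) sA.
rewrite XY; exists (fun i g => - (Y g *m A1 i g *m Y g)), X2, F; split; first exact: sV.
exact: (esym (wzV mu G_compact chi_dual sA)).
Qed.

Lemma deg_inv F c : deg setT F c -> exists X, forall g, F g *m X g = 1%:M.
Proof. by move=> [A1 [A2 [X [[FX _ _ _ _] _]]]]; exists X. Qed.

Lemma deg_near1 F c : deg setT F c -> (forall g, mxN (1%:M - F g) <= 1 / 4) -> c = 0.
Proof.
move=> [A1 [A2 [X [sF ->]]]] near1.
exact: (wz_near1 G_compact chi_dual mu_haar phiD I (fun _ _ _ _ => I) sF near1).
Qed.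

Lemma deg_pos (S : set Gamma) F c : S 0 -> (forall x y, S x -> S y -> S (x + y)) ->
  (forall x y, S x -> S y -> x + y = 0 -> y = 0) -> deg S F c -> c = 0.
Proof.
move=> S0 SD pos [A1 [A2 [X [sF ->]]]].
exact: (wz_pos G_compact chi_dual mu_haar phiD S0 SD pos sF).
Qed.

(** The polynomial [mev t] starts Newton's iteration for the inverse [X]; as its frequencies are in
    [S], so are those of all later approximants. *)
Lemma smooth_mev S s t X : S 0 -> (forall x y, S x -> S y -> S (x + y)) ->
  freq_in S s -> freq_in S t -> (forall g, mxN (1%:M - mev s g *m mev t g) <= 1 / 4) ->
  (forall g, mev s g *m X g = 1%:M) ->
  smooth S (mev s) (fun i => mevD (phi i) s) (fun i j => mevD (phi i) (derp (phi j) s)) X.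
Proof.
move=> S0 SD Ss St st sX; split=> [//|i|i|i j|i j g].
- exact: (mderiv_mev chi (phi i) Ss).
- exact: (mderiv_inv chi_dual S0 SD (@phiD i) (mderiv_mev _ (phi i) Ss) (mderiv_mev _ (phi i) St) st sX).
- have -> : mevD (phi j) s = mev (derp (phi j) s).
    by apply/funext => g; rewrite mev_derp.
  exact: (mderiv_mev chi (phi i) (freq_in_derp (phi := phi j) Ss)).
- rewrite !mevD_derp; apply: eq_bigr => x _.
  by rewrite [phi i _ * _]mulrC.
Qed.

Definition mbdd (F : G -> M) := exists2 K, 0 <= K & forall g, mxN (F g) <= K.

Definition mapprox (S : set Gamma) (F : G -> M) : Prop :=
  forall e : R, 0 < e -> exists2 s, freq_in S s & forall g, mxN (F g - mev s g) <= e.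

Lemma mxN_close (a b : M) e K : mxN (a - b) <= e -> mxN a <= K -> mxN b <= K + e.
Proof.
by move=> h1 h2; have := mxNB a (a - b); rewrite opprB addrCA subrr addr0; lra.
Qed.

Lemma mapprox_bdd S F : mapprox S F -> mbdd F.
Proof.
move=> /(_ 1 ltr01)[s _ hs]; have [K hK] := mev_bounded chi_dual s.
have K0 : 0 <= K := le_trans (mxN_ge0 _) (hK 0).
exists (K + 1); first by lra.
by move=> g; apply: (@mxN_close (mev s g)) => //; rewrite mxN_distC.
Qed.

Lemma deg_of_approx S F X : S 0 -> (forall x y, S x -> S y -> S (x + y)) ->
  mapprox S F -> mapprox S X -> (forall g, F g *m X g = 1%:M) ->
  forall e : R, 0 < e -> exists P c, deg S P c /\ forall g, mxN (F g - P g) <= e.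
Proof.
move=> S0 SD aF aX FX e e0.
have [K K0 hK] := mapprox_bdd aX.
(* [1 - P T = (F - P) X + P (X - T)] for the approximants [P] of [F] and [T] of [X]. The two
   constants with 8 make each term at most 1/8, which gives the 1/4 required by [mderiv_inv]. *)
pose d := Num.min e (1 / (8 * (K + 1))).
have d0 : 0 < d by rewrite lt_min e0 divr_gt0 //; lra.
have [s Ss hs] := aF _ d0.
have [L hL] := mev_bounded chi_dual s.
have L0 : 0 <= L := le_trans (mxN_ge0 _) (hL 0).
have f0 : 0 < 1 / (8 * (L + 1)) by rewrite divr_gt0 //; lra.
have [t St ht] := aX _ f0.
have st g : mxN (1%:M - mev s g *m mev t g) <= 1 / 4.
  have -> : 1%:M - mev s g *m mev t g = (F g - mev s g) *m X g + mev s g *m (X g - mev t g).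
    by rewrite mulmxBl mulmxBr FX addrA subrK.
  apply: le_trans (mxND _ _) _.
  have h1 := mxNM (F g - mev s g) (X g); have h2 := mxNM (mev s g) (X g - mev t g).
  have d1 : d <= 1 / (8 * (K + 1)) by rewrite ge_min lexx orbT.
  have h3 : mxN (F g - mev s g) * mxN (X g) <= (1 / (8 * (K + 1))) * (K + 1).
    by apply: (ler_pM (mxN_ge0 _) (mxN_ge0 _) (le_trans (hs g) d1)); have := hK g; lra.
  have h4 : mxN (mev s g) * mxN (X g - mev t g) <= (L + 1) * (1 / (8 * (L + 1))).
    by apply: (ler_pM (mxN_ge0 _) (mxN_ge0 _) _ (ht g)); have := hL g; lra.
  have e1 : (1 / (8 * (K + 1))) * (K + 1) = 1 / 8 by field; lra.
  have e2 : (L + 1) * (1 / (8 * (L + 1))) = 1 / 8 by field; lra.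
  by rewrite e1 in h3; rewrite e2 in h4; lra.
have sX g : mev s g *m invmx (mev s g) = 1%:M.
  apply: mulmxV; have : mev s g *m mev t g \in unitmx.
    by apply: near1_unitmx; apply: le_lt_trans (st g) _; lra.
  by rewrite unitmx_mul => /andP[].
have sm := smooth_mev S0 SD Ss St st sX.
exists (mev s), (wz (fun i => mevD (phi i) s) (fun g => invmx (mev s g))); split.
  by exists (fun i => mevD (phi i) s), (fun i j => mevD (phi i) (derp (phi j) s)), (fun g => invmx (mev s g)).
by move=> g; apply: le_trans (hs g) _; rewrite ge_min lexx.
Qed.

(** Extends the degree to functions without derivatives. Existence for an invertible [F] and
    uniqueness both come from the fact that the degree of approximants close to [F] is constant. *)
Definition wind (F : G -> M) (c : C) : Prop :=
  forall e : R, 0 < e -> exists2 P, deg setT P c & forall g, mxN (F g - P g) <= e.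

Lemma deg_wind F c : deg setT F c -> wind F c.
Proof. by move=> dF e /ltW e0; exists F => // g; rewrite subrr mxN0. Qed.

Lemma wind_pos S F X : S 0 -> (forall x y, S x -> S y -> S (x + y)) ->
  (forall x y, S x -> S y -> x + y = 0 -> y = 0) ->
  mapprox S F -> mapprox S X -> (forall g, F g *m X g = 1%:M) -> wind F 0.
Proof.
move=> S0 SD pos aF aX FX e e0.
have [P [c [dP FP]]] := deg_of_approx S0 SD aF aX FX e0.
by rewrite -(deg_pos S0 SD pos dP); exists P => //; apply: deg_setT dP.
Qed.

Lemma inv_close (a b x y : M) K : a *m x = 1%:M -> b *m y = 1%:M ->
  mxN x <= K -> mxN (a - b) * K <= 1 / 4 -> mxN y <= 2 * K.
Proof.
move=> ax byy xK abK; have yb : y *m b = 1%:M by apply: mulmx1C.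
have yE : y = x + y *m ((a - b) *m x).
  by rewrite mulmxBl ax mulmxBr mulmx1 mulmxA yb mul1mx addrC subrK.
have := mxND x (y *m ((a - b) *m x)); rewrite -yE.
have := mxNM y ((a - b) *m x); have := mxNM (a - b) x.
have := mxN_ge0 y; have := mxN_ge0 (a - b); have := mxN_ge0 x => x0 ab0 y0 h1 h2 h3.
have h4 : mxN (a - b) * mxN x <= 1 / 4.
  by apply: le_trans abK; apply: ler_wpM2l.
have h5 : mxN y * mxN ((a - b) *m x) <= mxN y * (1 / 4).
  by apply: ler_wpM2l => //; apply: le_trans h1 h4.
lra.
Qed.

(** Both approximants are so close to [F] that [P' P^-1] is within 1/4 of 1 and has degree 0. The
    16: [P^-1] is bounded by [2 (K + 1)], and [F - P] and [F - P'] then contribute 1/8 each. *)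
Lemma deg_locally_constant F X : mbdd X -> (forall g, F g *m X g = 1%:M) ->
  exists2 d : R, 0 < d & forall P P' c c', deg setT P c -> deg setT P' c' ->
   (forall g, mxN (F g - P g) <= d) -> (forall g, mxN (F g - P' g) <= d) -> c = c'.
Proof.
move=> [K K0 hK] FX; exists (1 / (16 * (K + 1))); first by rewrite divr_gt0 //; lra.
move=> P P' c c' dP dP' FP FP'.
have [Y PY] := deg_inv dP.
have e1 : 1 / (16 * (K + 1)) * (K + 1) = 1 / 16 by field; lra.
have d0 : 0 <= 1 / (16 * (K + 1)) by rewrite divr_ge0 //; lra.
set d := 1 / (16 * (K + 1)) in FP FP' e1 d0.
have hY g : mxN (Y g) <= 2 * (K + 1).
  apply: (inv_close (FX g) (PY g)); first by have := hK g; lra.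
  have : mxN (F g - P g) * (K + 1) <= d * (K + 1) by apply: ler_wpM2r => //; lra.
  by rewrite e1; lra.
have H := deg_near1 (degM dP' (degV dP PY)).
suff /H /eqP : forall g, mxN (1%:M - P' g *m Y g) <= 1 / 4 by rewrite subr_eq0 => /eqP.
move=> g; have -> : 1%:M - P' g *m Y g = (F g - P' g) *m Y g - (F g - P g) *m Y g.
    rewrite -mulmxBl; have -> : F g - P' g - (F g - P g) = P g - P' g.
      by rewrite opprB addrC addrA subrK.
    by rewrite mulmxBl PY.
apply: le_trans (mxNB _ _) _.
have := mxNM (F g - P' g) (Y g); have := mxNM (F g - P g) (Y g).
have : mxN (F g - P' g) * mxN (Y g) <= d * (2 * (K + 1)).
  by apply: (ler_pM (mxN_ge0 _) (mxN_ge0 _) (FP' g)); exact: hY.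
have : mxN (F g - P g) * mxN (Y g) <= d * (2 * (K + 1)).
  by apply: (ler_pM (mxN_ge0 _) (mxN_ge0 _) (FP g)); exact: hY.
have -> : d * (2 * (K + 1)) = 1 / 8 by rewrite mulrCA e1; lra.
lra.
Qed.

Lemma wind_exists F X : mapprox setT F -> mapprox setT X ->
  (forall g, F g *m X g = 1%:M) -> exists c, wind F c.
Proof.
move=> aF aX FX.
have [d d0 hd] := deg_locally_constant (mapprox_bdd aX) FX.
have ap := deg_of_approx (S := setT) I (fun _ _ _ _ => I) aF aX FX.
have [P [c [dP FP]]] := ap _ d0; exists c => e e0.
have m0 : 0 < Num.min d e by rewrite lt_min d0.
have [P' [c' [dP' FP']]] := ap _ m0.
have -> : c = c'.
  by apply: (hd _ _ _ _ dP dP' FP) => g; apply: le_trans (FP' g) _; rewrite ge_min lexx.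
by exists P' => // g; apply: le_trans (FP' g) _; rewrite ge_min lexx orbT.
Qed.

Lemma wind_locally_constant F X : mbdd X -> (forall g, F g *m X g = 1%:M) ->
  exists2 d : R, 0 < d & forall F' c c', wind F c -> wind F' c' ->
    (forall g, mxN (F g - F' g) <= d) -> c = c'.
Proof.
move=> bX FX; have [d d0 hd] := deg_locally_constant bX FX.
exists (d / 2) => [|F' c c' wF wF' FF']; first by lra.
have [P dP FP] := wF _ d0.
have d2 : 0 < d / 2 by lra.
have [P' dP' FP'] := wF' _ d2.
apply: (hd _ _ _ _ dP dP' FP) => g.
have -> : F g - P' g = (F g - F' g) + (F' g - P' g) by rewrite addrA subrK.
by have := mxND (F g - F' g) (F' g - P' g); have := FF' g; have := FP' g; lra.
Qed.

Lemma wind_uniq F X c c' : mbdd X -> (forall g, F g *m X g = 1%:M) ->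
  wind F c -> wind F c' -> c = c'.
Proof.
move=> bX FX wF wF'; have [d d0 hd] := wind_locally_constant bX FX.
by apply: (hd F) => // g; rewrite subrr mxN0 ltW.
Qed.

Lemma windM F F' c c' : mbdd F -> mbdd F' -> wind F c -> wind F' c' ->
  wind (fun g => F g *m F' g) (c + c').
Proof.
move=> [K K0 hK] [L L0 hL] wF wF' e e0.
pose d := Num.min 1 (e / (K + L + 1)).
have k0 : 0 < K + L + 1 by lra.
have d0 : 0 < d by rewrite lt_min ltr01 divr_gt0.
have d1 : d <= 1 by rewrite ge_min lexx.
have de : d * (K + L + 1) <= e by rewrite -ler_pdivlMr // ge_min lexx orbT.
have [P dP FP] := wF _ d0; have [P' dP' FP'] := wF' _ d0.
exists (fun g => P g *m P' g); first exact: (degM dP dP').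
move=> g; have -> : F g *m F' g - P g *m P' g = (F g - P g) *m F' g + P g *m (F' g - P' g).
  by rewrite mulmxBl mulmxBr addrA subrK.
apply: le_trans (mxND _ _) _.
have := mxNM (F g - P g) (F' g); have := mxNM (P g) (F' g - P' g).
have : mxN (F g - P g) * mxN (F' g) <= d * L.
  by apply: (ler_pM (mxN_ge0 _) (mxN_ge0 _) (FP g)); exact: hL.
have : mxN (P g) * mxN (F' g - P' g) <= (K + 1) * d.
  apply: (ler_pM (mxN_ge0 _) (mxN_ge0 _) _ (FP' g)).
  by have := mxN_close (FP g) (hK g); lra.
have : (K + 1) * d + d * L = d * (K + L + 1) by ring.
lra.
Qed.

End winding.

(** * Folner sets and Fejer means *)

Lemma leq_exp2rW a b m : (a <= b)%N -> (a ^ m <= b ^ m)%N.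
Proof. by case: m => // m ab; rewrite leq_exp2r. Qed.

Section folner.
Variable Gamma : zmodType.

(** The elements of [js] may satisfy relations, so distinct sums are listed; their number is still
    at most [N ^ size js], which is polynomial in [N]. *)
Definition box (js : seq Gamma) (N : nat) : seq Gamma :=
  undup [seq \sum_(k < size js) js`_k *+ f k | f : {ffun 'I_(size js) -> 'I_N}].

Lemma boxP js N x : reflect (exists f : {ffun 'I_(size js) -> 'I_N},
  x = \sum_(k < size js) js`_k *+ f k) (x \in box js N).
Proof.
rewrite mem_undup; apply: (iffP mapP) => [[f _ ->]|[f ->]]; first by exists f.
by exists f => //; rewrite mem_enum.
Qed.

Lemma size_box js N : (size (box js N) <= N ^ size js)%N.
Proof.
apply: leq_trans (size_undup _) _.
by rewrite size_map -cardE card_ffun !card_ord.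
Qed.

Lemma sub_box js N : {subset box js N <= box js N.+1}.
Proof.
move=> _ /boxP[f ->]; apply/boxP; exists [ffun k => widen_ord (leqnSn N) (f k)].
by apply: eq_bigr => k _; rewrite ffunE.
Qed.

Lemma box_add js N x j : x \in box js N -> j \in js -> x + j \in box js N.+1.
Proof.
move=> /boxP[f ->] jjs; apply/boxP.
have lt : (index j js < size js)%N by rewrite index_mem.
pose k0 := Ordinal lt.
exists [ffun k => inord (f k + (k == k0))].
rewrite (bigD1 k0) //= [RHS](bigD1 k0) //= ffunE eqxx inordK; last first.
  by rewrite addn1 ltnS ltn_ord.
rewrite nth_index // addn1 mulrSr addrAC; congr (_ + _).
apply: eq_bigr => k kk0; rewrite ffunE (negPf kk0) addn0 inordK //.
by apply: leq_trans (ltn_ord _) _.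
Qed.

Lemma box_gt0 js N : (0 < size (box js N.+1))%N.
Proof.
have : 0 \in box js N.+1.
  by apply/boxP; exists [ffun=> ord0]; rewrite big1 // => k _; rewrite ffunE.
by case: (box js N.+1).
Qed.

Lemma leq_linear_exp2 L : (1 + (L + 4) * L <= 2 ^ (L + 4))%N.
Proof.
have : ((L + 4) * (L + 4) <= 2 ^ (L + 4))%N.
  elim: L => // L ih; rewrite addSn expnS; move: (2 ^ (L + 4))%N ih => x; nia.
move: (2 ^ (L + 4))%N => x; nia.
Qed.

(** If every ratio of consecutive sizes exceeded [1 + e], the sizes would grow exponentially,
    against [size_box]. *)
Lemma box_slow_growth (R : realType) js (e : R) : 0 < e -> exists N,
  (size (box js N.+2))%:R <= (1 + e) * (size (box js N.+1))%:R.
Proof.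
move=> e0; apply: contrapT => /forallNP H.
pose a N : R := (size (box js N.+1))%:R.
have step N : (1 + e) * a N <= a N.+1 by apply: ltW; rewrite ltNge; apply/negP; apply: H.
have iter k N : (1 + e) ^+ k * a N <= a (N + k)%N.
  elim: k => [|k ih]; first by rewrite expr0 mul1r addn0.
  rewrite addnS exprS -mulrA; apply: le_trans (step _).
  by apply: ler_wpM2l => //; lra.
pose m := size js.
(* By Bernoulli's inequality [L] steps multiply the size by at least [2 ^ (m + 1)], so [k L] steps
   give [2 ^ ((m + 1) k)]. The polynomial bound is [(1 + k L) ^ m <= 2 ^ (k m)]; the choice
   [k = L + 4] ensures [1 + k L <= 2 ^ k]. *)
pose L := Num.Def.archi_bound (2 ^+ m.+1 / e).
have hL : 2 ^+ m.+1 <= (1 + e) ^+ L.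
  have h1 : 2 ^+ m.+1 / e < L%:R by apply: archi_boundP; rewrite divr_ge0 ?exprn_ge0 // ltW.
  have h2 : 1 + L%:R * e <= (1 + e) ^+ L.
    elim: L {h1} => [|l ih]; first by rewrite mul0r addr0 expr0.
    rewrite exprS -natr1; have : 0 <= l%:R :> R by []; nra.
  by move: h1; rewrite ltr_pdivrMr //; lra.
pose k := (L + 4)%N.
have big : 2 ^+ (m.+1 * k) <= a (k * L)%N.
  have := iter (k * L)%N 0%N; rewrite add0n; apply: le_trans.
  have a0 : 1 <= a 0%N by rewrite ler1n box_gt0.
  rewrite exprM [(k * L)%N]mulnC exprM.
  have e1 : 0 <= (1 + e) ^+ L ^+ k by rewrite !exprn_ge0 //; lra.
  apply: (@le_trans _ _ ((1 + e) ^+ L ^+ k)); last by nra.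
  by apply: lerXn2r; rewrite ?nnegrE ?exprn_ge0 //; lra.
have small : a (k * L)%N <= 2 ^+ (k * m).
  rewrite -natrX ler_nat; apply: leq_trans (size_box _ _) _.
  rewrite expnM; apply: leq_exp2rW; rewrite -add1n; exact: leq_linear_exp2.
have := le_trans big small; rewrite -!natrX ler_nat leq_exp2l //.
by rewrite /k; nia.
Qed.

Lemma folner (R : realType) (js : seq Gamma) (e : R) : 0 < e ->
  exists F : seq Gamma, [/\ uniq F, (0 < size F)%N &
    forall j, j \in js ->
      (1 - e) * (size F)%:R <= (count (fun y => y + j \in F) F)%:R].
Proof.
move=> e0; have [N hN] := box_slow_growth js e0.
exists (box js N.+1); split; [exact: undup_uniq|exact: box_gt0|move=> j jjs].
set F := box js N.+1 in hN *.
have uF : uniq F := undup_uniq _.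
(* The translates that leave the box are distinct and lie in the next box outside [F], so slow
   growth allows at most [e * size F] of them. *)
pose bad := [seq y + j | y <- F & y + j \notin F].
have ubad : uniq (F ++ bad).
  have ub : uniq bad by rewrite (map_inj_uniq (@addIr _ j)) filter_uniq.
  rewrite cat_uniq uF ub andbT; apply/hasPn => _ /mapP[y + ->].
  by rewrite mem_filter => /andP[].
have sub : {subset F ++ bad <= box js N.+2}.
  move=> x; rewrite mem_cat => /orP[/sub_box//|/mapP[y + ->]].
  by rewrite mem_filter => /andP[_ yF]; apply: box_add.
have := uniq_leq_size ubad sub; rewrite size_cat size_map size_filter.
set b := count _ _ => h2.
have h1 : (count (fun y : Gamma => (y + j)%R \in F) F + b = size F)%N := count_predC _ _.
move: h2; rewrite -(ler_nat R) natrD -h1 natrD; rewrite -h1 natrD in hN; lra.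
Qed.

End folner.

Section fejer.
Context {R : realType} {G : topologicalZmodType} {Gamma : zmodType}.
Context (chi : Gamma -> G -> R[i]) (mu : probability (borel G) R).
Hypothesis G_compact : compact [set: G].
Hypothesis chi_dual : is_character_group chi.
Hypothesis mu_haar : is_haar mu.
Local Notation C := R[i].
Local Notation Cint := (Cintegral mu).

Definition fourier (f : G -> C) (j : Gamma) : C := Cint (fun g => f g * (chi j g)^*%C).

Definition pev (s : seq (C * Gamma)) (g : G) : C := \sum_(x <- s) x.1 * chi x.2 g.

Definition approx_in (S : set Gamma) (f : G -> C) : Prop :=
  forall e : R, 0 < e -> exists2 s, (forall x, x \in s -> S x.2) &
    forall g, normc (f g - pev s g) <= e.

(** The coefficient at [j] is multiplied by the proportion of [y] in [F] with [y + j] in [F]. For an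
    interval of integers this is the classical Fejer mean. *)
Definition fejer (F : seq Gamma) (f : G -> C) (g : G) : C :=
  (size F)%:R^-1 * \sum_(x <- F) \sum_(y <- F) fourier f (x - y) * chi (x - y) g.

Lemma cont_conj_chi j : cont (fun g => (chi j g)^*%C).
Proof. exact: (cont_conj (cont_chi chi_dual (j := j))). Qed.

Lemma cont_fourier f j : cont f -> cont (fun g => f g * (chi j g)^*%C).
Proof. by move=> cf; exact: (contM cf (@cont_conj_chi j)). Qed.

Lemma cont_pev s : cont (pev s).
Proof.
apply: cont_sum => x; have c1 := cont_cst (R := R) (G := G) (c := x.1).
exact: (contM c1 (cont_chi chi_dual (j := x.2))).
Qed.

Lemma fourierD f h j : cont f -> cont h ->
  fourier (fun g => f g + h g) j = fourier f j + fourier h j.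
Proof.
move=> cf ch; refine (etrans _ (CintD G_compact mu (cont_fourier (j := j) cf) (cont_fourier (j := j) ch))).
by apply: Cint_ext => g; rewrite mulrDl.
Qed.

Lemma fourierZ c f j : cont f -> fourier (fun g => c * f g) j = c * fourier f j.
Proof.
move=> cf; refine (etrans _ (CintZ G_compact mu c (cont_fourier (j := j) cf))).
by apply: Cint_ext => g; rewrite mulrA.
Qed.

Lemma fourier_chi i j : fourier (chi i) j = (i == j)%:R.
Proof.
rewrite -subr_eq0 -(Cint_chi G_compact chi_dual mu_haar) /fourier.
apply: Cint_ext => g /=. by rewrite -(chiN chi_dual) (chiD chi_dual).
Qed.

Lemma fejerD F f h g : cont f -> cont h ->
  fejer F (fun g => f g + h g) g = fejer F f g + fejer F h g.
Proof.
move=> cf ch; rewrite /fejer -mulrDr; congr (_ * _); rewrite -big_split; apply: eq_bigr => x _.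
by rewrite -big_split; apply: eq_bigr => y _ /=; rewrite fourierD // mulrDl.
Qed.

Lemma fejerZ F c f g : cont f -> fejer F (fun g => c * f g) g = c * fejer F f g.
Proof.
move=> cf; rewrite /fejer mulrCA; congr (_ * _); rewrite mulr_sumr; apply: eq_bigr => x _.
by rewrite mulr_sumr; apply: eq_bigr => y _ /=; rewrite fourierZ // mulrA.
Qed.

Lemma sum_indicator (F : seq Gamma) (z : Gamma) : uniq F ->
  \sum_(x <- F) ((x == z)%:R : C) = (z \in F)%:R.
Proof.
elim: F => [|x F ih] /=; first by rewrite big_nil.
move=> /andP[xF uF]; rewrite big_cons ih // inE [z == x]eq_sym.
by case: eqP => [<-|]; rewrite ?(negPf xF) ?addr0 ?add0r.
Qed.

Lemma fejer_chi F j g : uniq F ->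
  fejer F (chi j) g = (count (fun y => y + j \in F) F)%:R / (size F)%:R * chi j g.
Proof.
move=> uF; rewrite /fejer mulrC exchange_big /= mulrAC; congr (_ / _).
rewrite (eq_bigr (fun y => (y + j \in F)%:R * chi j g)) => [|y _].
  rewrite -mulr_suml; congr (_ * _); rewrite -sum1_count natr_sum [RHS]big_mkcond.
  by apply: eq_bigr => y _; case: (_ \in _).
rewrite -(sum_indicator (y + j) uF) mulr_suml; apply: eq_bigr => x _.
rewrite fourier_chi -[in RHS](inj_eq (addIr (- y))) [y + j]addrC addrK eq_sym.
by case: eqP => [->|]; rewrite ?mul0r.
Qed.

Lemma normc_Cint_weight f k M : cont f -> cont (fun g => (k g)%:C) ->
  (forall g, normc (f g) <= M) -> (forall g, 0 <= k g) ->
  normc (Cint (fun g => f g * (k g)%:C)) <= M * complex.Re (Cint (fun g => (k g)%:C)).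
Proof.
move=> cf ck fM k0.
set z := Cint (fun g => f g * (k g)%:C).
have cfk : cont (fun g => f g * (k g)%:C) := contM cf ck.
(* A rotation [w] carries the integral to the nonnegative reals, where real parts can be compared
   under the integral. *)
have [w w1 wz] : exists2 w, normc w = 1 & normc z = complex.Re (w * z).
  have [->|z0] := eqVneq z 0; first by exists 1; rewrite ?normc1 // normc0 mulr0.
  have n0 : normc z != 0 by apply: contra z0 => /eqP /eq0_normc ->.
  exists ((normc z)%:C / z); last by rewrite divfK.
  by rewrite normcM normcV normcR ger0_norm ?normc_ge0 // divff.
rewrite wz -(CintZ G_compact mu w cfk).
have -> : M * complex.Re (Cint (fun g => (k g)%:C)) =
    complex.Re (Cint (fun g => M%:C * (k g)%:C)).
  by rewrite (CintZ G_compact mu M%:C ck); case: (Cint _) => a b /=; rewrite mul0r subr0.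
apply: (le_Re_Cint G_compact mu (contM (@cont_cst _ _ w) cfk) (contM (@cont_cst _ _ M%:C) ck)) => g.
rewrite -rmorphM /= mulrA; apply: le_trans (ler_norm _) _; apply: le_trans (Re_le_normc _) _.
by rewrite !normcM w1 mul1r normcR (ger0_norm (k0 g)) ler_wpM2r.
Qed.

(* The Fejer mean is the convolution with the nonnegative kernel
   [|sum_(x in F) chi_x|^2 / |F|], whose integral is 1. *)
Lemma fejer_bound F f M g : uniq F -> (0 < size F)%N -> cont f ->
  (forall g, normc (f g) <= M) -> normc (fejer F f g) <= M.
Proof.
move=> uF F0 cf fM.
pose D h := \sum_(x <- F) chi x g * (chi x h)^*%C.
pose k h := (size F)%:R^-1 * normc (D h) ^+ 2.
have F0R : (size F)%:R != 0 :> C by rewrite pnatr_eq0 -lt0n.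
have kE h : (k h)%:C = (size F)%:R^-1 * \sum_(x <- F) \sum_(y <- F) chi (x - y) g * (chi (x - y) h)^*%C.
  have sq (z : C) : (normc z ^+ 2)%:C = z * z^*%C.
    case: z => a b /=; rewrite sqr_sqrtr ?addr_ge0 ?sqr_ge0 //.
    by simpc; apply/eqP; rewrite eq_complex /=; apply/andP; split; apply/eqP; ring.
  rewrite /k rmorphM fmorphV rmorph_nat /= sq; congr (_ * _).
  rewrite /D rmorph_sum mulr_suml; apply: eq_bigr => x _.
  rewrite mulr_sumr; apply: eq_bigr => y _.
  rewrite rmorphM /= conjcK -!(chiN chi_dual) opprB !(chiD chi_dual) (chiN chi_dual y); ring.
have cD2 : cont (fun h => (k h)%:C).
  have -> : (fun h => (k h)%:C) = (fun h => (size F)%:R^-1 *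
     \sum_(x <- F) \sum_(y <- F) chi (x - y) g * (chi (x - y) h)^*%C).
    by apply/funext => h; rewrite kE.
  apply: contM; first exact: cont_cst.
  apply: cont_sum => x; apply: cont_sum => y; apply: contM; first exact: cont_cst.
  exact: cont_conj_chi.
have fE f' : cont f' -> fejer F f' g = Cint (fun h => f' h * (k h)%:C).
  move=> cf'.
  have E h : f' h * (k h)%:C = (size F)%:R^-1 * \sum_(x <- F) \sum_(y <- F)
      (chi (x - y) g * (f' h * (chi (x - y) h)^*%C)).
    rewrite kE mulrCA; congr (_ * _); rewrite mulr_sumr; apply: eq_bigr => x _.
    by rewrite mulr_sumr; apply: eq_bigr => y _; rewrite mulrCA.
  have c1 x y : cont (fun h => chi (x - y) g * (f' h * (chi (x - y) h)^*%C)).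
    exact: (contM (@cont_cst _ _ _) (cont_fourier (j := x - y) cf')).
  have c2 x : cont (fun h => \sum_(y <- F) chi (x - y) g * (f' h * (chi (x - y) h)^*%C)).
    exact: (@cont_sum _ _ _ F xpredT _ (c1 x)).
  have c3 : cont (fun h => \sum_(x <- F) \sum_(y <- F) chi (x - y) g * (f' h * (chi (x - y) h)^*%C)).
    exact: (@cont_sum _ _ _ F xpredT _ c2).
  refine (etrans _ (etrans (esym (CintZ G_compact mu _ c3)) (esym (Cint_ext _ E)))).
  rewrite /fejer; congr (_ * _).
  refine (etrans _ (esym (Cint_sum G_compact mu _ _ c2))); apply: eq_bigr => x _.
  refine (etrans _ (esym (Cint_sum G_compact mu _ _ (c1 x)))); apply: eq_bigr => y _.
  refine (etrans _ (esym (CintZ G_compact mu _ (cont_fourier (j := x - y) cf')))).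
  exact: mulrC.
have k1 : Cint (fun h => (k h)%:C) = 1.
  have -> : (fun h => (k h)%:C) = (fun h => chi 0 h * (k h)%:C).
    by apply/funext => h; rewrite (chi0 chi_dual) mul1r.
  rewrite -(fE _ (cont_chi chi_dual (j := 0))) fejer_chi // (chi0 chi_dual) mulr1.
  have -> : count (fun y => y + 0 \in F) F = size F.
    by apply/eqP; rewrite -all_count; apply/allP => y; rewrite addr0.
  by rewrite divff.
rewrite (fE _ cf); apply: le_trans (normc_Cint_weight cf cD2 fM _) _.
  by move=> h; rewrite mulr_ge0 ?invr_ge0 // sqr_ge0.
by rewrite k1 mulr1.
Qed.

End fejer.

(** * Approximation by polynomials with frequencies in the spectrum *)

Section spectral_approximation.
Context {R : realType} {G : topologicalZmodType} {Gamma : zmodType}.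
Context (chi : Gamma -> G -> R[i]) (mu : probability (borel G) R).
Hypothesis G_compact : compact [set: G].
Hypothesis chi_dual : is_character_group chi.
Hypothesis mu_haar : is_haar mu.
Local Notation C := R[i].
Local Notation cpev := (pev chi).
Local Notation cfejer := (fejer chi mu).
Local Notation cfourier := (fourier chi mu).
Local Notation approx_in := (approx_in chi).

Lemma pev_cons x s g : cpev (x :: s) g = x.1 * chi x.2 g + cpev s g.
Proof. by rewrite /cpev big_cons. Qed.

Lemma fejer_pev F s g : uniq F -> cfejer F (cpev s) g =
  \sum_(x <- s) (count (fun y => y + x.2 \in F) F)%:R / (size F)%:R * (x.1 * chi x.2 g).
Proof.
move=> uF; elim: s => [|x s ih].
  rewrite big_nil /fejer.
  have z : cpev [::] = (fun=> 0 * chi 0 0) by apply/funext => h; rewrite mul0r /pev big_nil.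
  have c1 : cont (fun=> chi 0 0 : C) := @cont_cst R G (chi 0 0).
  by rewrite -/(cfejer F _ g) z (fejerZ mu G_compact chi_dual F 0 g c1) mul0r.
have E : cpev (x :: s) = (fun h => x.1 * chi x.2 h + cpev s h).
  by apply/funext => h; rewrite pev_cons.
have cx := cont_chi chi_dual (j := x.2).
have c1 : cont (fun h => x.1 * chi x.2 h) := contM (@cont_cst R G x.1) cx.
rewrite big_cons -ih E (fejerD mu G_compact chi_dual F g c1 (cont_pev chi_dual (s := s))).
rewrite (fejerZ mu G_compact chi_dual F x.1 g cx) (fejer_chi G_compact chi_dual mu_haar _ _ uF).
by congr (_ + _); rewrite mulrCA.
Qed.

(** A Fejer mean of [f] has only frequencies of [f]. It is close to [f]: with [f = cpev s + r], it
    does not increase the bound on the small [r], and it almost fixes [cpev s] if [F] is almost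
    invariant under the frequencies of [s]. *)
Lemma approx_spectrum f (S : set Gamma) : cont f -> approx_in setT f ->
  spectrum chi mu f `<=` S -> approx_in S f.
Proof.
move=> cf af fS e e0.
have e4 : 0 < e / 4 by lra.
have [s _ hs] := af _ e4.
pose K := \sum_(x <- s) normc x.1.
have K0 : 0 <= K by apply: sumr_ge0 => x _; exact: normc_ge0.
have e'0 : 0 < e / (4 * (K + 1)) by rewrite divr_gt0 //; lra.
have [F [uF F0 hF]] := folner [seq x.2 | x <- s] e'0.
set e' := e / (4 * (K + 1)) in e'0 hF.
have Ke' : K * e' <= e / 4.
  have -> : e / 4 = (K + 1) * e' by rewrite /e'; field; lra.
  by apply: ler_wpM2r; [exact: ltW|lra].
have F0R : 0 < (size F)%:R :> R by rewrite ltr0n.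
pose r h := f h - cpev s h.
have cr : cont r.
  have c1 : cont (fun h => - 1 * cpev s h) := contM (@cont_cst R G (-1)) (cont_pev chi_dual (s := s)).
  have -> : r = (fun h => f h + - 1 * cpev s h) by apply/funext => h; rewrite mulN1r.
  exact: (contD cf c1).
(* Terms with zero coefficient are dropped, so the remaining frequencies are in the spectrum by
   definition. *)
pose s' := [seq p <- [seq ((size F)%:R^-1 * cfourier f (x - y), x - y) | x <- F, y <- F]
  | cfourier f p.2 != 0].
exists s' => [p|g].
  by rewrite mem_filter => /andP[pn0 _]; apply: fS; exact: pn0.
have -> : cpev s' g = cfejer F f g.
  rewrite /pev /fejer big_filter big_mkcond big_allpairs_dep mulr_sumr; apply: eq_bigr => x _.
  rewrite mulr_sumr; apply: eq_bigr => y _ /=.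
  by case: eqP => [->|_] /=; rewrite ?mul0r ?mulr0 // mulrA.
have fE : f = (fun h => cpev s h + r h) by apply/funext => h; rewrite addrC subrK.
have -> : cfejer F f g = cfejer F (cpev s) g + cfejer F r g.
  by rewrite [in LHS]fE (fejerD mu G_compact chi_dual F g (cont_pev chi_dual (s := s)) cr).
have h1 : normc (cfejer F r g) <= e / 4 := fejer_bound G_compact chi_dual mu_haar g uF F0 cr hs.
have h2 : normc (cpev s g - cfejer F (cpev s) g) <= e / 4.
  apply: le_trans Ke'; rewrite fejer_pev // /pev -sumrB.
  apply: le_trans (normc_sum _ _ _) _; rewrite /K mulr_suml big_seq [leRHS]big_seq.
  apply: ler_sum => x xs.
  set c := count _ _.
  have -> : x.1 * chi x.2 g - c%:R / (size F)%:R * (x.1 * chi x.2 g) =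
     x.1 * ((1 - c%:R / (size F)%:R)%:C * chi x.2 g).
    by rewrite rmorphB rmorph1 rmorphM fmorphV !rmorph_nat /=; ring.
  rewrite !normcM (normc_chi chi_dual) mulr1; apply: ler_wpM2l; first exact: normc_ge0.
  have h := hF _ (map_f snd xs); rewrite -/c in h.
  have cF : c%:R <= (size F)%:R :> R by rewrite ler_nat count_size.
  rewrite normcR ger0_norm; last by rewrite subr_ge0 ler_pdivrMr // mul1r.
  by rewrite lerBlDr addrC -lerBlDr ler_pdivlMr.
have -> : f g - (cfejer F (cpev s) g + cfejer F r g) =
    (f g - cpev s g) + ((cpev s g - cfejer F (cpev s) g) - cfejer F r g) by ring.
apply: le_trans (le_normcD _ _) _.
have := le_normcD (cpev s g - cfejer F (cpev s) g) (- cfejer F r g); rewrite normcN.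
by have := hs g; lra.
Qed.

Lemma mapprox_entries n (S : set Gamma) (F : G -> 'M[C]_n) :
  (forall i j, approx_in S (fun g => F g i j)) -> mapprox chi S F.
Proof.
move=> aF e e0.
(* Each of the [n * n] entries gets the error [d]; the 1 keeps the denominator positive when
   [n = 0]. *)
have d0 : 0 < e / (n * n + 1)%:R by rewrite divr_gt0 // ltr0n addn1.
set d := e / _ in d0.
have /choice[s hs] : forall ij : 'I_n * 'I_n, exists s : seq (C * Gamma),
    (forall x, x \in s -> S x.2) /\ forall g, normc (F g ij.1 ij.2 - cpev s g) <= d.
  by move=> ij; have [s s1 s2] := aF ij.1 ij.2 d d0; exists s.
pose t := flatten [seq [seq (x.1 *: delta_mx ij.1 ij.2, x.2) | x <- s ij] | ij <- enum {: 'I_n * 'I_n}]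
  : seq ('M[C]_n * Gamma).
exists t => [x /flattenP[_ /mapP[ij _ ->] /mapP[y ys ->]]|g] /=.
  by have [h _] := hs ij; apply: h.
have -> : mev chi t g = \matrix_(i, j) cpev (s (i, j)) g.
  rewrite /mev /t big_flatten big_map big_enum /=.
  rewrite [RHS]matrix_sum_delta pair_big /=; apply: eq_bigr => -[i j] _ /=.
  rewrite mxE big_map /pev scaler_suml; apply: eq_bigr => x _ /=.
  by rewrite scalerA mulrC.
rewrite /mxN.
apply: (@le_trans _ _ (\sum_(i < n) \sum_(j < n) d)).
  by apply: ler_sum => i _; apply: ler_sum => j _; rewrite !mxE; have [_ h] := hs (i, j); exact: h.
rewrite !sumr_const !card_ord -mulrnA -mulr_natl.
have -> : e = (n * n + 1)%:R * d by rewrite mulrC divfK // pnatr_eq0 addn1.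
by apply: ler_wpM2r; [exact: ltW|rewrite ler_nat addn1].
Qed.

End spectral_approximation.

(** * Extension of coordinates to Gamma *)

Section extension.
Variables (K : numFieldType) (A Gamma : zmodType).
Variables (f : {additive A -> Gamma}) (h : {additive A -> K}).
Hypothesis f_inj : injective f.

(** The graph of a morphism on a subgroup of Gamma, that is, a subgroup of the product which is
    single-valued over 0. As graphs, morphisms are ordered by inclusion. *)
Definition partial_morphism (S : set (Gamma * K)) : Prop :=
  [/\ S (0, 0), forall x v y w, S (x, v) -> S (y, w) -> S (x - y, v - w)
    & forall v, S (0, v) -> v = 0].

Lemma partial_morphismN S x v : partial_morphism S -> S (x, v) -> S (- x, - v).
Proof. by move=> [S0 SB _] Sp; have := SB _ _ _ _ S0 Sp; rewrite !sub0r. Qed.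

Lemma partial_morphismD S x v y w :
  partial_morphism S -> S (x, v) -> S (y, w) -> S (x + y, v + w).
Proof.
move=> PS Sp Sq; have [_ SB _] := PS.
by have := SB _ _ _ _ Sp (partial_morphismN PS Sq); rewrite !opprK.
Qed.

Lemma partial_morphismMz S x v (k : int) :
  partial_morphism S -> S (x, v) -> S (x *~ k, v *~ k).
Proof.
move=> PS Sp; have [S0 SB _] := PS.
have nat_case (m : nat) : S (x *+ m, v *+ m).
  elim: m => [|m ih]; first by rewrite !mulr0n.
  by rewrite !mulrS; apply: partial_morphismD.
case: k => m; first exact: nat_case.
by rewrite !NegzE !mulrNz; apply: partial_morphismN => //; exact: nat_case.
Qed.

Let base : set (Gamma * K) := [set p | exists a, p = (f a, h a)].

Lemma partial_morphism_base : partial_morphism base.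
Proof.
split; first by exists 0; rewrite !raddf0.
  by move=> x v y w [a [-> ->]] [b [-> ->]]; exists (a - b); rewrite !raddfB.
move=> v [a [fa ->]]; have -> : a = 0 by apply: f_inj; rewrite raddf0.
exact: raddf0.
Qed.

Lemma partial_morphism_extend S x : partial_morphism S -> exists w,
  partial_morphism [set p | exists y u (k : int), S (y, u) /\ p = (y + x *~ k, u + w *~ k)].
Proof.
move=> PS; have [S0 SB S1] := PS.
(* If a positive multiple [x *+ n.+1] is already in the domain, with value [v0], the value at [x]
   has to be [v0 / n.+1], and [K] has characteristic 0. Otherwise any value will do, and 0 is
   taken. *)
have [w hw] : exists w : K, forall v (k : int), S (x *~ k, v) -> v = w *~ k.
  have [[n [v0 Sv0]]|nex] := pselect (exists n v, S (x *+ n.+1, v)); last first.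
    exists 0 => v k Sk; rewrite mul0rz.
    case: k Sk => [[|n]|n] Sk.
    - by apply: S1.
    - by case: nex; exists n, v.
    - case: nex; exists n, (- v); have := partial_morphismN PS Sk.
      by rewrite NegzE mulrNz opprK.
  exists (v0 / n.+1%:R) => v k Sk.
  have n0 : n.+1%:R != 0 :> K by rewrite pnatr_eq0.
  have := SB _ _ _ _ (partial_morphismMz n.+1 PS Sk) (partial_morphismMz k PS Sv0).
  have -> : x *~ k *~ n.+1 = x *+ n.+1 *~ k by rewrite -mulrzA mulrC mulrzA.
  rewrite subrr => /S1 /eqP; rewrite subr_eq0 => /eqP E.
  apply: (mulIf n0); rewrite mulr_natr -[LHS]/(v *~ n.+1) E.
  by rewrite mulrzAl divfK.
exists w; split.
- by exists 0, 0, 0; split=> //; rewrite !mulr0z !addr0.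
- move=> y u y' u' [z [t [k [Szt [-> ->]]]]] [z' [t' [k' [Szt' [-> ->]]]]].
  exists (z - z'), (t - t'), (k - k'); split; first exact: SB.
  by congr (_, _); rewrite mulrzBr opprD addrACA.
- move=> v [y [u [k [Syu [E ->]]]]].
  have yE : y = x *~ - k by rewrite mulrNz; apply/eqP; rewrite -addr_eq0 -E.
  by rewrite (hw u (- k)) -?yE // mulrNz addNr.
Qed.

Lemma additive_extension : exists phi : Gamma -> K,
  (forall x y, phi (x + y) = phi x + phi y) /\ (forall a, phi (f a) = h a).
Proof.
(* The base graph is adjoined to [X] instead of being required inside it, so that the empty union,
   which arises from the empty chain, satisfies [P] too. *)
pose P (X : set (Gamma * K)) := partial_morphism (X `|` base).
have [X [PX maxX]] : exists X, P X /\ forall Y, X `<` Y -> ~ P Y.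
  apply: Zorn_bigcup => F FP Ftot; have [b0 bB b1] := partial_morphism_base.
  have pick2 p q : (\bigcup_(X in F) X `|` base) p -> (\bigcup_(X in F) X `|` base) q ->
      (exists X, [/\ F X, (X `|` base) p & (X `|` base) q]) \/ (base p /\ base q).
    move=> [[X FX Xp]|bp] [[Y FY Yq]|bq]; last by right.
    - by left; case: (Ftot X Y FX FY) => XY; [exists Y|exists X]; split=> //; left => //; apply: XY.
    - by left; exists X; split=> //; [left|right].
    - by left; exists Y; split=> //; [right|left].
  split; first by right.
    move=> x v y w p q; case: (pick2 _ _ p q) => [[X [FX Xp Xq]]|[bp bq]]; last by right; apply: bB.
    have [_ XB _] := FP X FX; have [Xr|br] := XB _ _ _ _ Xp Xq; last by right.
    by left; exists X.
  move=> v [[X FX Xv]|]; last exact: b1.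
  by have [_ _ X1] := FP X FX; apply: X1; left.
set S := X `|` base in PX *; have PS : partial_morphism S := PX.
have tot x : exists v, S (x, v).
  apply: contrapT => nx.
  have [w PS'] := partial_morphism_extend x PS.
  set S' := [set p | _] in PS'.
  have SS' : S `<=` S'.
    by move=> [y u] Sy; exists y, u, 0; split=> //; rewrite !mulr0z !addr0.
  apply: (maxX S').
    split; first by move=> p Xp; apply: SS'; left.
    move=> S'X; apply: nx; exists w; left; apply: S'X.
    by exists 0, 0, 1; split; [case: PS|rewrite !mulr1z !add0r].
  have -> : P S' = partial_morphism S'; last by [].
  rewrite /P; congr partial_morphism; apply/seteqP; split=> [p [//|bp]|p S'p]; last by left.
  by apply: SS'; right.
have [phi hphi] := choice tot.
have uniq x v : S (x, v) -> phi x = v.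
  move=> Sv; have [_ SB S1] := PS; have := SB _ _ _ _ (hphi x) Sv.
  by rewrite subrr => /S1 /eqP; rewrite subr_eq0 => /eqP.
exists phi; split=> [x y|a]; apply: uniq; first exact: partial_morphismD.
by right; exists a.
Qed.

End extension.

Lemma coordinate_extension (K : numFieldType) (Gamma : zmodType)
    (f : {additive 'rV[int]_3 -> Gamma}) : injective f ->
  exists phi : 'I_3 -> Gamma -> K,
    (forall i x y, phi i (x + y) = phi i x + phi i y) /\
    (forall i j, phi i (f (delta_mx 0 j)) = (i == j)%:R).
Proof.
move=> f_inj.
have ex (i : 'I_3) : exists phi : Gamma -> K, (forall x y, phi (x + y) = phi x + phi y) /\
   (forall a, phi (f a) = (a 0 i)%:~R).
  pose hi (a : 'rV[int]_3) : K := (a 0 i)%:~R.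
  have hadd : zmod_morphism hi by move=> a b; rewrite /hi !mxE rmorphB.
  pose hM := GRing.isZmodMorphism.Build _ _ hi hadd.
  pose ha : {additive 'rV[int]_3 -> K} := HB.pack hi hM.
  exact: (additive_extension ha f_inj).
have [phi hphi] := choice ex; exists phi; split=> [i|i j]; first by have [] := hphi i.
by have [_ ->] := hphi i; rewrite mxE eqxx rmorph_nat.
Qed.

(** * A matrix function of nonzero degree *)

Section quaternions.
Variable R : realType.
Local Notation C := R[i].
Local Notation I := ('i%C : C).

(** The quaternion with coordinates [a, b, c, d], here complex: its product and trace are polynomial
    in them, so identities reduce to [ring]. *)
Definition quat (a b c d : C) : 'M[C]_2 := \matrix_(i, j)
  if i == 0 then if j == 0 then a + I * b else c + I * d
  else if j == 0 then I * d - c else a - I * b.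

Lemma iiN1 : I * I = -1.
Proof. by rewrite -expr2 sqr_i. Qed.

Lemma quatM a b c d a' b' c' d' : quat a b c d *m quat a' b' c' d' =
  quat (a * a' - b * b' - c * c' - d * d') (a * b' + b * a' + c * d' - d * c')
       (a * c' - b * d' + c * a' + d * b') (a * d' + b * c' - c * b' + d * a').
Proof.
have E (x y : C) : I * x * (I * y) = - (x * y) by rewrite mulrACA iiN1 mulN1r.
apply/matrixP => i j; rewrite !mxE !big_ord_recl big_ord0 !mxE /=.
by case: i => [[|[|[]]]] //= ?; case: j => [[|[|[]]]] //= ?;
  rewrite ?(mulrDl, mulrDr, mulrBl, mulrBr, mulNr, mulrN, E, opprK, opprD); ring.
Qed.

Lemma quatD a b c d a' b' c' d' :
  quat a b c d + quat a' b' c' d' = quat (a + a') (b + b') (c + c') (d + d').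
Proof.
by apply/matrixP => i j; rewrite !mxE; case: (i == 0); case: (j == 0); ring.
Qed.

Lemma quatZ k a b c d : k *: quat a b c d = quat (k * a) (k * b) (k * c) (k * d).
Proof.
by apply/matrixP => i j; rewrite !mxE; case: (i == 0); case: (j == 0); ring.
Qed.

Lemma quat_scalar a : quat a 0 0 0 = a%:M.
Proof.
apply/matrixP => i j; rewrite !mxE.
by case: i => [[|[|[]]]] //= ?; case: j => [[|[|[]]]] //= ?; rewrite !mulr0 ?subr0 ?addr0.
Qed.

Lemma tr_quat a b c d : \tr (quat a b c d) = 2 * a.
Proof. by rewrite /mxtrace !big_ord_recl big_ord0 !mxE /=; ring. Qed.

(** The real parts drop out. The commutator is twice the cross product of the vector parts and the
    trace is twice the real part, hence -4 times a triple product. *)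
Lemma cubic_quat a b c d a' b' c' d' a'' b'' c'' d'' :
  cubic (quat a b c d) (quat a' b' c' d') (quat a'' b'' c'' d'') =
  - 4 * (b * (c' * d'' - d' * c'') + c * (d' * b'' - b' * d'') + d * (b' * c'' - c' * b'')).
Proof.
rewrite /cubic mulmxBr raddfB /= !quatM !tr_quat; ring.
Qed.

Variable m : nat.

(** Zero on the complement makes this additive and multiplicative, so it commutes with derivatives;
    the identity there is supplied separately by [embc]. *)
Definition emb (a : 'M[C]_2) : 'M[C]_(2 + m) := block_mx a 0 0 0.

Lemma embM a b : emb a *m emb b = emb (a *m b).
Proof. by rewrite /emb mulmx_block !mul0mx !mulmx0 !addr0. Qed.

Lemma embD a b : emb a + emb b = emb (a + b).
Proof. by rewrite /emb add_block_mx !addr0. Qed.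

Lemma embZ k a : k *: emb a = emb (k *: a).
Proof. by rewrite /emb scale_block_mx !scaler0. Qed.

Lemma tr_emb a : \tr (emb a) = \tr a.
Proof. by rewrite /emb mxtrace_block linear0 addr0. Qed.

Lemma cubic_emb a b c : cubic (emb a) (emb b) (emb c) = cubic a b c.
Proof.
have embN x : - emb x = emb (- x) by rewrite /emb opp_block_mx !oppr0.
by rewrite /cubic !embM embN embD embM tr_emb.
Qed.

Definition embc : 'M[C]_(2 + m) := block_mx 0 0 0 1%:M.

Lemma embc_emb a : embc *m emb a = 0.
Proof. by rewrite /emb /embc mulmx_block !mul0mx !mulmx0 !addr0 block_mx0. Qed.

Lemma emb_embc a : emb a *m embc = 0.
Proof. by rewrite /emb /embc mulmx_block !mul0mx !mulmx0 !addr0 block_mx0. Qed.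

Lemma embc_idem : embc *m embc = embc.
Proof. by rewrite /embc mulmx_block !mul0mx !mulmx0 mulmx1 !addr0 add0r. Qed.

Lemma embc1 : embc + emb 1%:M = 1%:M.
Proof. by rewrite /emb /embc add_block_mx !addr0 add0r -scalar_mx_block. Qed.

End quaternions.

(** * Sines and cosines as matrix polynomials *)

Section generator.
Context {R : realType} {G : topologicalZmodType} {Gamma : zmodType}.
Context (chi : Gamma -> G -> R[i]) (mu : probability (borel G) R).
Hypothesis G_compact : compact [set: G].
Hypothesis chi_dual : is_character_group chi.
Hypothesis mu_haar : is_haar mu.
Local Notation C := R[i].
Local Notation I := ('i%C : C).
Variable phi : 'I_3 -> Gamma -> C.
Hypothesis phiD : forall i x y, phi i (x + y) = phi i x + phi i y.
Variable e : 'I_3 -> Gamma.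
Hypothesis phi_e : forall i j, phi i (e j) = (i == j)%:R.
Variable m : nat.
Local Notation M := 'M[C]_(2 + m).

Definition cosc j g : C := (chi j g + chi (- j) g) / 2.
Definition sinc j g : C := (chi j g - chi (- j) g) / (2 * I).

Definition cosp (j : Gamma) : seq (M * Gamma) := [:: ((1 / 2)%:M, j); ((1 / 2)%:M, - j)].
Definition sinp (j : Gamma) : seq (M * Gamma) :=
  [:: ((1 / (2 * I))%:M, j); ((- (1 / (2 * I)))%:M, - j)].
Definition cstp (c : M) : seq (M * Gamma) := [:: (c, 0)].

Lemma mev_cosp j g : mev chi (cosp j) g = (cosc j g)%:M.
Proof.
rewrite /mev !big_cons big_nil /= addr0 !scale_scalar_mx -raddfD /=; congr _%:M.
by rewrite /cosc; field.
Qed.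

Lemma i_neq0 : I != 0.
Proof. by rewrite eq_complex /= oner_eq0 andbF. Qed.

Lemma mev_sinp j g : mev chi (sinp j) g = (sinc j g)%:M.
Proof.
rewrite /mev !big_cons big_nil /= addr0 !scale_scalar_mx -raddfD /=; congr _%:M.
by rewrite /sinc; field; exact: i_neq0.
Qed.

Lemma mev_cstp c g : mev chi (cstp c) g = c.
Proof. by rewrite /mev big_seq1 (chi0 chi_dual) scale1r. Qed.

Section derivation.
Variable p : Gamma -> C.
Hypothesis pD : forall x y, p (x + y) = p x + p y.

Lemma phiN j : p (- j) = - p j.
Proof. by apply/eqP; rewrite -addr_eq0 -pD addNr (deriv_phi0 pD). Qed.

Lemma mevD_cosp j g : mevD chi p (cosp j) g = (p j * (I * sinc j g))%:M.
Proof.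
rewrite /mevD !big_cons big_nil /= addr0 !scale_scalar_mx -raddfD /= phiN; congr _%:M.
by rewrite /sinc; field; exact: i_neq0.
Qed.

Lemma mevD_sinp j g : mevD chi p (sinp j) g = (p j * (- I * cosc j g))%:M.
Proof.
rewrite /mevD !big_cons big_nil /= addr0 !scale_scalar_mx -raddfD /= phiN; congr _%:M.
have -> : 1 / (2 * I) = - I / 2.
  have iV : I^-1 = - I by apply: (mulIf i_neq0); rewrite mulVf ?i_neq0 // mulNr iiN1 opprK.
  by rewrite div1r invfM iV mulrC.
by rewrite /cosc; field.
Qed.

Lemma mevD_cstp c g : mevD chi p (cstp c) g = 0.
Proof. by rewrite /mevD big_seq1 (deriv_phi0 pD) mul0r scale0r. Qed.

End derivation.
End generator.

Lemma quat_ext (R : realType) (a b c d a' b' c' d' : R[i]) :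
  a = a' -> b = b' -> c = c' -> d = d' -> quat a b c d = quat a' b' c' d'.
Proof. by move=> -> -> -> ->. Qed.

Section jacobian.
Variable R : realType.
Local Notation C := R[i].
Local Notation I := ('i%C : C).
Variables c s c1 s1 c2 s2 : C.

(** [Q] is the conjugate of the generator and [d] its squared norm; the other three factors are its
    derivatives without their common factor [I]. The identity holds for independent
    [c, s, c1, s1, c2, s2], which is why [ring] proves it. *)
Lemma quat_jacobian (d := c ^+ 2 + s ^+ 2 * (c1 ^+ 2 + c2 ^+ 2 + s1 ^+ 2 * s2 ^+ 2))
  (Q := quat c (- (s * c1)) (- (s * c2)) (- (s * s1 * s2))) :
  cubic (Q *m quat s (- c * c1) (- c * c2) (- c * s1 * s2))
        (Q *m quat 0 (s * s1) 0 (- (s * c1 * s2)))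
        (Q *m quat 0 0 (s * s2) (- (s * s1 * c2))) =
  4 * d * (s ^+ 2 * (c ^+ 2 + s ^+ 2) *
           (c1 ^+ 2 * s2 ^+ 2 + c2 ^+ 2 * s1 ^+ 2 + s1 ^+ 2 * s2 ^+ 2)).
Proof. by rewrite /Q /d !quatM cubic_quat; ring. Qed.

Lemma quat_conjM (d := c ^+ 2 + s ^+ 2 * (c1 ^+ 2 + c2 ^+ 2 + s1 ^+ 2 * s2 ^+ 2)) :
  quat c (s * c1) (s * c2) (s * s1 * s2) *m
  quat c (- (s * c1)) (- (s * c2)) (- (s * s1 * s2)) = d%:M.
Proof. by rewrite -quat_scalar quatM /d; apply: quat_ext; ring. Qed.

End jacobian.

#[local] Opaque quat emb embc.

Section generator.
Context {R : realType} {G : topologicalZmodType} {Gamma : zmodType}.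
Context (chi : Gamma -> G -> R[i]) (mu : probability (borel G) R).
Hypothesis G_compact : compact [set: G].
Hypothesis chi_dual : is_character_group chi.
Hypothesis mu_haar : is_haar mu.
Local Notation C := R[i].
Local Notation I := ('i%C : C).
Variable phi : 'I_3 -> Gamma -> C.
Hypothesis phiD : forall i x y, phi i (x + y) = phi i x + phi i y.
Variable e : 'I_3 -> Gamma.
Hypothesis phi_e : forall i j, phi i (e j) = (i == j)%:R.
Variable m : nat.
Local Notation M := 'M[C]_(2 + m).
Local Notation emb := (@emb R m).
Local Notation embc := (@embc R m).
Local Notation cstp := (@cstp R Gamma m).
Local Notation cosp := (@cosp R Gamma m).
Local Notation sinp := (@sinp R Gamma m).
Local Notation mev := (@mev R G Gamma chi (2 + m)).
Local Notation mevD := (@mevD R G Gamma chi (2 + m)).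
Local Notation cosc := (cosc chi).
Local Notation sinc := (sinc chi).

(* With [u = (cos x, cos y, sin x sin y)], which never vanishes, and with [J] the
   quaternion units, this is [cos t + sin t (u . J)], extended by 1 to size 2 + m.
   Its quaternion part maps the 3-torus to H \ {0} with Jacobian
   [sin^2 t (1 - cos^2 x cos^2 y) >= 0]. *)
Definition genp : seq (M * Gamma) :=
  cstp embc ++ (mulp (cosp (e i0)) (cstp (emb 1%:M)) ++
  mulp (sinp (e i0))
    (mulp (cosp (e i1)) (cstp (emb (quat 0 1 0 0))) ++
    (mulp (cosp (e i2)) (cstp (emb (quat 0 0 1 0))) ++
     mulp (sinp (e i1)) (mulp (sinp (e i2)) (cstp (emb (quat 0 0 0 1))))))).

Definition genq g := quat (cosc (e i0) g) (sinc (e i0) g * cosc (e i1) g)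
  (sinc (e i0) g * cosc (e i2) g) (sinc (e i0) g * sinc (e i1) g * sinc (e i2) g).

Lemma mev_genp g : mev genp g = embc + emb (genq g).
Proof.
rewrite /genp !(mev_cat, mev_mulp chi_dual, mev_cosp, mev_sinp, mev_cstp chi_dual).
rewrite /genq; move: (cosc _ _) (sinc _ _) (cosc _ _) (sinc _ _) (cosc _ _) (sinc _ _).
move=> c s c1 s1 c2 s2; rewrite !(mul_scalar_mx, embZ, embD) -quat_scalar !(quatZ, quatD).
apply: (congr1 (fun z => embc + emb z)); apply: quat_ext; ring.
Qed.

Lemma mevD_genp p g (p0 := p (e i0)) (p1 := p (e i1)) (p2 := p (e i2))
  (c := cosc (e i0) g) (s := sinc (e i0) g) (c1 := cosc (e i1) g) (s1 := sinc (e i1) g)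
  (c2 := cosc (e i2) g) (s2 := sinc (e i2) g) :
  (forall x y, p (x + y) = p x + p y) ->
  mevD p genp g = emb (I *: quat (p0 * s) (- p0 * c * c1 + p1 * s * s1)
    (- p0 * c * c2 + p2 * s * s2)
    (- p0 * c * s1 * s2 - p1 * s * c1 * s2 - p2 * s * s1 * c2)).
Proof.
move=> pD.
have mD (u v : seq (M * Gamma)) := mevD_mulp chi_dual u v g pD.
have eC := mevD_cosp chi m pD; have eS := mevD_sinp chi m pD; have eK := mevD_cstp chi (m := m) pD.
rewrite /genp !(mevD_cat, mD, mev_cat, mev_mulp chi_dual, eC, eS, eK, mev_cosp, mev_sinp, mev_cstp chi_dual).
rewrite -/p0 -/p1 -/p2 -/c -/s -/c1 -/s1 -/c2 -/s2 !mulmx0 !addr0 add0r.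
move: p0 p1 p2 c s c1 s1 c2 s2 => p0 p1 p2 c s c1 s1 c2 s2.
rewrite !(mul_scalar_mx, embZ, embD) -quat_scalar !(quatZ, quatD).
apply: (congr1 emb); apply: quat_ext; ring.
Qed.

End generator.

#[local] Opaque quat emb embc.

(** * The integral of the generator is nonzero *)

Section generator_degree.
Context {R : realType} {G : topologicalZmodType} {Gamma : zmodType}.
Context (chi : Gamma -> G -> R[i]) (mu : probability (borel G) R).
Hypothesis G_compact : compact [set: G].
Hypothesis chi_dual : is_character_group chi.
Hypothesis mu_haar : is_haar mu.
Local Notation C := R[i].
Local Notation I := ('i%C : C).
Local Notation Cint := (Cintegral mu).
Variable phi : 'I_3 -> Gamma -> C.
Hypothesis phiD : forall i x y, phi i (x + y) = phi i x + phi i y.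
Variable e : 'I_3 -> Gamma.
Hypothesis phi_e : forall i j, phi i (e j) = (i == j)%:R.
Variable m : nat.
Local Notation M := 'M[C]_(2 + m).
Local Notation emb := (@emb R m).
Local Notation embc := (@embc R m).
Local Notation genp := (@genp R Gamma e m).
Local Notation mev := (@mev R G Gamma chi (2 + m)).
Local Notation mevD := (@mevD R G Gamma chi (2 + m)).

Definition rcos j g : R := complex.Re (chi j g).
Definition rsin j g : R := complex.Im (chi j g).

Lemma coscE j g : cosc chi j g = (rcos j g)%:C.
Proof.
by rewrite /cosc (chiN chi_dual) addcJ mulrAC divff ?mul1r // pnatr_eq0.
Qed.

Lemma sincE j g : sinc chi j g = (rsin j g)%:C.
Proof.
rewrite /sinc (chiN chi_dual) subcJ -/(rsin j g); move: (rsin j g)%:C => x.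
by field; exact: i_neq0.
Qed.

Lemma rcos2D j g : rcos j g ^+ 2 + rsin j g ^+ 2 = 1.
Proof.
have := normc_chi chi_dual j g; rewrite /rcos /rsin; case: (chi j g) => a b /= h.
by have := sqr_sqrtr (addr_ge0 (sqr_ge0 a) (sqr_ge0 b)); rewrite h expr1n.
Qed.

Definition jac_den (c s c1 s1 c2 s2 : R) : R :=
  c ^+ 2 + s ^+ 2 * (c1 ^+ 2 + c2 ^+ 2 + s1 ^+ 2 * s2 ^+ 2).

Definition jac (c s c1 s1 c2 s2 : R) : R :=
  s ^+ 2 * (c ^+ 2 + s ^+ 2) * (c1 ^+ 2 * s2 ^+ 2 + c2 ^+ 2 * s1 ^+ 2 + s1 ^+ 2 * s2 ^+ 2)
  / jac_den c s c1 s1 c2 s2 ^+ 2.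

Lemma jac_den_bounds (c s c1 s1 c2 s2 : R) : c ^+ 2 + s ^+ 2 = 1 ->
  c1 ^+ 2 + s1 ^+ 2 = 1 -> c2 ^+ 2 + s2 ^+ 2 = 1 ->
  1 <= jac_den c s c1 s1 c2 s2 <= 2.
Proof.
move=> h h1 h2; rewrite /jac_den.
have -> : c ^+ 2 + s ^+ 2 * (c1 ^+ 2 + c2 ^+ 2 + s1 ^+ 2 * s2 ^+ 2) =
    1 + s ^+ 2 * (c1 ^+ 2 * c2 ^+ 2).
  have -> : s1 ^+ 2 = 1 - c1 ^+ 2 by rewrite -h1; ring.
  have -> : s2 ^+ 2 = 1 - c2 ^+ 2 by rewrite -h2; ring.
  have -> : c ^+ 2 = 1 - s ^+ 2 by rewrite -h; ring.
  ring.
have a0 := sqr_ge0 s; have a1 := sqr_ge0 c1; have a2 := sqr_ge0 c2.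
have b0 := sqr_ge0 c; have b1 := sqr_ge0 s1; have b2 := sqr_ge0 s2.
have m0 : 0 <= s ^+ 2 * (c1 ^+ 2 * c2 ^+ 2) := mulr_ge0 a0 (mulr_ge0 a1 a2).
have m1 : c1 ^+ 2 * c2 ^+ 2 <= 1 by apply: (mulr_ile1 a1 a2); lra.
have m2 : s ^+ 2 * (c1 ^+ 2 * c2 ^+ 2) <= 1 by apply: (mulr_ile1 a0 (mulr_ge0 a1 a2)) => //; lra.
by apply/andP; split; lra.
Qed.

(** The 4 comes from [d <= 2]. This trigonometric minorant has a computable integral, which replaces
    the argument that a nonzero nonnegative continuous function has a positive one. *)
Lemma jac_lower (c s c1 s1 c2 s2 : R) : c ^+ 2 + s ^+ 2 = 1 ->
  c1 ^+ 2 + s1 ^+ 2 = 1 -> c2 ^+ 2 + s2 ^+ 2 = 1 ->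
  s ^+ 2 * s1 ^+ 2 / 4 <= jac c s c1 s1 c2 s2.
Proof.
move=> h h1 h2; rewrite /jac; have /andP[] := jac_den_bounds h h1 h2.
set d := jac_den c s c1 s1 c2 s2 => d1 d2.
have -> : c1 ^+ 2 * s2 ^+ 2 + c2 ^+ 2 * s1 ^+ 2 + s1 ^+ 2 * s2 ^+ 2 =
   s1 ^+ 2 + c1 ^+ 2 * s2 ^+ 2.
  by rewrite -[X in _ = X + _]mulr1 -h2; ring.
rewrite h mulr1; apply: ler_pM.
- by rewrite mulr_ge0 ?sqr_ge0.
- by rewrite invr_ge0.
- by rewrite ler_wpM2l ?sqr_ge0 // lerDl mulr_ge0 ?sqr_ge0.
- rewrite lef_pV2 ?posrE //; last by rewrite exprn_gt0 //; lra.
  rewrite expr2; nra.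
Qed.

Lemma genp_inv g (c := rcos (e i0) g) (s := rsin (e i0) g) (c1 := rcos (e i1) g)
    (s1 := rsin (e i1) g) (c2 := rcos (e i2) g) (s2 := rsin (e i2) g) :
  mev genp g *m (embc + emb ((jac_den c s c1 s1 c2 s2)%:C^-1 *:
    quat c%:C (- (s%:C * c1%:C)) (- (s%:C * c2%:C)) (- (s%:C * s1%:C * s2%:C)))) = 1%:M.
Proof.
have gE := mev_genp chi_dual e m g.
rewrite /genq !coscE !sincE -/c -/s -/c1 -/s1 -/c2 -/s2 in gE.
have /andP[d1 _] := jac_den_bounds (rcos2D (e i0) g) (rcos2D (e i1) g) (rcos2D (e i2) g).
have dn0 : (jac_den c s c1 s1 c2 s2)%:C != 0.
  by rewrite eq_complex /= eqxx andbT gt_eqF //; apply: lt_le_trans d1.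
have dE : (jac_den c s c1 s1 c2 s2)%:C =
   c%:C ^+ 2 + s%:C ^+ 2 * (c1%:C ^+ 2 + c2%:C ^+ 2 + s1%:C ^+ 2 * s2%:C ^+ 2).
  by rewrite /jac_den !(rmorphD, rmorphM, rmorphXn).
have QQ := quat_conjM c%:C s%:C c1%:C s1%:C c2%:C s2%:C; rewrite -dE in QQ.
rewrite gE mulmxDl !mulmxDr embc_idem embc_emb emb_embc addr0 add0r embM.
by rewrite -scalemxAr QQ scale_scalar_mx mulVf // embc1.
Qed.

Lemma genp_cubic X g : mev genp g *m X g = 1%:M ->
  cubic (X g *m mevD (phi i0) genp g) (X g *m mevD (phi i1) genp g)
        (X g *m mevD (phi i2) genp g) =
  - (4 * I) * (jac (rcos (e i0) g) (rsin (e i0) g) (rcos (e i1) g)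
     (rsin (e i1) g) (rcos (e i2) g) (rsin (e i2) g))%:C.
Proof.
move=> gX.
rewrite !(mevD_genp chi_dual e m g (@phiD _)) !phi_e /=.
rewrite !(mul1r, mul0r, mulN1r, oppr0, addr0, add0r, subr0, sub0r).
have := mev_genp chi_dual e m g; rewrite /genq !coscE !sincE.
set c := rcos _ _; set s := rsin _ _; set c1 := rcos _ _; set s1 := rsin _ _.
set c2 := rcos _ _; set s2 := rsin _ _ => gE.
have /andP[d1 _] := jac_den_bounds (rcos2D (e i0) g) (rcos2D (e i1) g) (rcos2D (e i2) g).
rewrite /jac -/c -/s -/c1 -/s1 -/c2 -/s2 in d1 *; set d := jac_den c s c1 s1 c2 s2 in d1 *.
pose Q := quat c%:C (- (s%:C * c1%:C)) (- (s%:C * c2%:C)) (- (s%:C * s1%:C * s2%:C)).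
have dn0 : d%:C != 0 by rewrite eq_complex /= eqxx andbT gt_eqF //; lra.
have dE : d%:C = c%:C ^+ 2 + s%:C ^+ 2 * (c1%:C ^+ 2 + c2%:C ^+ 2 + s1%:C ^+ 2 * s2%:C ^+ 2).
  by rewrite /d /jac_den !(rmorphD, rmorphM, rmorphXn).
have XE : X g = embc + emb ((d%:C)^-1 *: Q).
  have YX := mulmx1C (genp_inv g).
  by rewrite -[LHS]mul1mx -YX -mulmxA gX mulmx1.
have XB (B : 'M[C]_2) : X g *m emb (I *: B) = emb ((I / d%:C) *: (Q *m B)).
  by rewrite XE mulmxDl embc_emb add0r embM -scalemxAl -scalemxAr scalerA mulrC.
(* Each logarithmic derivative carries the factor [I / d], which comes out cubed: [I ^+ 3 = - I],
   and one power of [d] cancels against the Jacobian. *)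
rewrite !XB cubic_emb cubicZ.
have := quat_jacobian c%:C s%:C c1%:C s1%:C c2%:C s2%:C.
rewrite -dE -/Q => ->.
rewrite !(rmorphM, rmorphD, rmorphXn, fmorphV) /= -/d.
have I3 : I ^+ 3 = - I by rewrite exprS sqr_i mulrN1.
rewrite expr_div_n I3; move: dn0 dE; move: d%:C c%:C s%:C c1%:C s1%:C c2%:C s2%:C.
move=> D c' s' c1' s1' c2' s2' D0 DE; field.
by rewrite -!expr2 -DE.
Qed.

Lemma mulp_pev (s t : seq (C * Gamma)) g :
  pev chi [seq (x.1 * y.1, x.2 + y.2) | x <- s, y <- t] g = pev chi s g * pev chi t g.
Proof.
rewrite /pev big_allpairs_dep mulr_suml; apply: eq_bigr => x _.
rewrite mulr_sumr; apply: eq_bigr => y _ /=.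
by rewrite (chiD chi_dual); ring.
Qed.

Lemma Cint_pev s : Cint (pev chi s) = \sum_(x <- s) x.1 * (x.2 == 0)%:R.
Proof.
have cx (x : C * Gamma) : cont (fun g => x.1 * chi x.2 g).
  have c0 := cont_chi chi_dual (j := x.2); exact: (contM (@cont_cst _ _ x.1) c0).
rewrite /pev (Cint_sum G_compact mu _ _ cx); apply: eq_bigr => x _.
rewrite -(Cint_chi G_compact chi_dual mu_haar).
exact: (CintZ G_compact mu x.1 (cont_chi chi_dual (j := x.2))).
Qed.

Definition sin2p (j : Gamma) : seq (C * Gamma) :=
  [:: (1 / 2, 0); (- (1 / 4), j + j); (- (1 / 4), - (j + j))].

Lemma pev_sin2p j g : pev chi (sin2p j) g = ((rsin j g) ^+ 2)%:C.
Proof.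
rewrite rmorphXn /= -sincE /sinc /pev !big_cons big_nil /= (chi0 chi_dual) addr0.
rewrite opprD !(chiD chi_dual) expr_div_n exprMn sqr_i.
have := chiNK chi_dual j g; set a := chi j g; set b := chi (- j) g => ba.
have -> : (a - b) ^+ 2 = a * a + b * b - 2 * (b * a) by ring.
by rewrite ba; field.
Qed.

Lemma Cint_sin2_sin2 : Cint (fun g => ((rsin (e i0) g) ^+ 2 * (rsin (e i1) g) ^+ 2)%:C) = 1 / 4.
Proof.
pose t := [seq (x.1 * y.1, x.2 + y.2) | x <- sin2p (e i0), y <- sin2p (e i1)].
have E g : ((rsin (e i0) g) ^+ 2 * (rsin (e i1) g) ^+ 2)%:C = pev chi t g.
  by rewrite mulp_pev !pev_sin2p rmorphM.
rewrite (Cint_ext _ E) Cint_pev big_allpairs_dep /sin2p !big_cons !big_nil /= !addr0 !add0r.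
(* A frequency on which some [phi i] is nonzero is nonzero. This excludes all products of terms
   except that of the two constants 1/2. *)
have n0 i z : phi i z != 0 -> (z == 0) = false.
  by move=> h; apply/eqP => z0; move: h; rewrite z0 (deriv_phi0 (@phiD i)) eqxx.
have pN i z := phiN (@phiD i) z.
have two : 1 + 1 != 0 :> C by rewrite -(natrD _ 1 1) pnatr_eq0.
have nn : - (1 + 1) != 0 :> C by rewrite oppr_eq0.
rewrite eqxx !(n0 i0 (e i0 + e i0 + _)) ?(n0 i0 (- (e i0 + e i0) + _)) ?(n0 i0 (e i0 + e i0))
  ?(n0 i0 (- (e i0 + e i0))) ?(n0 i1 (e i1 + e i1)) ?(n0 i1 (- (e i1 + e i1)));
  rewrite ?(phiD, pN, phi_e) /= ?oppr0 ?addr0 //.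
by rewrite !mulr0 !addr0 mulr1; field.
Qed.

Lemma wz_genp X : mcont X -> (forall g, mev genp g *m X g = 1%:M) ->
  wz mu (fun i => mevD (phi i) genp) X != 0.
Proof.
move=> cX gX.
pose k g := jac (rcos (e i0) g) (rsin (e i0) g) (rcos (e i1) g)
     (rsin (e i1) g) (rcos (e i2) g) (rsin (e i2) g).
have cA i : mcont (mevD (phi i) genp).
  by move=> a b; under eq_fun do rewrite -mev_derp; exact: mev_cont.
have cw := cont_wz_integrand cA cX.
have I0 : - (4 * I) != 0 :> C by rewrite oppr_eq0 mulf_neq0 ?pnatr_eq0 ?i_neq0.
pose w g := cubic (X g *m mevD (phi i0) genp g) (X g *m mevD (phi i1) genp g)
        (X g *m mevD (phi i2) genp g).
have kE : (fun g => (k g)%:C) = (fun g => (- (4 * I))^-1 * w g).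
  by apply/funext => g; rewrite /w genp_cubic // mulKf.
have ck : cont (fun g => (k g)%:C) by rewrite kE; exact: (contM (@cont_cst _ _ _) cw).
have -> : wz mu (fun i => mevD (phi i) genp) X = - (4 * I) * Cint (fun g => (k g)%:C).
  by rewrite kE (CintZ G_compact mu _ cw) mulVKf.
rewrite mulf_neq0 //; apply/eqP => z.
have csin j : cont (fun g => (rsin j g)%:C).
  have -> : (fun g => (rsin j g)%:C) = (fun g => (1 / (2 * I)) * chi j g + - (1 / (2 * I)) * chi (- j) g).
    by apply/funext => g; rewrite -sincE /sinc; field; exact: i_neq0.
  have c1 := cont_chi chi_dual (j := j); have c2 := cont_chi chi_dual (j := - j).
  exact: (contD (contM (@cont_cst _ _ _) c1) (contM (@cont_cst _ _ _) c2)).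
pose f g : C := ((rsin (e i0) g) ^+ 2 * (rsin (e i1) g) ^+ 2)%:C.
have cf : cont f.
  have -> : f = (fun g => (rsin (e i0) g)%:C * (rsin (e i0) g)%:C *
      ((rsin (e i1) g)%:C * (rsin (e i1) g)%:C)).
    by apply/funext => g; rewrite /f !expr2 !rmorphM.
  exact: (contM (contM (csin (e i0)) (csin (e i0))) (contM (csin (e i1)) (csin (e i1)))).
have cf4 : cont (fun g => (4^-1)%:C * f g) := contM (@cont_cst _ _ _) cf.
have le4 g : complex.Re ((4^-1)%:C * f g) <= complex.Re (k g)%:C.
  have := jac_lower (rcos2D (e i0) g) (rcos2D (e i1) g) (rcos2D (e i2) g).
  by rewrite /f -rmorphM /= mulrC.
have := le_Re_Cint G_compact mu cf4 ck le4.
(* If the integral were 0, the comparison would read [1/16 <= 0]. *)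
rewrite (CintZ G_compact mu _ cf) /f Cint_sin2_sin2 z.
have -> : (4^-1)%:C * (1 / 4) = (4^-1 * (1 / 4))%:C :> C.
  by rewrite !rmorphM !fmorphV !rmorph_nat rmorph1.
rewrite /=; lra.
Qed.

End generator_degree.

(** * Banach algebras *)

Section banach_algebra.
Context {R : realType} (B : comBanachAlgType R[i]).
Local Notation C := R[i].

Definition bnorm (a : B) : R := complex.Re `|a|.

Lemma bnormE (a : B) : `|a| = (bnorm a)%:C.
Proof. by rewrite /bnorm RRe_real // normr_real. Qed.

Lemma bnorm_ge0 a : 0 <= bnorm a.
Proof. by rewrite -ler0c -bnormE. Qed.

Lemma bnormD a b : bnorm (a + b) <= bnorm a + bnorm b.
Proof. by rewrite -lecR rmorphD /= -!bnormE ler_normD. Qed.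

Lemma bnormM a b : bnorm (a * b) <= bnorm a * bnorm b.
Proof. by rewrite -lecR rmorphM /= -!bnormE; exact: normr_bmul_le. Qed.

Lemma bnormN a : bnorm (- a) = bnorm a.
Proof. by rewrite /bnorm normrN. Qed.

Lemma bnorm_eq0 a : bnorm a = 0 -> a = 0.
Proof. by move=> a0; apply/normr0_eq0; rewrite bnormE a0. Qed.

Lemma bnormZ k a : bnorm (k *: a) = normc k * bnorm a.
Proof.
by apply: complexI; rewrite rmorphM /= -!bnormE -normc_normr normrZ.
Qed.

(** The solution [l] is the inverse of [1 - b]; the partial sums of its series are the iterates of
    [x |-> 1 + b x]. *)
Lemma geom_series_cvg (b : B) : bnorm b < 1 -> exists l, l = 1 + b * l.
Proof.
move=> b1; pose r := bnorm b; have r0 : 0 <= r := bnorm_ge0 b.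
pose s k := iter k (fun x => 1 + b * x) (1 : B).
have sS k : s k.+1 = 1 + b * s k by [].
pose K := bnorm (s 1%N - s 0%N).
have K0 : 0 <= K := bnorm_ge0 _.
have step k : bnorm (s k.+1 - s k) <= r ^+ k * K.
  elim: k => [|k ih]; first by rewrite expr0 mul1r.
  have -> : s k.+2 - s k.+1 = b * (s k.+1 - s k).
    by rewrite !sS mulrBr opprD addrACA subrr add0r.
  apply: le_trans (bnormM _ _) _; rewrite exprS -mulrA.
  exact: ler_wpM2l.
(* The usual geometric tail estimate, multiplied by [1 - r] to be free of division. *)
have tail N k : (1 - r) * bnorm (s (N + k)%N - s N) <= r ^+ N * K * (1 - r ^+ k).
  elim: k => [|k ih].
    by rewrite addn0 subrr expr0 subrr mulr0 /bnorm normr0 mulr0.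
  have -> : s (N + k.+1)%N - s N = (s (N + k).+1 - s (N + k)%N) + (s (N + k)%N - s N).
    by rewrite addnS addrA subrK.
  have h := bnormD (s (N + k).+1 - s (N + k)%N) (s (N + k)%N - s N).
  have := step (N + k)%N; rewrite exprD exprS => h2.
  have r1 : 0 <= 1 - r by rewrite subr_ge0 ltW.
  have h3 : (1 - r) * bnorm (s (N + k).+1 - s (N + k)%N) <= (1 - r) * (r ^+ N * r ^+ k * K).
    exact: ler_wpM2l.
  have h4 := ler_wpM2l r1 h.
  apply: le_trans h4 _; rewrite mulrDr.
  have -> : r ^+ N * K * (1 - r * r ^+ k) =
     (1 - r) * (r ^+ N * r ^+ k * K) + r ^+ N * K * (1 - r ^+ k) by ring.
  exact: lerD.
have small (e : R) : 0 < e -> exists N, forall k, bnorm (s (N + k)%N - s N) < e.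
  move=> e0.
  have e1 : 0 < e * (1 - r) / (K + 1).
    by rewrite !divr_gt0 ?mulr_gt0 ?subr_gt0 //; lra.
  have [N hN] : exists N, r ^+ N <= e * (1 - r) / (K + 1).
    have rlt : `|r| < 1 by rewrite ger0_norm.
    have /cvgrPdist_le /(_ _ e1)[N _ hN] := cvg_expr rlt.
    exists N; have := hN N (leqnn _).
    by rewrite /= sub0r normrN ger0_norm // exprn_ge0.
  exists N => k; rewrite -(ltr_pM2l (_ : 0 < 1 - r)) ?subr_gt0 //.
  apply: le_lt_trans (tail N k) _.
  have p0 : 0 <= r ^+ N by rewrite exprn_ge0.
  have q0 : 0 <= r ^+ k by rewrite exprn_ge0.
  apply: (@le_lt_trans _ _ (r ^+ N * K)).
    by rewrite ler_piMr ?mulr_ge0 // lerBlDr lerDl.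
  have eK : e * (1 - r) / (K + 1) * K < (1 - r) * e.
    have -> : (1 - r) * e = e * (1 - r) / (K + 1) * (K + 1) by rewrite divfK 1?mulrC // gt_eqF //; lra.
    by rewrite ltr_pM2l //; lra.
  by apply: le_lt_trans eK; apply: ler_wpM2r.
have eps_real (e : C) : 0 < e -> exists2 e' : R, 0 < e' & e = e'%:C.
  move=> e0; exists (complex.Re e); last by rewrite RRe_real // gtr0_real.
  by rewrite -ltcR RRe_real // gtr0_real.
have scauchy : cauchy (s @ \oo).
  apply: cauchy_exP => _ /eps_real[e e0 ->].
  have [N hN] := small e e0; exists (s N), N => // k /= Nk.
  rewrite -ball_normE /= -(subnKC Nk) distrC bnormE ltcR; exact: hN.
have /cvg_ex[l sl] : cvg (s @ \oo) by apply: cauchy_cvg.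
exists l; apply/eqP; rewrite -subr_eq0; apply/eqP/bnorm_eq0.
apply: le_anti; rewrite bnorm_ge0 andbT; apply/ler_addgt0Pl => e e0; rewrite addr0.
have e2 : 0 < (e / 2)%:C :> C by rewrite ltcR; lra.
have /cvgrPdist_lt /(_ _ e2)[N _ hN] := sl.
have h1 := hN N (leqnn _); have h2 := hN N.+1 (leqnSn _).
rewrite /= bnormE ltcR in h1; rewrite /= bnormE ltcR in h2.
have -> : l - (1 + b * l) = (l - s N.+1) + (- (b * (l - s N))).
  by rewrite sS; ring.
apply: le_trans (bnormD _ _) _; rewrite bnormN.
have := bnormM b (l - s N); have : bnorm b * bnorm (l - s N) <= 1 * bnorm (l - s N).
  by apply: ler_wpM2r; [exact: bnorm_ge0|exact: ltW].
lra.
Qed.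

(** If [f a] exceeded the norm of [a], then [b = a / f a] would have norm below 1 and [f b = 1];
    applying [f] to [l = 1 + b l] gives [f l = 1 + f l]. The norm of the unit does not enter. *)
Lemma multiplicative_contractive (f : B -> C) : linear (f : B -> C^o) ->
  monoid_morphism f -> forall a, normc (f a) <= bnorm a.
Proof.
move=> flin [f1 fM] a; rewrite leNgt; apply/negP => lt.
have z0 : f a != 0.
  apply/eqP => fa0; move: lt; rewrite fa0 normc0 ltNge bnorm_ge0 //.
have n0 : 0 < normc (f a) := le_lt_trans (bnorm_ge0 a) lt.
have fD x y : f (x + y) = f x + f y by have := flin 1 x y; rewrite !scale1r.
have f0 : f 0 = 0 by apply: (addrI (f 0)); rewrite -fD !addr0.
have fZ k x : f (k *: x) = k * f x by have := flin k x 0; rewrite addr0 f0 addr0.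
pose b := (f a)^-1 *: a.
have b1 : bnorm b < 1 by rewrite bnormZ normcV mulrC ltr_pdivrMr // mul1r.
have [l lE] := geom_series_cvg b1.
have := congr1 f lE; rewrite fD fM f1 fZ mulVf // mul1r => /eqP.
by rewrite -subr_eq0 opprD addrCA subrr addr0 oppr_eq0 oner_eq0.
Qed.

End banach_algebra.

(** * The winding class on the invertible matrices over an admissible algebra *)

Section admissible_algebra.
Context {R : realType} {G : topologicalZmodType} {Gamma : zmodType}.
Context (chi : Gamma -> G -> R[i]) (mu : probability (borel G) R).
Hypothesis G_compact : compact [set: G].
Hypothesis chi_dual : is_character_group chi.
Hypothesis mu_haar : is_haar mu.
Context (B : comBanachAlgType R[i]) (iota : B -> G -> R[i]).
Hypothesis B_adm : admissible chi iota.
Local Notation C := R[i].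
Variable phi : 'I_3 -> Gamma -> C.
Hypothesis phiD : forall i x y, phi i (x + y) = phi i x + phi i y.
Local Notation wind := (@wind R G Gamma chi mu _ phi).
Local Notation mapprox := (@mapprox R G Gamma chi _).
Local Notation mxeval := (@mxeval R G B iota).

Lemma iotaD a b g : iota (a + b) g = iota a g + iota b g.
Proof. by have := adm_linear B_adm g 1 a b; rewrite !scale1r. Qed.

Lemma iota0 g : iota 0 g = 0.
Proof. by apply: (addrI (iota 0 g)); rewrite -iotaD !addr0. Qed.

Lemma iotaB a b g : iota (a - b) g = iota a g - iota b g.
Proof. by apply: (addIr (iota b g)); rewrite -iotaD !subrK. Qed.

Lemma iotaN a g : iota (- a) g = - iota a g.
Proof. by rewrite -sub0r iotaB iota0 sub0r. Qed.

Lemma iotaM a b g : iota (a * b) g = iota a g * iota b g.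
Proof. by have [_ h] := adm_mul B_adm g; apply: h. Qed.

Lemma iota1 g : iota 1 g = 1.
Proof. by have [h _] := adm_mul B_adm g. Qed.

Lemma iota_sum I (r : seq I) (P : pred I) (F : I -> B) g :
  iota (\sum_(i <- r | P i) F i) g = \sum_(i <- r | P i) iota (F i) g.
Proof. by elim/big_rec2: _ => [|i y z _ <-]; rewrite ?iota0 // iotaD. Qed.

Lemma iota_contractive a g : normc (iota a g) <= bnorm a.
Proof.
exact: (@multiplicative_contractive R B (iota^~ g) (adm_linear B_adm g) (adm_mul B_adm g) a).
Qed.

Lemma cont_iota a : cont (iota a).
Proof. exact: (adm_continuous B_adm). Qed.

Lemma approx_iota a : approx_in chi setT (iota a).
Proof.
move=> e e0.
have [] := adm_dense B_adm (O := ball a e%:C).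
- by exists a; apply: ballxx; rewrite ltcR.
- exact: ball_open.
move=> p [ap [k [c [j pE]]]].
exists [seq (c i, j i) | i <- enum 'I_k] => // g.
have -> : pev chi [seq (c i, j i) | i <- enum 'I_k] g = iota p g.
  by rewrite /pev big_map big_enum pE.
rewrite -iotaB; apply: le_trans (iota_contractive _ _) _.
by move: ap; rewrite -ball_normE /= bnormE ltcR => /ltW.
Qed.

Section matrices.
Variable n : nat.
Implicit Types A : 'M[B]_n.

Lemma mxevalM A A' g : mxeval (A *m A') g = mxeval A g *m mxeval A' g.
Proof.
apply/matrixP => i j; rewrite !mxE iota_sum; apply: eq_bigr => k _.
by rewrite iotaM !mxE.
Qed.

Lemma mxeval1 g : mxeval (1%:M : 'M[B]_n) g = 1%:M.
Proof. by apply/matrixP => i j; rewrite !mxE; case: eqP => _; rewrite ?iota1 ?iota0. Qed.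

Lemma mxeval_inj A A' : (forall g, mxeval A g = mxeval A' g) -> A = A'.
Proof.
move=> E; apply/matrixP => i j; apply: (adm_inj B_adm); apply/funext => g.
by have /matrixP/(_ i j) := E g; rewrite !mxE.
Qed.

Lemma mxeval_approx A : mapprox setT (mxeval A).
Proof.
apply: mapprox_entries => i j; have := @approx_iota (A i j).
by congr approx_in; apply/funext => g; rewrite mxE.
Qed.

Lemma mxeval_bdd A : mbdd (mxeval A).
Proof. exact: (mapprox_bdd chi_dual (@mxeval_approx A)). Qed.

Lemma mxeval_approx_spectrum (S : set Gamma) A :
  (forall i j, spectrum chi mu (iota (A i j)) `<=` S) -> mapprox S (mxeval A).
Proof.
move=> AS; apply: mapprox_entries => i j.
have := approx_spectrum G_compact chi_dual mu_haar (@cont_iota (A i j)) (@approx_iota _) (AS i j).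
by congr approx_in; apply/funext => g; rewrite mxE.
Qed.

Lemma mxeval_close A A' e : (forall i j, bnorm (A i j - A' i j) <= e) ->
  forall g, mxN (mxeval A g - mxeval A' g) <= (n * n)%:R * e.
Proof.
move=> h g; rewrite /mxN.
apply: (@le_trans _ _ (\sum_(i < n) \sum_(j < n) e)).
  apply: ler_sum => i _; apply: ler_sum => j _.
  by rewrite !mxE -iotaB; apply: le_trans (iota_contractive _ _) (h i j).
by rewrite !sumr_const !card_ord -mulrnA mulr_natl lexx.
Qed.

Lemma nbhs_mxeval_close A (d : R) : 0 < d ->
  nbhs A [set A' | forall g, mxN (mxeval A g - mxeval A' g) <= d].
Proof.
move=> d0; have e0 : 0 < d / (n * n + 1)%:R by rewrite divr_gt0 // ltr0n addn1.
set e := d / _ in e0.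
apply/nbhs_ballP; exists e%:C; first by rewrite /= ltcR.
move=> A' [_ AA'] g /=; apply: le_trans (mxeval_close (e := e) _ g) _.
  move=> i j; have := AA' i j; rewrite -ball_normE /= bnormE ltcR; exact: ltW.
have -> : d = (n * n + 1)%:R * e by rewrite mulrC divfK // pnatr_eq0 addn1.
by apply: ler_wpM2r; [exact: ltW|rewrite ler_nat addn1].
Qed.

Lemma GL_mxeval A : GL A -> exists A', [/\ GL A', A *m A' = 1%:M, A' *m A = 1%:M &
  forall g, mxeval A g *m mxeval A' g = 1%:M].
Proof.
move=> [A' [AA' A'A]]; exists A'; split=> //; first by exists A.
by move=> g; rewrite -mxevalM AA' mxeval1.
Qed.

Lemma wind_GL A : GL A -> exists c, wind (mxeval A) c.
Proof.
move=> /GL_mxeval[A' [_ _ _ AA']].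
exact: (wind_exists G_compact chi_dual mu_haar phiD (@mxeval_approx A) (@mxeval_approx A') AA').
Qed.

Lemma wind_GL_uniq A c c' : GL A -> wind (mxeval A) c -> wind (mxeval A) c' -> c = c'.
Proof.
move=> /GL_mxeval[A' [_ _ _ AA']].
exact: (wind_uniq G_compact chi_dual mu_haar phiD (@mxeval_bdd A') AA').
Qed.

(** The neighbourhood is taken among all matrices while the class is asserted on [GL] only, so no
    openness of [GL] is involved. *)
Lemma wind_GL_nbhs A c : GL A -> wind (mxeval A) c ->
  nbhs A [set A' | GL A' -> wind (mxeval A') c].
Proof.
move=> gA wA; have [A' [_ _ _ AA']] := GL_mxeval gA.
have [d d0 hd] := wind_locally_constant G_compact chi_dual mu_haar phiD (@mxeval_bdd A') AA'.
apply: filterS (nbhs_mxeval_close A d0) => X AX gX.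
by have [c' wX] := wind_GL gX; rewrite (hd _ _ _ wA wX AX).
Qed.

Lemma wind_GLM A A' c c' : wind (mxeval A) c -> wind (mxeval A') c' ->
  wind (mxeval (A *m A')) (c + c').
Proof.
move=> wA wA'.
have := windM G_compact chi_dual mu_haar phiD (@mxeval_bdd A) (@mxeval_bdd A') wA wA'.
have -> : mxeval (A *m A') = (fun g => mxeval A g *m mxeval A' g); last by [].
by apply/funext => g; rewrite mxevalM.
Qed.

Lemma GL1 : GL (1%:M : 'M[B]_n).
Proof. by exists 1%:M; rewrite mulmx1. Qed.

Lemma GLM A A' : GL A -> GL A' -> GL (A *m A').
Proof.
move=> [X [AX XA]] [Y [AY YA]]; exists (Y *m X); split.
  by rewrite mulmxA -(mulmxA A) AY mulmx1.
by rewrite mulmxA -(mulmxA Y) XA mulmx1.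
Qed.

Lemma wind1 : wind (mxeval (1%:M : 'M[B]_n)) 0.
Proof.
have [c w] := wind_GL GL1.
(* From [1 * 1 = 1] and uniqueness, [c = c + c]. *)
have w2 := wind_GLM w w; rewrite mulmx1 in w2.
have := wind_GL_uniq GL1 w w2.
by rewrite -{1}[c]addr0 => /addrI cE; rewrite [X in wind _ X]cE.
Qed.

Definition GL0 : set 'M[B]_n := [set A | GL A /\ wind (mxeval A) 0].

Lemma GL0_closed_subgroup : is_closed_subgroup GL0.
Proof.
split.
- by split; [exact: GL1|exact: wind1].
- move=> X Y [gX wX] [gY wY]; split; first exact: GLM.
  by have := wind_GLM wX wY; rewrite addr0.
- move=> X Y [gX wX] XY YX; have gY : GL Y by exists X.
  split=> //; have [c wY] := wind_GL gY.
  have w2 := wind_GLM wX wY; rewrite XY add0r in w2.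
  by rewrite (wind_GL_uniq GL1 wind1 w2).
(* An invertible [A] in the closure has points of [GL0] in the neighbourhood where the class is that
   of [A], so this class is 0. *)
- exists (closure GL0); first exact: closed_closure.
  apply/seteqP; split=> [A [gA wA]|A [clA gA]]; first by split=> //; apply: subset_closure.
  split=> //; have [c wA] := wind_GL gA.
  have [X [[gX wX] /(_ gX) wX']] := clA _ (wind_GL_nbhs gA wA).
  by rewrite (wind_GL_uniq gX wX wX').
Qed.

Lemma wind_path (X Y : 'M[B]_n) c : path_in (R := R) (GL (n := n)) X Y ->
  wind (mxeval X) c -> wind (mxeval Y) c.
Proof.
move=> [gamma [cg g0 g1 gGL]] wX.
pose J := gamma @` `[0, 1].
have cJ : connected J.
  by apply: connected_continuous_connected => //; exact: segment_connected.
have JGL A : J A -> GL A by move=> [t t01 <-]; apply: gGL.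
have JX : J X by exists 0 => //; rewrite /= in_itv /= lexx ler01.
have JY : J Y by exists 1 => //; rewrite /= in_itv /= lexx ler01.
pose U := [set A : 'M[B]_n | GL A -> wind (mxeval A) c].
pose V := [set A : 'M[B]_n | GL A -> ~ wind (mxeval A) c].
(* The matrices of class [c] form a nonempty part of the connected [J]. It is relatively open
   through the interior of [U], and relatively closed because having a class other than [c] is a
   local property as well. *)
have E : [set A | J A /\ wind (mxeval A) c] = J.
  apply: cJ.
  - by exists X.
  - exists (interior U); first exact: open_interior.
    apply/seteqP; split=> A [JA hA]; split=> //; first exact: wind_GL_nbhs (JGL _ JA) hA.
    by have := interior_subset hA; apply; apply: JGL.
  - exists (~` interior V); first by apply: open_closedC; exact: open_interior.
    apply/seteqP; split=> A [JA hA]; split=> //.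
      by move=> /interior_subset /(_ (JGL _ JA)).
    apply: contrapT => nw; apply: hA; have [c' wA] := wind_GL (JGL _ JA).
    apply: filterS (wind_GL_nbhs (JGL _ JA) wA) => A' w' gA' wA'.
    by apply: nw; rewrite (wind_GL_uniq gA' wA' (w' gA')).
by have [_ wY] : [set A | J A /\ wind (mxeval A) c] Y by rewrite E.
Qed.

End matrices.
End admissible_algebra.

(** * Diagonal matrices of characters *)

Section diagonal.
Context {R : realType} {G : topologicalZmodType} {Gamma : zmodType}.
Context (chi : Gamma -> G -> R[i]) (mu : probability (borel G) R).
Hypothesis G_compact : compact [set: G].
Hypothesis chi_dual : is_character_group chi.
Hypothesis mu_haar : is_haar mu.
Local Notation C := R[i].
Variable phi : 'I_3 -> Gamma -> C.
Hypothesis phiD : forall i x y, phi i (x + y) = phi i x + phi i y.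
Variable n : nat.
Local Notation M := 'M[C]_n.
Implicit Types j : 'I_n -> Gamma.

Definition diagp j : seq (M * Gamma) := [seq (delta_mx k k, j k) | k <- enum 'I_n].

Lemma sum_diag (a : 'I_n -> C) : \sum_k a k *: delta_mx k k = diag_mx (\row_k a k) :> M.
Proof.
apply/matrixP => i l; rewrite summxE !mxE (bigD1 i) //= big1 => [|k ki].
  by rewrite !mxE eqxx /= addr0 eq_sym mulr_natr.
by rewrite !mxE [i == k]eq_sym (negPf ki) mulr0.
Qed.

Lemma mev_diagp j g : mev chi (diagp j) g = diag_mx (\row_k chi (j k) g).
Proof. by rewrite /mev /diagp big_map big_enum /= sum_diag. Qed.

Lemma mevD_diagp p j g : mevD chi p (diagp j) g = diag_mx (\row_k (p (j k) * chi (j k) g)).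
Proof. by rewrite /mevD /diagp big_map big_enum /= sum_diag. Qed.

Lemma diagp_inv j g : mev chi (diagp j) g *m mev chi (diagp (fun k => - j k)) g = 1%:M.
Proof.
rewrite !mev_diagp mulmx_diag -diag_const_mx; congr diag_mx; apply/rowP => k.
by rewrite !mxE mulrC (chiNK chi_dual).
Qed.

Lemma wind_diag j : wind chi mu phi (fun g => diag_mx (\row_k chi (j k) g)) 0.
Proof.
have -> : (fun g => diag_mx (\row_k chi (j k) g)) = mev chi (diagp j).
  by apply/funext => g; rewrite mev_diagp.
apply: deg_wind.
have near1 g : mxN (1%:M - mev chi (diagp j) g *m mev chi (diagp (fun k => - j k)) g) <= 1 / 4.
  by rewrite diagp_inv subrr mxN0; lra.
have sm := smooth_mev chi_dual phiD (S := setT) I (fun _ _ _ _ => I) (fun _ _ => I) (fun _ _ => I)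
  near1 (diagp_inv j).
exists (fun i => mevD chi (phi i) (diagp j)),
  (fun i l => mevD chi (phi i) (derp (phi l) (diagp j))), (mev chi (diagp (fun k => - j k))).
split; first exact: sm.
refine (etrans (esym (Cint_cst mu 0)) _); apply: Cint_ext => g.
rewrite !mevD_diagp mev_diagp !mulmx_diag /cubic [X in _ *m (_ - X)]diag_mxC subrr mulmx0.
by rewrite raddf0.
Qed.

End diagonal.

(** * Polynomials in the algebra, and the class of factorable matrices *)

Section main.
Context {R : realType} {G : topologicalZmodType} {Gamma : zmodType}.
Context (chi : Gamma -> G -> R[i]) (mu : probability (borel G) R).
Hypothesis G_compact : compact [set: G].
Hypothesis chi_dual : is_character_group chi.
Hypothesis mu_haar : is_haar mu.
Context (B : comBanachAlgType R[i]) (iota : B -> G -> R[i]).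
Hypothesis B_adm : admissible chi iota.
Local Notation C := R[i].
Variable phi : 'I_3 -> Gamma -> C.
Hypothesis phiD : forall i x y, phi i (x + y) = phi i x + phi i y.
Local Notation wind := (@wind R G Gamma chi mu _ phi).
Local Notation mxeval := (@mxeval R G B iota).

Lemma realize_mev n (s : seq ('M[C]_n * Gamma)) :
  exists A : 'M[B]_n, forall g, mxeval A g = mev chi s g.
Proof.
have /choice[a ha] : forall ij : 'I_n * 'I_n, exists a : B, iota a = (fun g => mev chi s g ij.1 ij.2).
  move=> ij; have [a _ <-] : range iota (fun g => mev chi s g ij.1 ij.2); last by exists a.
  apply: (adm_trig_poly B_adm).
  exists (size s), (fun k => (tnth (in_tuple s) k).1 ij.1 ij.2), (fun k => (tnth (in_tuple s) k).2).
  apply/funext => g; rewrite /mev summxE big_tnth; apply: eq_bigr => k _.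
  by rewrite mxE mulrC.
exists (\matrix_(i, j) a (i, j)) => g; apply/matrixP => i j.
by rewrite !mxE ha.
Qed.

(** The determinant is an element of [B] that vanishes nowhere; inverse closedness inverts it in
    [B], and the adjugate does the rest. *)
Lemma GL_of_unit n (A : 'M[B]_n) : (forall g, mxeval A g \in unitmx) -> GL A.
Proof.
move=> Au.
have detE g : iota (\det A) g = \det (mxeval A g).
  have sgn (b : bool) : iota ((-1) ^+ b) g = (-1) ^+ b.
    by case: b; rewrite ?expr0 ?expr1 ?(iotaN B_adm) (iota1 B_adm).
  rewrite /determinant (iota_sum B_adm); apply: eq_bigr => s _.
  rewrite (iotaM B_adm) sgn; congr (_ * _).
  elim/big_rec2: _ => [|i y z _ <-]; first exact: (iota1 B_adm).
  by rewrite (iotaM B_adm) mxE.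
have det0 g : iota (\det A) g != 0.
  by rewrite detE -unitfE; have := Au g; rewrite unitmxE.
have [b hb] : exists b : B, \det A * b = 1.
  apply: (adm_inverse_closed B_adm); exists (fun g => (iota (\det A) g)^-1); split.
    move=> g; apply: (@cvgV C _ _ _ _ _ (det0 g)); exact: (adm_continuous B_adm).
  by move=> g; rewrite divff.
exists (b *: \adj A); split.
  by rewrite -scalemxAr mul_mx_adj scale_scalar_mx mulrC hb.
by rewrite -scalemxAl mul_adj_mx scale_scalar_mx mulrC hb.
Qed.

Lemma wind_mev n (s : seq ('M[C]_n * Gamma)) A A' : A *m A' = 1%:M ->
  (forall g, mxeval A g = mev chi s g) ->
  wind (mxeval A) (wz mu (fun i => mevD chi (phi i) s) (mxeval A')).
Proof.
move=> AA' As.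
have -> : mxeval A = mev chi s by apply/funext.
have sX g : mev chi s g *m mxeval A' g = 1%:M by rewrite -As -(mxevalM B_adm) AA' (mxeval1 B_adm).
have [K hK] := mev_bounded chi_dual s.
have K0 : 0 <= K := le_trans (mxN_ge0 _) (hK 0).
have e0 : 0 < 1 / (4 * (K + 1)) by rewrite divr_gt0 //; lra.
have [t _ ht] := mxeval_approx B_adm A' e0.
apply: deg_wind.
have near1 g : mxN (1%:M - mev chi s g *m mev chi t g) <= 1 / 4.
  have -> : 1%:M - mev chi s g *m mev chi t g = mev chi s g *m (mxeval A' g - mev chi t g).
    by rewrite mulmxBr sX.
  apply: le_trans (mxNM _ _) _.
  have -> : 1 / 4 = (K + 1) * (1 / (4 * (K + 1))) :> R by field; rewrite gt_eqF // ltr_wpDl.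
  by apply: (ler_pM (mxN_ge0 _) (mxN_ge0 _) _ (ht g)); have := hK g; lra.
have sm := smooth_mev chi_dual phiD (S := setT) I (fun _ _ _ _ => I) (fun _ _ => I) (fun _ _ => I)
  near1 sX.
by exists (fun i => mevD chi (phi i) s), (fun i l => mevD chi (phi i) (derp (phi l) s)), (mxeval A').
Qed.

Variable le : rel Gamma.
Hypothesis le_order : is_group_order le.

Lemma leD0 x y : le 0 x -> le 0 y -> le 0 (x + y).
Proof.
have [_ _ tr _ add] := le_order => x0 y0; apply: (tr y) => //.
by have := add _ _ y x0; rewrite add0r.
Qed.

Lemma geD0 x y : le x 0 -> le y 0 -> le (x + y) 0.
Proof.
have [_ _ tr _ add] := le_order => x0 y0; apply: (tr y) => //.
by have := add _ _ y x0; rewrite add0r.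
Qed.

Lemma le0_sum0 x y : le 0 x -> le 0 y -> x + y = 0 -> y = 0.
Proof.
have [_ anti _ _ add] := le_order => x0 y0 xy; apply: anti; rewrite y0 andbT.
by have := add _ _ y x0; rewrite add0r xy.
Qed.

Lemma ge0_sum0 x y : le x 0 -> le y 0 -> x + y = 0 -> y = 0.
Proof.
have [_ anti _ _ add] := le_order => x0 y0 xy; apply: anti; rewrite y0 /=.
by have := add _ _ y x0; rewrite add0r xy.
Qed.

Lemma le00 : le 0 0. Proof. by have [r _ _ _ _] := le_order. Qed.

Lemma GL_in_wind0 n (S : set Gamma) (A : 'M[B]_n) : S 0 -> (forall x y, S x -> S y -> S (x + y)) ->
  (forall x y, S x -> S y -> x + y = 0 -> y = 0) ->
  GL_in [set a | spectrum chi mu (iota a) `<=` S] A -> GL0 chi mu iota phi A.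
Proof.
move=> S0 SD pos [A' [AA' A'A SA SA']]; split; first by exists A'.
apply: (wind_pos G_compact chi_dual mu_haar phiD S0 SD pos (X := mxeval A')).
- exact: (mxeval_approx_spectrum G_compact chi_dual mu_haar B_adm SA).
- exact: (mxeval_approx_spectrum G_compact chi_dual mu_haar B_adm SA').
- by move=> g; rewrite -(mxevalM B_adm) AA' (mxeval1 B_adm).
Qed.

Lemma GLF_sub_GL0 n : GLF chi mu le iota (n := n) `<=` GL0 chi mu iota phi (n := n).
Proof.
move=> A [Am [Ap [j [hm hp E]]]].
have [gm wm] := GL_in_wind0 (S := [set x | le x 0]) le00 geD0 ge0_sum0 hm.
have [gp wp] := GL_in_wind0 (S := [set x | le 0 x]) le00 leD0 le0_sum0 hp.
(* The diagonal factor is given only as a function on [G]; it is realized in [GL] over [B] so that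
   the factorization becomes a product of matrices over [B]. *)
have [D hD] := realize_mev (@diagp R Gamma n j).
have DE : mxeval D = (fun g => diag_mx (\row_k chi (j k) g)).
  by apply/funext => g; rewrite hD mev_diagp.
have gD : GL D.
  apply: GL_of_unit => g; rewrite hD.
  by have /mulmx1_unit[] := diagp_inv chi_dual j g.
have wD : wind (mxeval D) 0.
  by rewrite DE; exact: (wind_diag mu chi_dual phiD j).
have -> : A = Am *m D *m Ap.
  by apply: (mxeval_inj B_adm) => g; rewrite !(mxevalM B_adm) E DE.
split; first by apply: GLM => //; apply: GLM.
have := wind_GLM G_compact chi_dual mu_haar B_adm phiD
  (wind_GLM G_compact chi_dual mu_haar B_adm phiD wm wD) wp.
by rewrite !addr0.
Qed.

End main.

Section generator_in_algebra.
Context {R : realType} {G : topologicalZmodType} {Gamma : zmodType}.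
Context (chi : Gamma -> G -> R[i]) (mu : probability (borel G) R).
Hypothesis G_compact : compact [set: G].
Hypothesis chi_dual : is_character_group chi.
Hypothesis mu_haar : is_haar mu.
Context (B : comBanachAlgType R[i]) (iota : B -> G -> R[i]).
Hypothesis B_adm : admissible chi iota.
Local Notation C := R[i].
Variable phi : 'I_3 -> Gamma -> C.
Hypothesis phiD : forall i x y, phi i (x + y) = phi i x + phi i y.
Variable e : 'I_3 -> Gamma.
Hypothesis phi_e : forall i j, phi i (e j) = (i == j)%:R.
Local Notation mxeval := (@mxeval R G B iota).

Lemma wind_neq0_exists m : exists (A : 'M[B]_(2 + m)) (c : C),
  [/\ GL A, wind chi mu phi (mxeval A) c & c != 0].
Proof.
have [A hA] := realize_mev B_adm (@genp R Gamma e m).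
have gA : GL A.
  apply: (GL_of_unit B_adm) => g; rewrite hA.
  by have /mulmx1_unit[] := genp_inv chi_dual e m g.
have [A' [_ AA' _ sX]] := GL_mxeval B_adm gA.
exists A, (wz mu (fun i => mevD chi (phi i) (genp e m)) (mxeval A')); split=> //.
  exact: (wind_mev mu chi_dual B_adm phiD AA' hA).
apply: (wz_genp G_compact chi_dual mu_haar phiD phi_e).
  by move=> i j; have := cont_iota B_adm (a := A' i j); congr cont; apply/funext => g; rewrite mxE.
by move=> g; rewrite -hA.
Qed.

End generator_in_algebra.

Theorem theorem2p1 (R : realType) (Gamma : zmodType)
    (Gamma_tf : torsion_free Gamma) (Gamma_Z3 : contains_Z3 Gamma)
    (G : topologicalZmodType)
    (G_compact : compact [set: G]) (G_hausdorff : hausdorff_space G)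
    (G_connected : connected [set: G])
    (chi : Gamma -> G -> R[i]) (chi_dual : is_character_group chi)
    (mu : probability (borel G) R) (mu_haar : is_haar mu)
    (le : rel Gamma) (le_order : is_group_order le)
    (B : comBanachAlgType R[i]) (iota : B -> G -> R[i])
    (B_admissible : admissible chi iota)
    (n : nat) (n_ge2 : (2 <= n)%N) :
  let GLB : set 'M[B]_n := GL (n := n) in
  let H : set 'M[B]_n :=
    smallest is_closed_subgroup (GLF chi mu le iota (n := n)) in
  infinite_set [set C : set 'M[B]_n |
    is_path_component GLB C /\ C `&` H = set0] /\
  ~ (GLB `<=` closure H).
Proof.
move=> GLB H.
have [f f_inj] := Gamma_Z3.
have [phi [phiD phi_f]] := coordinate_extension R[i] f_inj.
pose e j : Gamma := f (delta_mx 0 j).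
case: n n_ge2 @GLB @H => [|[|m]] // _ GLB H.
have [A [c [gA wA c0]]] : exists (A : 'M[B]_(m.+2)) (c : R[i]),
    [/\ GL A, wind chi mu phi (mxeval iota A) c & c != 0].
  exact: (wind_neq0_exists G_compact chi_dual mu_haar B_admissible phiD (e := e) phi_f m).
have HGL0 : H `<=` GL0 chi mu iota phi (n := m.+2).
  apply: smallest_sub; first exact: (GL0_closed_subgroup G_compact chi_dual mu_haar B_admissible phiD).
  exact: (GLF_sub_GL0 G_compact chi_dual mu_haar B_admissible phiD le_order).
(* The powers of [A], of class [c *+ k]. *)
pose P k := iter k (mulmx A) 1%:M.
have gP k : GL (P k).
  by elim: k => [|k ih]; [exact: GL1|exact: GLM].
have wP k : wind chi mu phi (mxeval iota (P k)) (c *+ k).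
  elim: k => [|k ih]; first by rewrite mulr0n; exact: (wind1 G_compact chi_dual mu_haar B_admissible phiD).
  by rewrite mulrS; exact: (wind_GLM G_compact chi_dual mu_haar B_admissible phiD wA ih).
have path_wind X Y d : path_in (R := R) GLB X Y -> wind chi mu phi (mxeval iota X) d ->
    wind chi mu phi (mxeval iota Y) d.
  exact: (wind_path G_compact chi_dual mu_haar B_admissible phiD).
have wuniq (X : 'M[B]_m.+2) d d' : GL X -> wind chi mu phi (mxeval iota X) d ->
    wind chi mu phi (mxeval iota X) d' -> d = d'.
  exact: (wind_GL_uniq G_compact chi_dual mu_haar B_admissible phiD).
have path_refl X : GL X -> path_in (R := R) GLB X X.
  move=> gX; exists (fun=> X); split=> //.
  by apply: continuous_subspaceT => t; exact: cvg_cst.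
(* The index is shifted because the component of [P 0 = 1] meets [H]. *)
pose comp k := [set Y | path_in (R := R) GLB (P k.+1) Y].
split.
  move=> fin.
  have inj_comp : injective comp.
    (* Equal components give [c *+ k.+1 = c *+ l.+1], hence [k = l] since [c] is nonzero in
       characteristic 0. *)
    move=> k l kl; have : comp l (P k.+1) by rewrite -kl; exact: path_refl.
    move=> /path_wind /(_ (wP _)) w; have := wuniq _ _ _ (gP _) (wP _) w.
    by move=> /(mulrIn c0) [->].
  have fpre := finite_preimage (f := comp) (fun k l _ _ => inj_comp k l) fin.
  apply: infinite_nat; apply: sub_finite_set fpre.
  move=> k _ /=; split; first by exists (P k.+1); [exact: gP|].
  rewrite -subset0 => Y [PY HY] /=; have [gY wY] := HGL0 _ HY.
  have := wuniq _ _ _ gY wY (path_wind _ _ _ PY (wP _)).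
  by move/esym/eqP; rewrite mulrn_eq0 (negPf c0).
move=> dense.
(* Density would put an element of [H], of class 0, into the neighbourhood of [A] where the class is
   [c]. *)
have [X [HX /(_ _)wX]] := dense A gA _ (wind_GL_nbhs G_compact chi_dual mu_haar B_admissible phiD gA wA).
have [gX w0] := HGL0 _ HX.
by move/eqP: c0; apply; rewrite (wuniq _ _ _ gX (wX gX) w0).
Qed.
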